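(* Let $\mathbb{X}$ be a Polish space, $H$ a probability measure on $\mathbb{X}$, and $\mathfrak{q}$ an EPPF whose associated Kingman weights sum to $1$ almost surely. For a sequence $(\xi_n)_{n\ge1}$ of $\mathbb{X}$-valued random variables the following are equivalent (auxiliary random variables in (ii) and (iii) being defined on a possibly enlarged probability space, and the identities for $\xi_n$ holding almost surely): (i) $(\xi_n)_{n\ge1}$ is a $gSSS(\mathfrak{q},H)$. (ii) For every $n\ge1$, $\xi_n=Z_{I_n}$, where $(Z_j)_{j\ge1}$ are i.i.d. random variables with common distribution $H$; $(p_j)_{j\ge1}$ is a sequence of random weights in $[0,1]$ with $\sum_j p_j=1$ a.s., independent of $(Z_j)_{j\ge1}$; the positive-integer-valued random variables $(I_n)_{n\ge1}$ are conditionally independent given $(p_j)_{j\ge1}$ and $(Z_j)_{j\ge1}$ with $P\{I_n=k\mid (p_j)_{j\ge1},(Z_j)_{j\ge1}\}=p_k$ for all $k\geq 1$; moreover the EPPF associated via Kingman's correspondence to the decreasing rearrangement $(p_j^{\downarrow})_{j\ge1}$ of $(p_j)_{j\geq 1}$ is $\mathfrak{q}$. (iii) For every $n\ge1$, $\xi_n=Z'_{\mathscr{C}_n(\Pi)}$, where $\Pi$ is an exchangeable random partition of $\mathbb{N}$ with EPPF $\mathfrak{q}$, $(Z'_j)_{j\ge1}$ are i.i.d. random variables with common distribution $H$, and $\Pi$ and $(Z'_j)_{j\ge1}$ are stochastically independent.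
   Context: A partition $\pi_n=[\pi_{1,n},\dots,\pi_{k,n}]$ of $[n]=\{1,\dots,n\}$ has its (nonempty, disjoint) blocks listed in increasing order of their smallest elements (order of appearance). A random partition of $\mathbb{N}$ is a sequence $\Pi=(\Pi_n)_{n\ge1}$, with $\Pi_n$ a random partition of $[n]$, such that for $m<n$ the restriction of $\Pi_n$ to $[m]$ is $\Pi_m$. It is exchangeable if $\Pi_n$ and $\rho(\Pi_n)$ have the same law for every $n$ and every permutation $\rho$ of $[n]$ (acting on blocks elementwise). Its EPPF (exchangeable partition probability function) is the unique symmetric function $\mathfrak{q}$ on finite sequences of positive integers such that $P\{\Pi_n=\pi_n\}=\mathfrak{q}(|\pi_{1,n}|,\dots,|\pi_{k,n}|)$ for every partition $\pi_n$ of $[n]$ with $k$ blocks. Kingman's correspondence: if $\Pi$ is exchangeable with EPPF $\mathfrak{q}$ and $|\Pi^{\downarrow}_{j,n}|$, $j\ge1$, denote the block sizes of $\Pi_n$ in decreasing order (padded by zeros), then $|\Pi^{\downarrow}_{j,n}|/n\to p_j^{\downarrow}$ a.s. for all $j$, for random weights $p_1^{\downarrow}\ge p_2^{\downarrow}\ge\dots\ge0$ with $\sum_j p_j^{\downarrow}\le1$; the map sending $\mathfrak{q}$ to the law of $(p_j^{\downarrow})_j$ is a bijection between EPPFs and laws on such ranked sequences. These are the Kingman weights of $\mathfrak{q}$. $SSrp(\mathfrak{q},H)$ is the law of the random probability measure $P=\sum_{j\ge1}p_j\delta_{Z_j}$, where $(Z_j)_{j\ge1}$ are i.i.d. with law $H$,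 $(p_j)_{j\ge1}$ are random weights in $[0,1]$ with $\sum_jp_j=1$ a.s., independent of $(Z_j)_{j\ge1}$, and the EPPF corresponding via Kingman to the decreasing rearrangement of $(p_j)_j$ is $\mathfrak{q}$. A sequence $(\xi_n)_{n\ge1}$ is a $gSSS(\mathfrak{q},H)$ (generalized species sampling sequence) if it is exchangeable with directing random measure $P\sim SSrp(\mathfrak{q},H)$, i.e. the $\xi_n$ are conditionally i.i.d. given $P$ with common law $P$. The measure $H$ may have atoms. For a random partition $\Pi$ of $\mathbb{N}$, $\mathscr{C}_n(\Pi)$ is the index (in order of appearance) of the block containing $n$: $\mathscr{C}_n(\Pi)=c$ if $n\in\Pi_{c,n}$. *)

(* Defs.v *)
(* Indexing starts at 0 throughout: the element i of
   {1,...,n} is i-1 : 'I_n, the n-th term of a sequence indexed by n >= 1 is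
   its value at n-1, and blocks are numbered from 0 in order of appearance. *)
From HB Require Import structures.
From mathcomp Require Import all_boot all_order all_algebra all_fingroup.
From mathcomp Require Import all_classical all_reals all_analysis.

Set Implicit Arguments.
Unset Strict Implicit.
Unset Printing Implicit Defensive.

Import Order.TTheory GRing.Theory Num.Theory.
Import numFieldNormedType.Exports.

Local Open Scope classical_set_scope.
Local Open Scope ring_scope.

Definition is_metric (R : realType) (T : Type) (dist : T -> T -> R) : Prop :=
  [/\ forall x y, dist x y = 0 <-> x = y,
      forall x y, dist x y = dist y x &
      forall x y z, dist x z <= dist x y + dist y z].

Definition metrizes (R : realType) (T : topologicalType) (dist : T -> T -> R)
    : Prop :=
  forall (x : T) (U : set T),
    nbhs x U <-> exists2 e : R, 0 < e & [set y | dist x y < e] `<=` U.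

Definition metric_complete (R : realType) (T : topologicalType)
    (dist : T -> T -> R) : Prop :=
  forall u : nat -> T,
    (forall e : R, 0 < e -> exists N : nat, forall m n : nat,
        (N <= m)%N -> (N <= n)%N -> dist (u m) (u n) < e) ->
    exists l : T, u @ \oo --> l.

Definition polish (R : realType) (T : topologicalType) : Prop :=
  (exists2 D : set T, countable D & dense D) /\
  (exists dist : T -> T -> R,
     [/\ is_metric dist, metrizes dist & metric_complete dist]).

Definition borel (T : ptopologicalType) := g_sigma_algebraType (@open T).

Definition cylinders (d : measure_display) (T : measurableType d)
    : set (set (nat -> T)) :=
  \bigcup_n preimage_set_system setT (fun s : nat -> T => s n) measurable.

Definition seqspace (d : measure_display) (T : measurableType d) :=
  g_sigma_algebraType (@cylinders d T).

Section probability.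
Context (R : realType) (d : measure_display) (Om : measurableType d).
Variable P : probability Om R.

Definition seq_law (d' : measure_display) (T : measurableType d')
    (X : nat -> {RV P >-> T}) (B : set (seqspace T)) : \bar R :=
  P [set w | B (fun n => X n w)].

Definition seq_sigma (d' : measure_display) (T : measurableType d')
    (X : nat -> {RV P >-> T}) : set (set Om) :=
  <<s \bigcup_n preimage_set_system setT (X n) measurable >>.

Definition indep_systems (F G : set (set Om)) : Prop :=
  forall A B : set Om, F A -> G B -> P (A `&` B) = (P A * P B)%E.

Definition iid (d' : measure_display) (T : measurableType d')
    (Z : nat -> {RV P >-> T}) (H : probability T R) : Prop :=
  (forall (j : nat) (B : set T), measurable B -> P (Z j @^-1` B) = H B) /\
  (forall (s : seq nat) (B : nat -> set T),
     uniq s -> (forall i, measurable (B i)) ->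
     P (\bigcap_(i in [set` s]) (Z i @^-1` B i)) =
     (\prod_(i <- s) P (Z i @^-1` B i))%E).

(* f is a version of the conditional probability P(A | F). *)
Definition cond_prob (F : set (set Om)) (A : set Om) (f : Om -> R) : Prop :=
  [/\ forall B : set R, measurable B -> F (f @^-1` B),
      P.-integrable setT (EFin \o f) &
      forall C : set Om, F C -> (\int[P]_(w in C) (f w)%:E = P (A `&` C))%E].

(* Any two versions of a conditional probability agree almost surely, so that
   it is immaterial which versions f i are used. *)
Definition cond_indep (F : set (set Om)) (d' : measure_display)
    (T : measurableType d') (X : nat -> {RV P >-> T}) : Prop :=
  forall (s : seq nat) (B : nat -> set T) (f : nat -> Om -> R),
    uniq s -> (forall i, measurable (B i)) ->
    (forall i, cond_prob F (X i @^-1` B i) (f i)) ->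
    cond_prob F (\bigcap_(i in [set` s]) (X i @^-1` B i))
      (fun w => \prod_(i <- s) f i w).

End probability.

Definition least (n : nat) (B : {set 'I_n}) : nat :=
  (\big[minn/n]_(i in B) (i : nat))%N.

Definition blocks (n : nat) (pi : {set {set 'I_n}}) : seq {set 'I_n} :=
  sort (relpre (@least n) leq) (enum pi).

Definition restrict_partition (m n : nat) (le_mn : (m <= n)%N)
    (pi : {set {set 'I_n}}) : {set {set 'I_m}} :=
  ([set widen_ord le_mn @^-1: B | B : {set 'I_n} in pi] :\ finset.set0)%SET.

Definition permute_partition (n : nat) (rho : 'S_n) (pi : {set {set 'I_n}})
    : {set {set 'I_n}} :=
  [set rho @: B | B : {set 'I_n} in pi]%SET.

(* Size of the j-th largest block, 0 if there are at most j blocks. *)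
Definition ranked_block_size (n : nat) (pi : {set {set 'I_n}}) (j : nat)
    : nat :=
  nth 0%N (sort geq [seq #|(B : {set 'I_n})| | B <- enum pi]) j.

Section random_partitions.
Context (R : realType) (d : measure_display) (Om : measurableType d).
Variable P : probability Om R.
Implicit Type Pi : forall n : nat, Om -> {set {set 'I_n}}.

Definition random_partition Pi : Prop :=
  [/\ forall n (pi : {set {set 'I_n}}), measurable (Pi n @^-1` [set pi]),
      forall n w, finset.partition (Pi n w) [set: 'I_n]%SET &
      forall (m n : nat) (le_mn : (m <= n)%N) w,
        restrict_partition le_mn (Pi n w) = Pi m w].

Definition exchangeable_partition Pi : Prop :=
  forall (n : nat) (rho : 'S_n) (pi : {set {set 'I_n}}),
    P [set w | permute_partition rho (Pi n w) = pi] = P [set w | Pi n w = pi].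

Definition partition_sigma Pi : set (set Om) :=
  <<s \bigcup_n preimage_set_system setT (Pi n)
        [set: set {set {set 'I_n}}] >>.

(* Only the values of q on sequences of positive integers are relevant. *)
Definition has_eppf Pi (q : seq nat -> R) : Prop :=
  (forall s t : seq nat, all (leq 1) s -> perm_eq s t -> q s = q t) /\
  (forall (n : nat) (pi : {set {set 'I_n}}), (0 < n)%N ->
     finset.partition pi [set: 'I_n]%SET ->
     P [set w | Pi n w = pi] =
     (q [seq #|(B : {set 'I_n})| | B <- blocks pi])%:E).

Definition exchangeable_with_eppf Pi (q : seq nat -> R) : Prop :=
  [/\ random_partition Pi, exchangeable_partition Pi & has_eppf Pi q].

Definition kingman_weights Pi (w : nat -> {RV P >-> R}) : Prop :=
  {ae P, forall x, forall j : nat,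
    (fun n : nat => (ranked_block_size (Pi n x) j)%:R / n%:R : R) @ \oo
      --> w j x}.

(* ord_max : 'I_n.+1 is the (n+1)-st element, so this is C_(n+1)(Pi) - 1. *)
Definition class_index Pi (n : nat) (w : Om) : nat :=
  find (fun B : {set 'I_n.+1} => ord_max \in B) (blocks (Pi n.+1 w)).

End random_partitions.

(* q and L correspond to each other in Kingman's correspondence: L is the law
   of the Kingman weights of an exchangeable random partition with EPPF q. *)
Definition kingman (R : realType) (q : seq nat -> R)
    (L : set (seqspace R) -> \bar R) : Prop :=
  exists (d : measure_display) (Om : measurableType d) (P : probability Om R)
    (Pi : forall n : nat, Om -> {set {set 'I_n}})
    (w : nat -> {RV P >-> R}),
    [/\ exchangeable_with_eppf P Pi q, kingman_weights Pi w &
        forall B : set (seqspace R), measurable B -> seq_law w B = L B].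

Definition proper_eppf (R : realType) (q : seq nat -> R) : Prop :=
  exists2 L : probability (seqspace R) R,
    kingman q L &
    {ae L, forall s : seqspace R,
       (\sum_(0 <= j <oo) ((s : nat -> R) j)%:E = 1)%E}.

(* s is p rearranged in decreasing order; if p has infinitely many positive
   terms then its zero terms do not appear in s. *)
Definition decreasing_rearrangement (R : realType) (p s : nat -> R) : Prop :=
  [/\ forall i j : nat, (i <= j)%N -> s j <= s i,
      forall j, 0 <= s j &
      exists2 f : nat -> nat,
        set_bij [set j | 0 < s j] [set i | 0 < p i] f &
        forall j, 0 < s j -> p (f j) = s j].

Section species_sampling.
Context (R : realType) (d : measure_display) (Om : measurableType d).
Variable P : probability Om R.

Definition random_weights (p : nat -> {RV P >-> R}) : Prop :=
  (forall j w, 0 <= p j w <= 1) /\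
  {ae P, forall w, (\sum_(0 <= j <oo) (p j w)%:E = 1)%E}.

Definition weights_eppf (p : nat -> {RV P >-> R}) (q : seq nat -> R) : Prop :=
  exists s : nat -> {RV P >-> R},
    {ae P, forall w, decreasing_rearrangement (p^~ w) (s^~ w)} /\
    kingman q (seq_law s).

Definition species_data (X : ptopologicalType) (q : seq nat -> R)
    (H : probability (borel X) R) (p : nat -> {RV P >-> R})
    (Z : nat -> {RV P >-> borel X}) : Prop :=
  [/\ iid Z H, random_weights p,
      indep_systems P (seq_sigma p) (seq_sigma Z) & weights_eppf p q].

End species_sampling.

(* L is the law SSrp(q, H).  The random measure \sum_j p_j \d_(Z_j) is a
   probability measure almost surely; mu is any random probability measure
   that is almost surely equal to it. *)
Definition is_SSrp (R : realType) (X : ptopologicalType) (q : seq nat -> R)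
    (H : probability (borel X) R)
    (L : set (pprobability (borel X) R) -> \bar R) : Prop :=
  exists (d : measure_display) (Om : measurableType d) (P : probability Om R)
    (p : nat -> {RV P >-> R}) (Z : nat -> {RV P >-> borel X})
    (mu : {RV P >-> pprobability (borel X) R}),
    [/\ species_data q H p Z,
        {ae P, forall w, forall A : set (borel X), measurable A ->
          (mu w : probability (borel X) R) A =
          (\sum_(0 <= j <oo) (p j w)%:E * \d_(Z j w) A)%E} &
        forall B : set (pprobability (borel X) R), measurable B ->
          L B = distribution P mu B].

Section representations.
Context (R : realType) (X : ptopologicalType) (q : seq nat -> R).
Context (H : probability (borel X) R).
Context (d : measure_display) (Om : measurableType d) (P : probability Om R).
Variable xi : nat -> {RV P >-> borel X}.

Definition gSSS : Prop :=
  exists mu : {RV P >-> pprobability (borel X) R},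
    let F := preimage_set_system setT mu measurable in
    [/\ is_SSrp q H (distribution P mu),
        forall (n : nat) (A : set (borel X)), measurable A ->
          cond_prob P F (xi n @^-1` A)
            (fun w => fine ((mu w : probability (borel X) R) A)) &
        cond_indep F xi].

(* (Om', P') enlarges (Om, P) through phi. *)
Definition measure_preserving (d' : measure_display) (Om' : measurableType d')
    (P' : probability Om' R) (phi : {mfun Om' >-> Om}) : Prop :=
  forall A : set Om, measurable A -> P' (phi @^-1` A) = P A.

Definition weights_representation : Prop :=
  exists (d' : measure_display) (Om' : measurableType d')
    (P' : probability Om' R) (phi : {mfun Om' >-> Om})
    (p : nat -> {RV P' >-> R}) (Z : nat -> {RV P' >-> borel X})
    (I : nat -> {RV P' >-> nat}),
    let F := <<s seq_sigma p `|` seq_sigma Z >> in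
    [/\ measure_preserving P' phi,
        species_data q H p Z,
        forall n k : nat, cond_prob P' F (I n @^-1` [set k]) (p k),
        cond_indep F I &
        forall n : nat, {ae P', forall w, xi n (phi w) = Z (I n w) w}].

Definition partition_representation : Prop :=
  exists (d' : measure_display) (Om' : measurableType d')
    (P' : probability Om' R) (phi : {mfun Om' >-> Om})
    (Pi : forall n : nat, Om' -> {set {set 'I_n}})
    (Z : nat -> {RV P' >-> borel X}),
    [/\ measure_preserving P' phi,
        exchangeable_with_eppf P' Pi q,
        iid Z H,
        indep_systems P' (partition_sigma Pi) (seq_sigma Z) &
        forall n : nat,
          {ae P', forall w, xi n (phi w) = Z (class_index Pi n w) w}].

End representations.

(* Main.v *)
(* Every statement reduces to an equality of laws. Given weights p, i.i.d. types
   Z and indices I sampled from p, the blocks {i : I_i = k} form an exchangeable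
   partition whose EPPF is that of Kingman's paintbox, and relabelling the types
   by order of appearance (with fresh copies for the indices that never appear)
   leaves them i.i.d. and independent of the partition; this is (ii) -> (iii),
   and it shows that the law of (Z_(I_n)) depends on q and H only.

   For (iii) -> (i), xi has the law of a sequence Z_(I_n) on an explicit model,
   where the indices are drawn from one uniform variable. There the directing
   measure \sum_k p_k \d_(Z_k) is recovered almost surely from the limiting
   frequencies of the sequence itself, even when H has atoms, and the same
   functional of xi is the directing measure that is needed.

   For (i) -> (ii), xi again has the law of (Z_(I_n)), now with p decreasing.
   The conditional law of the indices given the sequence (Radon-Nikodym) is used
   to draw indices for xi; the weights are then the limiting frequencies of these
   indices, and Z_k is read off from xi at the first time that the index is k, or
   from an independent i.i.d. reserve if k is never drawn. *)

Require Import Defs.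
From HB Require Import structures.
From mathcomp Require Import all_boot all_order all_algebra all_fingroup.
From mathcomp Require Import all_classical all_reals all_analysis.
From mathcomp Require Import measurable_realfun lra.

Set Implicit Arguments.
Unset Strict Implicit.
Unset Printing Implicit Defensive.

Import Order.TTheory GRing.Theory Num.Theory.
Import numFieldNormedType.Exports.

Local Open Scope classical_set_scope.
Local Open Scope ring_scope.

(** * Laws of sequences and independence *)

(** The hypothesis on [q] only provides some exchangeable partition with EPPF [q] and its limiting
    block frequencies, so the paintbox formula has to be derived. One half is proved directly:
    drawing n elements of [N] with replacement instead of without shows that each partition
    probability is at least the truncated paintbox probability. Two probability vectors on the
    finite set of partitions of [n] that dominate the same truncated vectors coincide as soon as the
    mass of the latter tends to 1, which it does because the weights sum to 1. Atoms of [H] are the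
    other obstacle: distinct indices may carry equal types, so neither the indices nor the
    individual weights are functions of the sequence. The directing measure still is, which is
    enough for (i); (ii) asks for indices, and these need additional randomness. Decreasing weights
    serve for (ii) because a rearrangement is a relation between two sequences of variables, whereas
    being decreasing is an event and passes from one space to another through the law alone. *)

Section same_law.
Context (R : realType) (d1 d2 d : measure_display).
Context (Om1 : measurableType d1) (P1 : probability Om1 R).
Context (Om2 : measurableType d2) (P2 : probability Om2 R).

Definition same_law (S : measurableType d) (X : Om1 -> S) (Y : Om2 -> S) : Prop :=
  forall B : set S, measurable B -> P1 (X @^-1` B) = P2 (Y @^-1` B).

Lemma same_law_comp (S : measurableType d) (d' : measure_display)
    (S' : measurableType d') (g : S -> S') (X : Om1 -> S) (Y : Om2 -> S) :
  measurable_fun setT g -> same_law X Y ->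
  forall B : set S', measurable B -> P1 ((g \o X) @^-1` B) = P2 ((g \o Y) @^-1` B).
Proof.
move=> mg XY B mB; apply: (XY (g @^-1` B)).
by rewrite -[_ @^-1` _]setTI; exact: mg.
Qed.

Lemma same_law_integral (S : measurableType d) (X : Om1 -> S) (Y : Om2 -> S)
    (D : set S) (f : S -> \bar R) :
  measurable_fun setT X -> measurable_fun setT Y -> same_law X Y ->
  measurable D -> measurable_fun [set: S] f -> (forall x, 0 <= f x)%E ->
  (\int[P1]_(x in X @^-1` D) f (X x) = \int[P2]_(x in Y @^-1` D) f (Y x))%E.
Proof.
move=> mX mY XY mD mf f0.
have mfD : measurable_fun D f by exact: measurable_funTS.
rewrite -(ge0_integral_pushforward mX)// -(ge0_integral_pushforward mY)//.
by apply: eq_measure_integral => A mA _; exact: XY.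
Qed.

End same_law.

Section measure_uniqueness.
Context (R : realType) (d : measure_display) (T : measurableType d).

Lemma finite_measure_unique (G : set (set T)) (m1 m2 : {measure set T -> \bar R}) :
  G `<=` measurable -> G setT -> setI_closed G ->
  (m1 setT < +oo)%E -> (forall A, G A -> m1 A = m2 A) ->
  forall A, <<s G >> A -> m1 A = m2 A.
Proof.
move=> GT GG GI foo m12 A sA.
(* With [setT] in [G], the constant sequence is an admissible exhaustion of the space. *)
apply: (@g_sigma_algebra_measure_unique _ R T G GT (fun=> setT)) => //.
by apply/seteqP; split=> // x _; exists 0%N.
Qed.

End measure_uniqueness.

Section seqspace.
Context (d : measure_display) (T : measurableType d).

Definition rect (n : nat) (B : nat -> set T) : set (seqspace T) :=
  [set s : nat -> T | forall i, (i < n)%N -> B i (s i)].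

Lemma measurable_coord n : measurable_fun setT (fun s : seqspace T => (s : nat -> T) n).
Proof.
move=> _ B mB; apply: sub_sigma_algebra.
by exists n => //; exists B.
Qed.

Lemma measurable_rect n (B : nat -> set T) : (forall i, measurable (B i)) ->
  measurable (rect n B).
Proof.
move=> mB.
rewrite (_ : rect n B = \bigcap_(i in `I_n) ((fun s : seqspace T => (s : nat -> T) i) @^-1` B i)).
  apply: bigcap_measurableType => i _.
  by rewrite -[X in measurable X]setTI; exact: measurable_coord.
by apply/seteqP; split=> s /= sB i /sB.
Qed.

Definition rects : set (set (seqspace T)) :=
  [set E | exists n (B : nat -> set T), (forall i, measurable (B i)) /\ E = rect n B].

Lemma rectsT : rects setT.
Proof.
exists 0%N, (fun=> setT); split; first by move=> i.
by apply/seteqP; split.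
Qed.

Lemma rectsI : setI_closed rects.
Proof.
move=> _ _ [n [B [mB ->]]] [m [C [mC ->]]].
exists (maxn n m), (fun i => (if (i < n)%N then B i else setT) `&`
   (if (i < m)%N then C i else setT)); split.
  by move=> i; apply: measurableI; case: ifP.
apply/seteqP; split=> s /=.
  move=> [sB sC] i _; split; case: ifPn => // ilt; [exact: sB|exact: sC].
move=> h; split=> i ilt.
  by have := h i; rewrite leq_max ilt => /(_ isT)[].
by have := h i; rewrite leq_max ilt orbT => /(_ isT)[].
Qed.

(** Full sides express the absence of a constraint, so conditions on an initial segment already
    generate every coordinate event. This pi-system is the one on which laws and independence of
    sequences are tested. *)
Lemma measurable_rects : @measurable _ (seqspace T) = <<s rects >>.
Proof.
apply/seteqP; split; last first.
  apply: smallest_sub; first exact: sigma_algebra_measurable.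
  by move=> _ [n [B [mB ->]]]; exact: measurable_rect.
apply: smallest_sub; first exact: smallest_sigma_algebra.
move=> _ [n _ [B mB <-]]; apply: sub_sigma_algebra.
exists n.+1, (fun i => if i == n then B else setT); split.
  by move=> i; case: ifP.
rewrite setTI; apply/seteqP; split=> s /=.
  by move=> sB i _; case: eqP => // ->.
by move=> /(_ n (ltnSn n)); rewrite eqxx.
Qed.

Lemma measurable_seq (d' : measure_display) (Om : measurableType d')
    (X : nat -> Om -> T) : (forall n, measurable_fun setT (X n)) ->
  measurable_fun setT (fun w => (X ^~ w) : seqspace T).
Proof.
move=> mX.
apply: (@measurability _ _ Om (seqspace T) setT _ (@cylinders _ T) erefl).
move=> _ [_ [n _ [B mB <-]] <-].
rewrite !setTI -[X in measurable X]setTI.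
exact: mX.
Qed.

End seqspace.

Section seq_law.
Context (R : realType) (d1 d2 d : measure_display) (T : measurableType d).
Context (Om1 : measurableType d1) (P1 : probability Om1 R).
Context (Om2 : measurableType d2) (P2 : probability Om2 R).

Lemma seq_same_law (X : nat -> Om1 -> T) (Y : nat -> Om2 -> T) :
  (forall n, measurable_fun setT (X n)) -> (forall n, measurable_fun setT (Y n)) ->
  (forall n (B : nat -> set T), (forall i, measurable (B i)) ->
    P1 [set w | forall i, (i < n)%N -> B i (X i w)] =
    P2 [set w | forall i, (i < n)%N -> B i (Y i w)]) ->
  same_law P1 P2 (fun w => (X ^~ w) : seqspace T) (fun w => (Y ^~ w) : seqspace T).
Proof.
move=> mX mY XY B mB.
have mX' := measurable_seq mX; have mY' := measurable_seq mY.
have := @finite_measure_unique R _ (seqspace T) (@rects _ T)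
  (pushforward P1 (mfun_Sub (mem_set mX'))) (pushforward P2 (mfun_Sub (mem_set mY'))).
apply => //.
- by rewrite measurable_rects; exact: sub_sigma_algebra.
- exact: rectsT.
- exact: rectsI.
- by rewrite /= /pushforward preimage_setT probability_setT ltry.
- by move=> _ [n [C [mC ->]]]; exact: XY.
- by rewrite -measurable_rects.
Qed.

End seq_law.

Section independence.
Context (R : realType) (d : measure_display) (Om : measurableType d).
Variable P : probability Om R.

Lemma integral_mrestr (E : set Om) (mE : measurable E) (f : Om -> \bar R) :
  measurable_fun [set: Om] f -> (forall x, 0 <= f x)%E ->
  (\int[mrestr P mE]_x f x = \int[P]_(x in E) f x)%E.
Proof.
move=> mf f0.
rewrite -(setUv E) ge0_integral_setU//=; last 3 first.
- by apply: measurableC.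
- by rewrite setUv.
- exact/disj_setPCl.
rewrite [X in (_ + X)%E](eq_measure_integral mzero) => [|A mA AE]; last first.
  by rewrite /= /mrestr /mzero (_ : A `&` E = set0) ?measure0//; exact/disjoints_subset.
rewrite integral_measure_zero adde0.
apply: eq_measure_integral => A mA AE.
by rewrite /= /mrestr; congr (P _); exact/setIidPl.
Qed.

Lemma fin_num_prob (A : set Om) : measurable A -> P A \is a fin_num.
Proof. by move=> mA; exact: fin_num_measure. Qed.

(** By independence the image under [X] of [P] restricted to [E] is [P E] times the law of [X]; the
    product formula thus passes from events to nonnegative functions. *)
Lemma integral_indep (d' : measure_display) (S : measurableType d') (X : Om -> S)
    (E : set Om) (h : S -> \bar R) :
  measurable_fun setT X -> measurable E ->
  (forall B, measurable B -> P (X @^-1` B `&` E) = (P (X @^-1` B) * P E)%E) ->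
  measurable_fun [set: S] h -> (forall x, 0 <= h x)%E ->
  (\int[P]_(w in E) h (X w) = (\int[P]_w h (X w)) * P E)%E.
Proof.
move=> mX mE XE mh h0.
have PE0 : 0 <= fine (P E) by rewrite fine_ge0.
rewrite -(integral_mrestr mE); last 2 first.
- exact: measurableT_comp.
- by move=> x.
rewrite -[LHS](@ge0_integral_pushforward _ _ _ _ R X mX (mrestr P mE) setT h)//.
rewrite -[in RHS](@ge0_integral_pushforward _ _ _ _ R X mX P setT h)//.
rewrite (eq_measure_integral (mscale (NngNum PE0) (pushforward P X))) => [|A mA _].
  by rewrite ge0_integral_mscale//= fineK ?fin_num_prob// muleC.
by rewrite /= /mscale/= /pushforward /mrestr XE// fineK ?fin_num_prob// muleC.
Qed.

Context (d' : measure_display) (T : measurableType d').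

Lemma indep_rect (X : nat -> Om -> T) (E : set Om) :
  (forall n, measurable_fun setT (X n)) -> measurable E ->
  (forall n (B : nat -> set T), (forall i, measurable (B i)) ->
    P ([set w | forall i, (i < n)%N -> B i (X i w)] `&` E) =
    (P [set w | forall i, (i < n)%N -> B i (X i w)] * P E)%E) ->
  forall B : set (seqspace T), measurable B ->
   P ((fun w => (X ^~ w) : seqspace T) @^-1` B `&` E) =
   (P ((fun w => (X ^~ w) : seqspace T) @^-1` B) * P E)%E.
Proof.
move=> mX mE XE B mB.
have mX' := measurable_seq mX.
have PE0 : 0 <= fine (P E) by rewrite fine_ge0.
have := @finite_measure_unique R _ (seqspace T) (@rects _ T)
  (pushforward (mrestr P mE) (mfun_Sub (mem_set mX')))
  (mscale (NngNum PE0) (pushforward P (mfun_Sub (mem_set mX')))).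
move=> /(_ mX' mX') /(_ _ _ _ _ _ B); rewrite /= /mscale /= /pushforward /mrestr.
rewrite fineK ?fin_num_prob// muleC; apply => //.
- by rewrite measurable_rects; exact: sub_sigma_algebra.
- exact: rectsT.
- exact: rectsI.
- by rewrite preimage_setT setTI ltey_eq fin_num_prob.
- by move=> _ [n [C [mC ->]]]; rewrite [RHS]muleC; exact: XE.
- by rewrite -measurable_rects.
Qed.

Lemma seq_sigmaE (X : nat -> {RV P >-> T}) :
  seq_sigma X = preimage_set_system setT
   (fun w => (fun n => X n w) : seqspace T) measurable.
Proof.
rewrite /measurable/= -g_sigma_preimageE /seq_sigma; congr (<<s _ >>).
apply/seteqP; split=> A.
  move=> [n _ [B mB <-]]; exists ((fun s : nat -> T => s n) @^-1` B) => //.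
  by exists n => //; exists B => //; rewrite setTI.
move=> [_ [n _ [B mB <-]] <-]; exists n => //.
by exists B => //; rewrite !setTI.
Qed.

Lemma seq_sigma_measurable (X : nat -> {RV P >-> T}) : seq_sigma X `<=` measurable.
Proof.
rewrite seq_sigmaE => _ [B mB <-]; apply: (@measurable_seq _ T) => //.
Qed.

Lemma iid_rect (Z : nat -> {RV P >-> T}) (H : probability T R) n B :
  iid Z H -> (forall i, measurable (B i)) ->
  P [set w | forall i, (i < n)%N -> B i (Z i w)] = (\prod_(i < n) H (B i))%E.
Proof.
move=> [ZH Zi] mB.
rewrite (_ : [set w | _] = \bigcap_(i in [set` iota 0 n]) (Z i @^-1` B i)); last first.
  apply/seteqP; split => w /= h i.
    by rewrite /= mem_iota add0n => /h.
  by move=> ilt; apply: h => /=; rewrite mem_iota.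
rewrite Zi ?iota_uniq// -[in LHS]val_enum_ord big_map big_enum.
by apply: eq_bigr => i _; exact: ZH.
Qed.

(** Initial segments are enough: full sides give the marginals, and any finite index set sits inside
    an initial segment. *)
Lemma iidP (Z : nat -> {RV P >-> T}) (H : probability T R) :
  (forall n B, (forall i, measurable (B i)) ->
  P [set w | forall i, (i < n)%N -> B i (Z i w)] = (\prod_(i < n) H (B i))%E) ->
  iid Z H.
Proof.
move=> Zrect.
have ZH (j : nat) (B : set T) : measurable B -> P (Z j @^-1` B) = H B.
  move=> mB; have := Zrect j.+1 (fun i => if i == j then B else setT).
  rewrite (_ : [set w | _] = Z j @^-1` B); last first.
    apply/seteqP; split => w /=.
      by move=> /(_ j (ltnSn j)); rewrite eqxx.
    by move=> jB i _; case: eqP => // ->.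
  move=> ->; last by move=> i; case: ifP.
  rewrite big_ord_recr/= eqxx big1 ?mul1e// => i _.
  by rewrite ifF ?probability_setT//; apply/negbTE; rewrite neq_ltn ltn_ord.
split=> // s B us mB.
under eq_bigr do rewrite ZH//.
pose n := (\max_(i <- s) i).+1.
have sn i : i \in s -> (i < n)%N by move=> si; rewrite /n ltnS; exact: leq_bigmax_seq.
have := Zrect n (fun i => if i \in s then B i else setT).
rewrite (_ : [set w | _] = \bigcap_(i in [set` s]) (Z i @^-1` B i)); last first.
  apply/seteqP; split => w /= h i.
    by move=> /= si; have := h i (sn _ si); rewrite si.
  by move=> ilt; case: ifPn => // si; exact: h.
move=> ->; last by move=> i; case: ifP.
rewrite (bigID (fun i : 'I_n => (i : nat) \in s))/= [X in (_ * X)%E]big1 ?mule1; last first.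
  by move=> i /negbTE ->; rewrite probability_setT.
rewrite -big_filter -(big_map (@nat_of_ord n) xpredT (fun i => H (if i \in s then B i else setT))).
rewrite (perm_big s)/=; last first.
  apply: uniq_perm => //.
    by rewrite map_inj_uniq; [exact/filter_uniq/index_enum_uniq|exact: ord_inj].
  move=> i; apply/mapP/idP.
    by move=> [j]; rewrite mem_filter => /andP[? _] ->.
  move=> si; exists (Ordinal (sn _ si)) => //.
  by rewrite mem_filter /= si mem_index_enum.
by rewrite big_seq [RHS]big_seq; apply: eq_bigr => i ->.
Qed.

End independence.

(** The factor may be infinite: below it is a product of values of [mix], which can be infinite
    where the weights do not sum to 1. *)
Lemma ge0_nneseriesZr (R : realType) (x : \bar R) (f : nat -> \bar R) :
  (0 <= x)%E -> (forall k, 0 <= f k)%E ->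
  (\sum_(0 <= k <oo) (f k * x) = (\sum_(0 <= k <oo) f k) * x)%E.
Proof.
move=> x0 f0; have fx0 k : (0 <= f k * x)%E by rewrite mule_ge0.
case: x x0 fx0 => [x x0 _|_ fx0|//].
  by under eq_eseriesr do rewrite muleC; rewrite nneseriesZl// muleC.
have [f00|/existsNP[k /eqP fk]] := pselect (forall k, f k = 0%E).
  by rewrite !eseries0 ?mul0e// => k _ _; rewrite f00// mul0e.
have fk0 : (0 < f k)%E by rewrite lt0e fk f0.
have gt0 (g : nat -> \bar R) : (forall k, 0 <= g k)%E -> (g k <= \sum_(0 <= k <oo) g k)%E.
  move=> g0; apply: le_trans (nneseries_lim_ge k.+1 _) => //.
  by rewrite big_nat_recr//= leeDr// sume_ge0.
rewrite gt0_muley; last exact: lt_le_trans fk0 (gt0 _ f0).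
by apply/eqP; rewrite -leye_eq (le_trans _ (gt0 _ fx0))// gt0_muley.
Qed.

Lemma emeasurable_prod (R : realType) (d : measure_display) (T : measurableType d)
    (A : set T) (J : Type) (s : seq J) (h : J -> T -> \bar R) :
  (forall i, measurable_fun A (h i)) ->
  measurable_fun A (fun x => (\prod_(i <- s) h i x)%E).
Proof.
move=> mh; elim: s => [|i s IH].
  by under eq_fun do rewrite big_nil; exact: measurable_cst.
by under eq_fun do rewrite big_cons; exact: emeasurable_funM.
Qed.

Lemma measurable_preimage_nat (d : measure_display) (T : measurableType d)
    (f : T -> nat) (B : set nat) :
  (forall k, measurable (f @^-1` [set k])) -> measurable (f @^-1` B).
Proof.
move=> mf; rewrite (_ : f @^-1` B = \bigcup_(k in B) f @^-1` [set k]); last first.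
  by apply/seteqP; split=> w /=; [move=> fB; exists (f w)|move=> [k Bk ->]].
by apply: bigcup_measurable => k _; exact: mf.
Qed.

Lemma measure_nat_partition (R : realType) (d : measure_display)
    (T : measurableType d) (m : {measure set T -> \bar R}) (f : T -> nat) (A : set T) :
  (forall k, measurable (f @^-1` [set k])) -> measurable A ->
  (m A = \sum_(0 <= k <oo) m (A `&` f @^-1` [set k]))%E.
Proof.
move=> mf mA; rewrite -measure_semi_bigcup//.
- rewrite -setI_bigcupr; congr (m _); apply/esym/setIidPl => w _.
  by exists (f w).
- by move=> k; exact: measurableI.
- exact: trivIset_preimage1_in.
- by apply: bigcup_measurable => k _; exact: measurableI.
Qed.

(** * Sampling indices from random weights *)

Section sampling.
Context (R : realType) (d : measure_display) (Om : measurableType d).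
Variables (P : probability Om R) (F : set (set Om)).
Variables (p : nat -> Om -> R) (I : nat -> Om -> nat).

(* the I_i are conditionally independent given F, with P(I_i = k | F) = p_k *)
Definition sampling : Prop := forall C : set Om, F C ->
  forall (s : seq nat) (k : nat -> nat), uniq s ->
  (P (C `&` [set w | forall i, i \in s -> I i w = k i]) =
   \int[P]_(w in C) \prod_(i <- s) (p (k i) w)%:E)%E.

(** The conditional probability given [F] that the event attached to the drawn index occurs, when
    all [E k] belong to [F]. With [E k] the event that [Z k] lies in B, it is the mass that the
    random measure \sum_k p_k \d_(Z_k) gives to B. *)
Definition mix (E : nat -> set Om) (w : Om) : \bar R :=
  (\sum_(0 <= k <oo) ((p k w)%:E * (\1_(E k) w)%:E))%E.

Hypothesis p0 : forall k w, 0 <= p k w.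
Hypothesis mp : forall k, measurable_fun setT (p k).
Hypothesis mI : forall i k, measurable (I i @^-1` [set k]).
Hypothesis Fm : F `<=` measurable.
Hypothesis FI : setI_closed F.
Lemma mix_ge0 E w : (0 <= mix E w)%E.
Proof. by apply: nneseries_ge0 => k _ _; rewrite mule_ge0// lee_fin. Qed.

Lemma measurable_mix E : (forall k, measurable (E k)) -> measurable_fun setT (mix E).
Proof.
move=> mE; apply: ge0_emeasurable_sum => k.
  by move=> w _ _; rewrite mule_ge0// lee_fin.
move=> _; apply: emeasurable_funM; apply/measurable_EFinP => //.
Qed.

(** Indices move one at a time from [s], where they are tested against events, to [t], where their
    value is prescribed, by splitting over the value. The hypothesis concerns only the
    rearrangements of one list [u], so that the lemma also applies when the sampling identity is
    known for a single index set. *)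
Lemma sampling_mix_perm (u : seq nat) s : uniq u ->
  (forall (C : set Om) t (k : nat -> nat), F C -> perm_eq t u ->
    P (C `&` [set w | forall i, i \in t -> I i w = k i]) =
    \int[P]_(w in C) \prod_(i <- t) (p (k i) w)%:E)%E ->
  forall t (C : set Om) (k : nat -> nat) (E : nat -> nat -> set Om),
  F C -> perm_eq (s ++ t) u -> (forall i j, F (E i j)) ->
  (P (C `&` [set w | (forall i, i \in t -> I i w = k i) /\
                    (forall i, i \in s -> E i (I i w) w)]) =
   \int[P]_(w in C) ((\prod_(i <- t) (p (k i) w)%:E) * \prod_(i <- s) mix (E i) w))%E.
Proof.
move=> uu sI; elim: s => [|i s IH] t C k E FC su FE.
  under eq_integral do rewrite big_nil mule1.
  rewrite -sI//; congr (P (_ `&` _)).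
  by apply/seteqP; split=> w /=; [move=> []|].
have mC := Fm FC; have mE i0 j := Fm (FE i0 j).
pose A := C `&` [set w | (forall j, j \in t -> I j w = k j) /\
                    (forall j, j \in i :: s -> E j (I j w) w)].
have mA : measurable A.
  apply: measurableI => //.
  rewrite (_ : [set w | _] = (\bigcap_(j in [set` t]) I j @^-1` [set k j]) `&`
    \bigcap_(j in [set` i :: s]) (\bigcup_l (I j @^-1` [set l] `&` E j l))).
    apply: measurableI; apply: bigcap_measurableType => j _ //.
    by apply: bigcup_measurable => l _; exact: measurableI.
  apply/seteqP; split=> w /= [h1 h2]; split=> j jt.
  - exact: h1.
  - by exists (I j w) => //; split => //; exact: h2.
  - exact: h1.
  - by have [l _ [/= <-]] := h2 j jt.
rewrite (measure_nat_partition P (mI i) mA).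
pose k' l j := if j == i then l else k j.
have us' : perm_eq (s ++ i :: t) u.
  by rewrite -(permPr su) -cat1s; apply/permPl; exact: perm_catCA.
have ist : i \notin t.
  move: uu; rewrite -(perm_uniq su) /= mem_cat negb_or -andbA.
  by move=> /and3P[].
have -> : (\sum_(0 <= l <oo) P (A `&` I i @^-1` [set l]) =
  \sum_(0 <= l <oo) \int[P]_(w in C) (((p l w)%:E * (\1_(E i l) w)%:E) *
    ((\prod_(j <- t) (p (k j) w)%:E) * \prod_(j <- s) mix (E j) w)))%E.
  apply: eq_eseriesr => l _.
  (* On the cell where index i equals l, its condition is the event [E i l] of [F]: this event is
     absorbed into [C], and i joins the prescribed indices with value l. *)
  rewrite (_ : A `&` _ = (C `&` E i l) `&` [set w | (forall j, j \in i :: t -> I j w = k' l j) /\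
                    (forall j, j \in s -> E j (I j w) w)]); last first.
    apply/seteqP; split=> w /=.
      move=> [[Cw [tw sw]] Iw]; split.
        by split => //; rewrite -Iw; apply: sw; rewrite inE eqxx.
      split=> j.
        rewrite inE /k'; case: eqP => [->//|_ /= jt]; exact: tw.
      by move=> js; apply: sw; rewrite inE js orbT.
    move=> [[Cw Ew] [tw sw]]; have Iw : I i w = l.
      by have := tw i; rewrite inE eqxx /k' eqxx; exact.
    split=> //; split=> //; split=> j.
      move=> jt; have := tw j; rewrite inE jt orbT /k' => /(_ isT).
      by case: eqP => // jE; move: ist; rewrite -jE jt.
    by rewrite inE => /orP[/eqP ->|js]; [rewrite Iw|exact: sw].
  rewrite IH//; last exact: FI.
  rewrite integral_mkcondr; apply: eq_integral => w _.
  rewrite patchE indicE; case: ifPn => wE; last by rewrite mule0 mul0e.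
  rewrite mule1 big_cons {1}/k' eqxx -muleA; congr (_ * (_ * _))%E.
  rewrite big_seq [RHS]big_seq; apply: eq_bigr => j jt; rewrite /k'.
  by case: eqP => // jE; move: ist; rewrite -jE jt.
rewrite -integral_nneseries//; last 2 first.
- move=> l; apply: measurable_funTS; apply: emeasurable_funM; last first.
    apply: emeasurable_funM; last by apply: emeasurable_prod => j; exact: measurable_mix.
    by apply: emeasurable_prod => j; exact/measurable_EFinP.
  apply: emeasurable_funM; apply/measurable_EFinP => //.
- move=> l w _; rewrite mule_ge0//; first by rewrite mule_ge0// lee_fin.
  by rewrite mule_ge0// prode_ge0// => j _; rewrite ?lee_fin// mix_ge0.
apply: eq_integral => w _.
rewrite ge0_nneseriesZr.
- by rewrite big_cons muleCA.
- by rewrite mule_ge0// prode_ge0// => j _; rewrite ?lee_fin// mix_ge0.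
- by move=> l; rewrite mule_ge0// lee_fin.
Qed.

Lemma sampling_mix s t (C : set Om) (k : nat -> nat) (E : nat -> nat -> set Om) :
  sampling -> F C -> uniq (s ++ t) -> (forall i j, F (E i j)) ->
  (P (C `&` [set w | (forall i, i \in t -> I i w = k i) /\
                    (forall i, i \in s -> E i (I i w) w)]) =
   \int[P]_(w in C) ((\prod_(i <- t) (p (k i) w)%:E) * \prod_(i <- s) mix (E i) w))%E.
Proof.
move=> sI FC us FE; apply: (@sampling_mix_perm (s ++ t)) => //.
by move=> D t' l FD t'u; apply: sI => //; rewrite (perm_uniq t'u).
Qed.

Lemma mix_setT w : (\sum_(0 <= k <oo) (p k w)%:E)%E = 1%E -> mix (fun=> setT) w = 1%E.
Proof.
by move=> p1; rewrite -p1; apply: eq_eseriesr => k _; rewrite indicT mule1.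
Qed.

Lemma mix_eq (j : nat) w : mix (fun k => if k == j then setT else set0) w = (p j w)%:E.
Proof.
rewrite /mix (nneseriesD1 (n := j))//; last first.
  by move=> k _; rewrite mule_ge0// lee_fin.
rewrite eqxx indicT mule1 eseries0 ?adde0// => k _ kj.
by rewrite (negbTE kj) indic0 mule0.
Qed.

(** An index set is completed to an initial segment by indices under the trivial condition [setT].
    Each of these contributes the factor [mix (fun=> setT)], which is 1 exactly because the weights
    sum to 1. *)
Lemma sampling_init :
  F set0 -> F setT ->
  {ae P, forall w, (\sum_(0 <= k <oo) (p k w)%:E = 1)%E} ->
  (forall (C : set Om) n (k : nat -> nat), F C ->
    P (C `&` [set w | forall i, (i < n)%N -> I i w = k i]) =
    \int[P]_(w in C) \prod_(i < n) (p (k i) w)%:E)%E ->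
  sampling.
Proof.
move=> F0 FT p1 pI C FC s k us.
pose n := (\max_(i <- s) i).+1.
have sn i : i \in s -> (i < n)%N by move=> si; rewrite /n ltnS; exact: leq_bigmax_seq.
pose E i j : set Om := if (i \in s) && (j != k i) then set0 else setT.
have FE i j : F (E i j) by rewrite /E; case: ifP.
rewrite (_ : [set w | _] = [set w | (forall i, i \in [::] -> I i w = k i) /\
                    (forall i, i \in iota 0 n -> E i (I i w) w)]); last first.
  apply/seteqP; split=> w /=.
    move=> h; split=> // i _; rewrite /E; case: ifP => // /andP[/h ->].
    by rewrite eqxx.
  move=> [_ h] i si; have : E i (I i w) w.
    by apply: h; rewrite -[_ :: _]/(iota 0 n) mem_iota add0n sn.
  by rewrite /E si /=; case: eqP.
rewrite (@sampling_mix_perm (iota 0 n)) ?iota_uniq ?cats0//; last first.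
  move=> D t l FD tn.
  under eq_integral do rewrite (perm_big _ tn) -(val_enum_ord n) big_map big_enum.
  rewrite -pI//.
  congr (P (_ `&` _)); apply/seteqP; split=> w /= h i.
    by move=> ilt; apply: h; rewrite (perm_mem tn) mem_iota.
  by rewrite (perm_mem tn) mem_iota => /h.
have mC := Fm FC.
apply: ae_eq_integral => //.
- apply: measurable_funTS; apply: emeasurable_funM.
    by apply: emeasurable_prod => j; exact/measurable_EFinP.
  by apply: emeasurable_prod => j; apply: measurable_mix => l; exact: Fm.
- by apply: measurable_funTS; apply: emeasurable_prod => j; exact/measurable_EFinP.
- apply: filterS p1 => w p1 _; rewrite big_nil mul1e.
  have mixE i : mix (E i) w = if i \in s then (p (k i) w)%:E else 1%E.
    rewrite /E; case: ifPn => si /=; last by rewrite mix_setT.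
    rewrite -mix_eq; apply: eq_eseriesr => l _; by case: eqP.
  under eq_bigr do rewrite mixE.
  rewrite -big_mkcond/= -big_filter; apply: perm_big; apply: uniq_perm => //.
    exact/filter_uniq/(iota_uniq 0 n).
  move=> i; rewrite mem_filter -[_ :: _]/(iota 0 n) mem_iota add0n; apply/andP/idP => [[]//|si].
  by split=> //; exact: sn.
Qed.

End sampling.

Definition mkRV (d d' : measure_display) (Om : measurableType d) (T : measurableType d')
    (R : realType) (P : probability Om R) (f : Om -> T) (mf : measurable_fun setT f) :
  {RV P >-> T} := mfun_Sub (mem_set mf).

Lemma measurable_select (d d' : measure_display) (Om : measurableType d)
    (T : measurableType d') (f : nat -> Om -> T) (sg : Om -> nat) :
  (forall k, measurable_fun setT (f k)) -> (forall k, measurable (sg @^-1` [set k])) ->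
  measurable_fun setT (fun w => f (sg w) w).
Proof.
move=> mf ms _ B mB; rewrite setTI.
rewrite (_ : _ @^-1` B = \bigcup_k (sg @^-1` [set k] `&` f k @^-1` B)).
  apply: bigcup_measurable => k _; apply: measurableI => //.
  by rewrite -[X in measurable X]setTI; exact: mf.
by apply/seteqP; split=> w /=; [move=> h; exists (sg w)|move=> [k _ [/= <-]]].
Qed.

(** * Selecting i.i.d. types by a random injection independent of them *)

Section selection.
Context (R : realType) (d d' : measure_display) (Om : measurableType d).
Context (T : measurableType d') (P : probability Om R) (H : probability T R).
Variables (Z : nat -> {RV P >-> T}) (G : set (set Om)) (sg : nat -> Om -> nat).
Hypothesis Z_iid : iid Z H.
Hypothesis GZ : indep_systems P G (seq_sigma Z).
Hypothesis Gm : G `<=` measurable.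
Hypothesis GI : setI_closed G.
Hypothesis Gs : forall j k, G (sg j @^-1` [set k]).
Hypothesis s_inj : forall w, injective (sg ^~ w).

Lemma iid_seq (t : seq nat) (C : nat -> set T) : uniq t -> (forall k, measurable (C k)) ->
  P [set w | forall k, k \in t -> C k (Z k w)] = (\prod_(k <- t) H (C k))%E.
Proof.
move=> ut mC; have [ZH Zi] := Z_iid.
rewrite (_ : [set w | _] = \bigcap_(i in [set` t]) (Z i @^-1` C i)) // Zi//.
by apply: eq_bigr => i _; exact: ZH.
Qed.

Lemma seq_sigma_seq (t : seq nat) (C : nat -> set T) : (forall k, measurable (C k)) ->
  seq_sigma Z [set w | forall k, k \in t -> C k (Z k w)].
Proof.
move=> mC; rewrite seq_sigmaE.
exists ([set s : nat -> T | forall k, k \in t -> C k (s k)]); last by rewrite setTI.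
rewrite (_ : [set s | _] = \bigcap_(i in [set` t]) ((fun s : seqspace T => (s : nat -> T) i) @^-1` C i)) //.
apply: bigcap_measurableType => i _.
by rewrite -[X in measurable X]setTI; exact: measurable_coord.
Qed.

Lemma measurable_selected j : measurable_fun setT (fun w => Z (sg j w) w).
Proof. apply: (@measurable_select _ _ _ _ (fun k => Z k : Om -> T) (sg j)) => // k.
exact: Gm. Qed.

(** On the cell where [sg j] equals k, a constraint on the selected type is one on the fixed type
    [Z k] and moves to [t]. Injectivity of the selection keeps the remaining selected positions away
    from [t], so that no type is constrained twice; the last hypothesis carries this through the
    induction. *)
Lemma selection (s : seq nat) : forall (t : seq nat) (g : set Om) (B C : nat -> set T),
  G g -> uniq s -> uniq t -> (forall k, measurable (B k)) -> (forall k, measurable (C k)) ->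
  (forall w j, g w -> j \in s -> sg j w \notin t) ->
  P (g `&` [set w | (forall k, k \in t -> C k (Z k w)) /\
                    (forall j, j \in s -> B j (Z (sg j w) w))]) =
  (P g * ((\prod_(k <- t) H (C k)) * \prod_(j <- s) H (B j)))%E.
Proof.
elim: s => [|j s IH] t g B C Gg us ut mB mC gst.
  rewrite big_nil mule1 -iid_seq// -GZ//; last exact: seq_sigma_seq.
  by congr (P (_ `&` _)); apply/seteqP; split=> w /=; [move=> []|].
move: us => /= /andP[js us].
set X := ((\prod_(k <- t) H (C k)) * \prod_(i <- j :: s) H (B i))%E.
have X0 : (0 <= X)%E by rewrite mule_ge0// prode_ge0.
have mg := Gm Gg; have ms i k := Gm (Gs i k).
pose A := g `&` [set w | (forall k, k \in t -> C k (Z k w)) /\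
                    (forall i, i \in j :: s -> B i (Z (sg i w) w))].
have mA : measurable A.
  apply: measurableI => //.
  rewrite (_ : [set w | _] = (\bigcap_(k in [set` t]) Z k @^-1` C k) `&`
    \bigcap_(i in [set` j :: s]) ((fun w => Z (sg i w) w) @^-1` B i)).
    apply: measurableI; apply: bigcap_measurableType => k _ //.
      by rewrite -[X in measurable X]setTI; exact: measurable_funP.
    by rewrite -[X in measurable X]setTI; exact: measurable_selected.
  by apply/seteqP; split=> w /= [h1 h2]; split=> k /= kt; [exact: h1|exact: h2|exact: h1|exact: h2].
rewrite (measure_nat_partition P (ms j) mA) (measure_nat_partition P (ms j) mg).
rewrite -ge0_nneseriesZr//; apply: eq_eseriesr => k _.
(* A position already constrained cannot be selected on [g], so this cell is empty. *)
have [kt|kt] := boolP (k \in t).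
  have g0 : g `&` sg j @^-1` [set k] = set0.
    apply/seteqP; split=> w //= -[gw /= sk].
    by have := gst w j gw; rewrite inE eqxx sk kt => /(_ isT).
  rewrite (_ : A `&` _ = set0) ?g0 ?measure0 ?mul0e//.
  by apply/seteqP; split=> w //= -[[gw _] sk]; have : set0 w by rewrite -g0.
rewrite (_ : A `&` _ = (g `&` sg j @^-1` [set k]) `&`
  [set w | (forall l, l \in k :: t -> (if l == k then B j else C l) (Z l w)) /\
           (forall i, i \in s -> B i (Z (sg i w) w))]); last first.
  apply/seteqP; split=> w /=.
    move=> [[gw [tw sw]] sk]; split=> //; split.
      move=> l; rewrite inE; case: eqP => [-> _|_ /= lt]; last exact: tw.
      by rewrite -sk; apply: sw; rewrite inE eqxx.
    by move=> i si; apply: sw; rewrite inE si orbT.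
  move=> [[gw sk] [tw sw]]; split=> //; split=> //; split.
    move=> l lt; have := tw l; rewrite inE lt orbT => /(_ isT).
    by case: eqP => // lk; move: kt; rewrite -lk lt.
  move=> i; rewrite inE => /orP[/eqP->|]; last exact: sw.
  by have := tw k; rewrite inE eqxx sk; exact.
apply: etrans; first apply: (IH (k :: t) _ B (fun l => if l == k then B j else C l)) => //.
- exact: GI.
- by rewrite /= kt.
- by move=> l; case: ifP.
- move=> w i [gw sk] si; rewrite inE negb_or gst ?inE ?si ?orbT// andbT.
  apply/negP => /eqP; rewrite -sk => /s_inj ij.
  by move: js; rewrite -ij si.
congr (_ * _)%E; rewrite /X !big_cons eqxx -muleA muleCA; congr (_ * (_ * _))%E.
rewrite [LHS]big_seq [RHS]big_seq; apply: eq_bigr => l lt.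
by case: eqP => // lk; move: kt; rewrite -lk lt.
Qed.

Definition selected j : {RV P >-> T} := mkRV P (measurable_selected j).

Lemma selected_rect (g : set Om) n (B : nat -> set T) : G g -> (forall i, measurable (B i)) ->
  P ([set w | forall i, (i < n)%N -> B i (selected i w)] `&` g) = (P g * \prod_(i < n) H (B i))%E.
Proof.
move=> Gg mB; have := @selection (iota 0 n) [::] g B (fun=> setT) Gg (iota_uniq _ _) isT mB
  (fun=> measurableT) (fun _ _ _ _ => isT).
rewrite big_nil mul1e -[in RHS]val_enum_ord big_map big_enum => <-.
rewrite setIC; congr (P (_ `&` _)); apply/seteqP; split=> w /=.
  by move=> h; split=> // i; rewrite mem_iota => /h.
by move=> [_ h] i ilt; apply: h; rewrite mem_iota.
Qed.

Hypothesis GT : G setT.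

Lemma selected_iid : iid selected H.
Proof.
apply: iidP => n B mB; rewrite -[X in P X]setIT selected_rect//.
by rewrite probability_setT mul1e.
Qed.

Lemma selected_indep : indep_systems P G (seq_sigma selected).
Proof.
move=> g E Gg; rewrite seq_sigmaE => -[B mB <-]; rewrite setTI setIC muleC.
apply: (@indep_rect _ _ _ P _ _ (fun j w => selected j w)) => //; first exact: Gm.
by move=> n C mC; rewrite selected_rect// (iid_rect n selected_iid)// muleC.
Qed.

End selection.

(** * Realizing prescribed prefix probabilities by one uniform variable *)

Section sampler.
Context (R : realType) (d : measure_display) (S : measurableType d).
Variable m : seq nat -> S -> R.
Hypothesis mm : forall t, measurable_fun setT (m t).
Hypothesis m_ge0 : forall t x, 0 <= m t x.
Hypothesis m_nil : forall x, m [::] x = 1.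
Hypothesis m_sum : forall t x, (\sum_(0 <= k <oo) (m (rcons t k) x)%:E = (m t x)%:E)%E.

Let T := (S * measurableTypeR R)%type.

(** Left endpoint of the interval of the prefix t: at each level, the masses of the siblings placed
    before the chosen child. *)
Definition node_left (t : seq nat) (x : S) : R :=
  \sum_(i < size t) \sum_(l < nth 0%N t i) m (rcons (take i t) l) x.

(* [0, 1) is cut into consecutive intervals of lengths m [:: k], each of these
   into consecutive intervals of lengths m [:: k; l], and so on *)
Definition node (t : seq nat) : set T :=
  [set z | node_left t z.1 <= z.2 < node_left t z.1 + m t z.1].

Lemma node_left_rcons t k x :
  node_left (rcons t k) x = node_left t x + \sum_(l < k) m (rcons t l) x.
Proof.
rewrite /node_left size_rcons big_ord_recr/=; congr (_ + _).
  apply: eq_bigr => i _; rewrite nth_rcons ltn_ord -cats1 takel_cat//.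
  exact/ltnW/ltn_ord.
by rewrite nth_rcons ltnn eqxx -cats1 take_cat ltnn subnn take0 cats0.
Qed.

Lemma partial_sum_le (t : seq nat) n (x : S) : \sum_(l < n) m (rcons t l) x <= m t x.
Proof.
rewrite -lee_fin -m_sum -sumEFin -(big_mkord xpredT (fun l => (m (rcons t l) x)%:E)).
by apply: nneseries_lim_ge => k _ _; rewrite lee_fin.
Qed.

Lemma partial_sum_gt (t : seq nat) (x : S) c : c < m t x -> exists n, c < \sum_(l < n) m (rcons t l) x.
Proof.
move=> cm; apply: contrapT => /forallNP h.
have : (m t x <= c)%R; last by rewrite leNgt cm.
rewrite -lee_fin -m_sum; apply: lime_le.
  by apply: is_cvg_nneseries => k _ _; rewrite lee_fin.
apply: nearW => n; rewrite big_mkord sumEFin lee_fin leNgt.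
by apply/negP; exact: h.
Qed.

Lemma node_rconsS t k : node (rcons t k) `<=` node t.
Proof.
move=> [x u]; rewrite /node /= node_left_rcons => /andP[h1 h2]; apply/andP; split.
  by apply: le_trans h1; rewrite lerDl sumr_ge0.
apply: lt_le_trans h2 _; rewrite -addrA lerD2l.
by have := partial_sum_le t k.+1 x; rewrite big_ord_recr.
Qed.

Lemma node_rcons_inj t k k' z : node (rcons t k) z -> node (rcons t k') z -> k = k'.
Proof.
case: z => x u; rewrite /node /= !node_left_rcons => /andP[h1 h2] /andP[h3 h4].
have mono i j : (i < j)%N -> \sum_(l < i) m (rcons t l) x + m (rcons t i) x <=
    \sum_(l < j) m (rcons t l) x.
  move=> ij.
  have -> : \sum_(l < i) m (rcons t l) x + m (rcons t i) x =
    \sum_(l < i.+1) m (rcons t l) x by rewrite big_ord_recr.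
  rewrite -!(big_mkord xpredT (fun l => m (rcons t l) x)).
  by rewrite [leRHS](@big_cat_nat _ _ _ i.+1)//= lerDl sumr_ge0.
case: (ltngtP k k') => // [/mono|/mono]; rewrite -(lerD2l (node_left t x)) addrA => kk'.
- by have := lt_le_trans h2 kk'; rewrite ltNge h3.
- by have := lt_le_trans h4 kk'; rewrite ltNge h1.
Qed.

Lemma node_rcons_ex t z : node t z -> exists k, node (rcons t k) z.
Proof.
case: z => x u; rewrite /node /= => /andP[h1 h2].
have exn : exists n, u < node_left t x + \sum_(l < n) m (rcons t l) x.
  have [|n nP] := @partial_sum_gt t x (u - node_left t x).
    by rewrite ltrBlDl.
  by exists n; rewrite -ltrBlDl.
(* The least number of children whose masses carry the left endpoint past u is nonzero, since no
   children at all leave the left endpoint of t; its predecessor is the child containing u. *)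
case: (ex_minnP exn) => -[|n] un nmin.
  by move: un; rewrite big_ord0 addr0 ltNge h1.
exists n; rewrite node_left_rcons; apply/andP; split.
  by rewrite leNgt; apply/negP => /nmin; rewrite ltnn.
by rewrite -addrA; move: un; rewrite big_ord_recr.
Qed.

(** The default 0 is reached only when the second coordinate is outside [0, 1): inside, every
    interval is exhausted by its children. *)
Fixpoint nodes (n : nat) (z : T) : seq nat :=
  if n is n'.+1 then rcons (nodes n' z) (xget 0%N [set k | node (rcons (nodes n' z) k) z])
  else [::].

Definition draw (i : nat) (z : T) : nat :=
  xget 0%N [set k | node (rcons (nodes i z) k) z].

Lemma size_nodes n z : size (nodes n z) = n.
Proof. by elim: n => //= n IH; rewrite size_rcons IH. Qed.

Lemma nth_nodes n i z : (i < n)%N -> nth 0%N (nodes n z) i = draw i z.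
Proof.
elim: n => //= n IH; rewrite ltnS leq_eqVlt => /predU1P[->|ilt].
  by rewrite nth_rcons size_nodes ltnn eqxx.
by rewrite nth_rcons size_nodes ilt IH.
Qed.

Lemma node_nodes n z : node [::] z -> node (nodes n z) z.
Proof.
move=> z0; elim: n => // n /node_rcons_ex[k kz] /=.
by case: xgetP => [l _ //|/(_ k)].
Qed.

Lemma nodeS t z : node t z -> node [::] z.
Proof. by elim/last_ind: t => // t k IH /node_rconsS. Qed.

Lemma node_nodesE t z : node t z -> nodes (size t) z = t.
Proof.
elim/last_ind: t => // t k IH tz; rewrite size_rcons /= IH; last exact: node_rconsS tz.
congr rcons; case: xgetP => [l _ lz|/(_ k)//].
exact: node_rcons_inj lz tz.
Qed.

Lemma node_left_bounds t x : 0 <= node_left t x /\ node_left t x + m t x <= 1.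
Proof.
split; first by apply: sumr_ge0 => i _; exact: sumr_ge0.
elim/last_ind: t => [|t k IH].
  by rewrite /node_left big_ord0 add0r m_nil.
apply: le_trans IH; rewrite node_left_rcons -addrA lerD2l.
by have := partial_sum_le t k.+1 x; rewrite big_ord_recr.
Qed.

Lemma measurable_node_left t : measurable_fun setT (node_left t).
Proof. by apply: measurable_sum => i; apply: measurable_sum => l. Qed.

Lemma measurable_node t : measurable (node t).
Proof.
have ml : measurable_fun setT (fun z : T => node_left t z.1).
  by apply: measurableT_comp measurable_fst; exact: measurable_node_left.
have mt : measurable_fun setT (fun z : T => m t z.1).
  exact: measurableT_comp measurable_fst.
rewrite (_ : node t = (fun z : T => node_left t z.1 <= z.2) @^-1` [set true] `&`
  (fun z : T => z.2 < node_left t z.1 + m t z.1) @^-1` [set true]); last first.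
  by apply/seteqP; split=> z; rewrite /node /= => /andP.
apply: measurableI; rewrite -[X in measurable X]setTI.
  by apply: measurable_fun_ler => //; exact: measurable_snd.
by apply: measurable_fun_ltr => //; first [exact: measurable_funD|exact: measurable_snd].
Qed.

(** There are countably many prefixes of length i.+1 ending in k; the additional set accounts for
    the default value 0 outside the root interval. *)
Lemma measurable_draw i k : measurable (draw i @^-1` [set k]).
Proof.
pose F (t : seq nat) := if (size t == i.+1) && (last 0%N t == k) then node t else set0.
rewrite (_ : _ @^-1` _ = (\bigcup_t F t) `|` (~` node [::] `&` (fun=> k == 0%N) @^-1` [set true])).
  apply: measurableU.
    apply: countable_bigcupT_measurable => // t.
    by rewrite /F; case: ifP => // _; exact: measurable_node.
  apply: measurableI; first by apply: measurableC; exact: measurable_node.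
  by rewrite -[X in measurable X]setTI; exact: measurable_cst.
have off z : ~ node [::] z -> draw i z = 0%N.
  by move=> z0; rewrite /draw; case: xgetP => // l _ /nodeS.
apply/seteqP; split=> z /=.
  have [z0 iz|z0] := pselect (node [::] z); last by rewrite off// => <-; right.
  left; exists (nodes i.+1 z) => //; rewrite /F size_nodes eqxx /= last_rcons.
  by rewrite -/(draw i z) iz eqxx; have /= := node_nodes i.+1 z0; rewrite -/(draw i z) iz.
move=> [[t _]|[z0 /eqP ->]]; last exact: off.
rewrite /F; case: ifP => // /andP[/eqP st /eqP lt] tz.
by move: lt; rewrite -(node_nodesE tz) st /= last_rcons.
Qed.

Lemma draw_node (t : seq nat) z : node [::] z ->
  (forall i, (i < size t)%N -> draw i z = nth 0%N t i) <-> node t z.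
Proof.
move=> z0; split => [h|tz i it]; last first.
  by rewrite -(nth_nodes _ it) node_nodesE.
rewrite (_ : t = nodes (size t) z); first exact: node_nodes.
apply: (@eq_from_nth _ 0%N); first by rewrite size_nodes.
by move=> i it; rewrite nth_nodes// h.
Qed.

Lemma uniform_itv (a b : R) : 0 <= a -> b <= 1 -> a <= b ->
  uniform_prob (@ltr01 R) `[a, b[%classic = (b - a)%:E.
Proof.
move=> a0 b1 ab; rewrite /uniform_prob.
rewrite (eq_integral (cst 1%E)) => [|u]; last first.
  rewrite inE /= in_itv /= /uniform_pdf => /andP[au ub].
  by rewrite (le_trans a0 au) (ltW (lt_le_trans ub b1)) subr0 invr1.
rewrite integral_cst//= mul1e lebesgue_measure_itv/= lte_fin.
case: ltP => // ba; have -> : a = b by apply/eqP; rewrite eq_le ab ba.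
by rewrite subrr.
Qed.

Variable Q : probability S R.

(** On the root interval, prescribing the draws means lying in the interval of t, whose length at x
    is [m t x]; integrating the lengths of the sections gives the formula. *)
Lemma draw_law (B : set S) (t : seq nat) : measurable B ->
  ((Q \x uniform_prob (@ltr01 R)) ((B `*` setT) `&`
    [set z | forall i, (i < size t)%N -> draw i z = nth 0%N t i]) =
  \int[Q]_(x in B) (m t x)%:E)%E.
Proof.
move=> mB; pose PU : probability T R := (Q \x uniform_prob (@ltr01 R))%E.
rewrite -[LHS]/(PU _).
have mBT : measurable (B `*` setT : set T) by exact: measurableX.
have mn := measurable_node.
have n01 : PU (~` node [::]) = 0%E.
  rewrite (_ : ~` node [::] = setT `*` ~` `[0, 1[%classic); last first.
    apply/seteqP; split=> -[x u]; rewrite /node /= /node_left big_ord0 m_nil add0r in_itv/=;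
      by [move=> h; split|move=> []].
  rewrite [LHS]product_measure1E//; last exact: measurableC.
  have := @probability_setC _ _ _ (uniform_prob (@ltr01 R)) `[0%R, 1%R[%classic (measurable_itv _).
  rewrite [X in (1 - X)%E](_ : _ = (1 - 0)%:E); last exact: uniform_itv.
  by rewrite subr0 subee// => U0; rewrite [X in (_ * X)%E]U0 mule0.
have mD : measurable [set z : T | forall i, (i < size t)%N -> draw i z = nth 0%N t i].
  rewrite (_ : [set z | _] = \bigcap_(i in `I_(size t)) (draw i @^-1` [set nth 0%N t i])) //.
  by apply: bigcap_measurableType => i _; exact: measurable_draw.
(* The two events can differ only off the root interval, a null set; adding it to both makes them
   equal. *)
rewrite -(@measureU0 _ _ _ PU _ (~` node [::]))//; [|exact: measurableI|exact: measurableC].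
rewrite (_ : _ `|` _ = ((B `*` setT) `&` node t) `|` ~` node [::]); last first.
  apply/seteqP; split=> z.
    move=> [[Bz zt]|z0]; last by right.
    have [z0|z0] := pselect (node [::] z); last by right.
    by left; split => //; apply/draw_node.
  move=> [[Bz zt]|z0]; last by right.
  by left; split=> //; apply/draw_node => //; exact: nodeS zt.
rewrite measureU0//; [|exact: measurableI|exact: measurableC].
rewrite {1}/PU /product_measure1/= [RHS]integral_mkcond; apply: eq_integral => x _.
rewrite patchE /comp; case: ifPn => xB; last first.
  rewrite (_ : xsection _ _ = set0) ?measure0//.
  apply/seteqP; split=> u // /xsectionP[[/= Bx _] _].
  by move: xB; rewrite notin_setE.
rewrite (_ : xsection _ _ = `[node_left t x, node_left t x + m t x[%classic).
  have [? ?] := node_left_bounds t x.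
  by rewrite uniform_itv//; [congr EFin; rewrite addrC addKr|rewrite lerDl].
apply/seteqP; split=> u /=.
  by move=> /xsectionP[_]; rewrite /node /= in_itv.
by rewrite in_itv/= => h; apply/xsectionP; split=> //; split=> //=; rewrite -inE.
Qed.

End sampler.

(** * Kingman's paintbox *)

Section fibers.

Definition fibers (n : nat) (f : 'I_n -> nat) : {set {set 'I_n}} :=
  preim_partition f [set: 'I_n]%SET.

Lemma fibers_partition n (f : 'I_n -> nat) :
  finset.partition (fibers f) [set: 'I_n]%SET.
Proof. exact: preim_partitionP. Qed.

Lemma fibersP n (f : 'I_n -> nat) (B : {set 'I_n}) :
  reflect (exists i, B = [set j | f j == f i]%SET) (B \in fibers f).
Proof.
apply: (iffP imsetP) => [[i _ ->]|[i ->]]; exists i => //.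
  by apply/setP => j; rewrite !inE eq_sym.
by apply/setP => j; rewrite !inE eq_sym.
Qed.

Lemma eq_fibers n (f g : 'I_n -> nat) :
  (forall i j, (f i == f j) = (g i == g j)) -> fibers f = fibers g.
Proof.
move=> fg; apply/setP => B; apply/fibersP/fibersP => -[i ->]; exists i;
by apply/setP => j; rewrite !inE fg.
Qed.

Lemma fibers_restrict (m n : nat) (le_mn : (m <= n)%N) (f : 'I_n -> nat) :
  restrict_partition le_mn (fibers f) = fibers (f \o widen_ord le_mn).
Proof.
apply/setP => B; rewrite !inE; apply/andP/fibersP.
  move=> [B0 /imsetP[C /fibersP[i ->] BE]]; have /set0Pn[j jB] := B0.
  exists j; rewrite BE; apply/setP => l; rewrite !inE.
  by move: jB; rewrite BE !inE => /eqP <-.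
move=> [i ->]; split; first by apply/set0Pn; exists i; rewrite inE.
apply/imsetP; exists [set j | f j == f (widen_ord le_mn i)]%SET.
  by apply/fibersP; exists (widen_ord le_mn i).
by apply/setP => j; rewrite !inE.
Qed.

(** Composing with rho pulls blocks back, whereas [permute_partition] takes images; hence the
    inverse. *)
Lemma fibers_permute n (rho : 'S_n) (f : 'I_n -> nat) :
  permute_partition (rho^-1)%g (fibers f) = fibers (f \o rho).
Proof.
have setE i : ((rho^-1)%g @: [set j | f j == f i])%SET = [set j | f (rho j) == f i]%SET.
  apply/setP => j; rewrite inE; apply/imsetP/idP.
    by move=> [l]; rewrite inE => /eqP fl ->; rewrite permKV fl.
  by move=> fj; exists (rho j); rewrite ?inE// permK.
apply/setP => B; apply/imsetP/fibersP.
  move=> [C /fibersP[i ->] ->]; exists ((rho^-1)%g i); rewrite setE.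
  by apply/setP => j; rewrite !inE /= permKV.
move=> [i ->]; exists [set j | f j == f (rho i)]%SET.
  by apply/fibersP; exists (rho i).
by rewrite setE.
Qed.

(** List the image of each of the two injections, [g] and the inclusion, followed by all remaining
    points, and send the entries of one list to the entries of the other at the same position. *)
Lemma perm_of_inj (n N : nat) (g : 'I_n -> 'I_N) (le_nN : (n <= N)%N) : injective g ->
  exists rho : 'S_N, forall i, rho (widen_ord le_nN i) = g i.
Proof.
case: N g le_nN => [|N] g le_nN gi.
  by exists 1%g => i; case: (g i).
pose w := widen_ord le_nN.
have wi : injective w by move=> i j /(congr1 val) /= /val_inj.
pose s (h : 'I_n -> 'I_N.+1) := codom h ++ [seq x <- enum 'I_N.+1 | x \notin codom h].
have us h : injective h -> uniq (s h).
  move=> hi; rewrite cat_uniq; apply/and3P; split.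
  - by rewrite map_inj_uniq ?enum_uniq.
  - by apply/hasPn => x; rewrite mem_filter => /andP[].
  - by rewrite filter_uniq// enum_uniq.
have ms h x : x \in s h.
  by rewrite mem_cat mem_filter mem_enum andbT orbN.
have ss h : injective h -> size (s h) = N.+1.
  move=> hi; rewrite -[RHS]card_ord cardE; apply/eqP.
  rewrite -uniq_size_uniq ?us// ?enum_uniq// => x; last by rewrite mem_enum ms.
pose r x := nth ord0 (s g) (index x (s w)).
have idx x : (index x (s w) < N.+1)%N by rewrite -[X in (_ < X)%N](ss w wi) index_mem.
have ri : injective r.
  move=> x y /eqP; rewrite /r nth_uniq ?us ?ss ?idx// => /eqP.
  by apply: (index_inj x); rewrite ms.
exists (perm ri) => i; rewrite permE /r.
have wE : index (w i) (s w) = index i (enum 'I_n).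
  by rewrite /s index_cat codom_f /codom /image_mem index_map.
rewrite [X in nth _ _ X]wE.
have ilt : (index i (enum 'I_n) < size (enum 'I_n))%N by rewrite index_mem mem_enum.
rewrite /s nth_cat size_map ilt (nth_map i)// nth_index//.
exact: mem_enum.
Qed.

End fibers.

(** * Numbering the blocks in order of appearance *)

Section order_of_appearance.

Lemma least_le n (B : {set 'I_n}) (i : 'I_n) : i \in B -> (least B <= i)%N.
Proof.
rewrite /least -big_filter => iB.
have : i \in [seq j <- index_enum 'I_n | j \in B].
  by rewrite mem_filter iB mem_index_enum.
elim: [seq j <- index_enum 'I_n | j \in B] => //= j s IH; rewrite inE big_cons => /predU1P[<-|/IH].
  exact: geq_minl.
by apply: leq_trans; exact: geq_minr.
Qed.

Lemma least_ge n (B : {set 'I_n}) k : (k <= n)%N ->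
  (forall j, j \in B -> k <= j)%N -> (k <= least B)%N.
Proof.
move=> kn kB; rewrite /least; elim/big_ind: _ => //.
by move=> x y kx ky; rewrite leq_min kx.
Qed.

Lemma leastE n (B : {set 'I_n}) (i : 'I_n) : i \in B ->
  (forall j, j \in B -> i <= j)%N -> least B = i.
Proof.
move=> iB iBle; apply/eqP; rewrite eqn_leq least_le//= least_ge//.
exact/ltnW/ltn_ord.
Qed.

Lemma index_sorted (T : eqType) (key : T -> nat) (s : seq T) x :
  sorted (relpre key leq) s -> uniq (map key s) -> x \in s ->
  index x s = count (fun y => key y < key x)%N s.
Proof.
elim: s => //= y s IH ps /andP[ys us]; rewrite inE eq_sym.
have yle : all (fun z => key y <= key z)%N s.
  by apply: (order_path_min _ ps) => a b c /=; exact: leq_trans.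
have [yx|yx /= xs] := eqVneq y x => /=.
  rewrite -yx ltnn add0n => _; apply/esym/eqP; rewrite eqn0Ngt -has_count -all_predC.
  by move: yle; apply: sub_all => z /=; rewrite -leqNgt.
rewrite -IH//; last exact: path_sorted ps.
suff -> : (key y < key x)%N by [].
rewrite ltn_neqAle (allP yle)// andbT.
by apply: contraNneq ys => ->; exact: map_f.
Qed.

Variable f : nat -> nat.

Definition first_occ (i : nat) : bool := all (fun j => f j != f i) (iota 0 i).

Definition first_index (n : nat) : nat := find (fun j => f j == f n) (iota 0 n.+1).

Lemma first_indexP n : [/\ (first_index n <= n)%N, f (first_index n) = f n &
  first_occ (first_index n)].
Proof.
have hn : has (fun j => f j == f n) (iota 0 n.+1).
  by apply/hasP; exists n => //; rewrite mem_iota ltnSn.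
have le : (first_index n < n.+1)%N.
  by rewrite -[X in (_ < X)%N](size_iota 0) -has_find.
have := nth_find 0%N hn; rewrite nth_iota// add0n => /eqP fE.
split => //; apply/allP => j; rewrite mem_iota add0n => /andP[_ jlt].
have := before_find 0%N jlt; rewrite nth_iota ?add0n; last exact: ltn_trans jlt le.
by rewrite -fE => /negbT.
Qed.

Lemma first_occ_inj i j : first_occ i -> first_occ j -> f i = f j -> i = j.
Proof.
move=> /allP oi /allP oj fij; case: (ltngtP i j) => // ij.
- by have := oj i; rewrite mem_iota add0n ij fij eqxx => /(_ isT).
- by have := oi j; rewrite mem_iota add0n ij fij eqxx => /(_ isT).
Qed.

(** Since each value has one first occurrence, this is the number of distinct values taken strictly
    before time t. *)
Definition rank_occ (t : nat) : nat := \sum_(i < t) first_occ i.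

Lemma rank_occ_lt t u : first_occ t -> (t < u)%N -> (rank_occ t < rank_occ u)%N.
Proof.
move=> ot tu; rewrite /rank_occ -!(big_mkord xpredT (fun i => first_occ i : nat)).
rewrite [X in (_ < X)%N](@big_cat_nat _ _ _ t)//=; last exact: ltnW.
by rewrite -[X in (X < _)%N]addn0 ltn_add2l big_ltn// ot.
Qed.

(** The blocks are sorted by least element, and the least element of the block of n is the first
    time at which the value [f n] is taken. The position of that block is therefore the number of
    first occurrences before that time. *)
Lemma find_blocks n :
  find (fun B : {set 'I_n.+1} => ord_max \in B) (blocks (fibers (fun i : 'I_n.+1 => f i))) =
  rank_occ (first_index n).
Proof.
set pi := fibers _.
have [fn fE fo] := first_indexP n.
pose block (i : nat) : {set 'I_n.+1} := [set j : 'I_n.+1 | f j == f i]%SET.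
have blockpi (i : 'I_n.+1) : block i \in pi by apply/fibersP; exists i.
have least_block (i : 'I_n.+1) : first_occ i -> least (block i) = i.
  move=> oi; apply: leastE; first by rewrite inE.
  move=> j; rewrite inE => /eqP fji; rewrite leqNgt; apply/negP => ji.
  by have /allP/(_ (j : nat)) := oi; rewrite mem_iota add0n ji fji eqxx => /(_ isT).
have pi_block B : B \in pi -> exists2 i : 'I_n.+1, first_occ i & B = block i.
  move=> /fibersP[i ->]; have [ti tE ot] := first_indexP i.
  exists (Ordinal (leq_ltn_trans ti (ltn_ord i))) => //=.
  by apply/setP => j; rewrite !inE tE.
have key_inj : {in pi &, injective (@least n.+1)}.
  move=> B C /pi_block[i oi ->] /pi_block[j oj ->]; rewrite !least_block//.
  by move=> /ord_inj ->.
have fb : (find (fun B : {set 'I_n.+1} => ord_max \in B) (blocks pi)) = index (block n) (blocks pi).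
  apply: eq_in_find => B; rewrite mem_sort mem_enum => /pi_block[i oi ->] /=.
  rewrite inE /=; apply/idP/eqP => [/eqP fni|/setP/(_ ord_max)]; last by rewrite !inE eqxx.
  by apply/setP => j; rewrite !inE fni.
have bE : block n = block (Ordinal (leq_ltn_trans fn (ltnSn n))).
  by apply/setP => j; rewrite !inE /= fE.
rewrite fb (index_sorted (key := @least n.+1)); first last.
- by rewrite mem_sort mem_enum bE blockpi.
- rewrite map_inj_in_uniq ?sort_uniq ?enum_uniq// => B C.
  by rewrite !mem_sort !mem_enum; exact: key_inj.
- by apply: sort_sorted => B C /=; exact: leq_total.
rewrite (seq.permP (permEl (perm_sort _ _))) bE least_block//.
rewrite -size_filter -(card_uniqP (filter_uniq _ (enum_uniq (mem pi)))).
(* Blocks with a smaller least element correspond one to one to the first occurrences before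
   [first_index n]. *)
rewrite (eq_card (B := mem [set block i | i : 'I_n.+1 in [pred i : 'I_n.+1 | first_occ i && (i < first_index n)%N]]%SET)); last first.
  move=> B; rewrite mem_filter mem_enum; apply/andP/imsetP.
    move=> [lB /pi_block[i oi BE]]; exists i => //.
    by rewrite inE /= oi -(least_block i oi) -BE.
  by move=> [i]; rewrite inE => /andP[oi ilt] ->; rewrite least_block.
rewrite card_in_imset; last first.
  move=> i j; rewrite !inE => /andP[oi _] /andP[oj _] bij; apply: val_inj => /=.
  by rewrite -(least_block i oi) -(least_block j oj) bij.
rewrite -sum1_card /rank_occ -(big_mkord xpredT (fun i => first_occ i : nat)).
rewrite [RHS](big_nat_widen _ _ n.+1)/=; last by rewrite ltnW// ltnS.
rewrite big_mkord [RHS]big_mkcond [LHS]big_mkcond /=; apply: eq_bigr => i _.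
by rewrite inE; case: (first_occ i); case: ltnP.
Qed.

Lemma rank_occ_first_index n m :
  (rank_occ (first_index n) = rank_occ (first_index m)) <-> f n = f m.
Proof.
have [nn fn on] := first_indexP n; have [mm fm om] := first_indexP m.
split=> [r|fnm].
  case: (ltngtP (first_index n) (first_index m)) => [h|h|h].
  - by have := rank_occ_lt on h; rewrite r ltnn.
  - by have := rank_occ_lt om h; rewrite r ltnn.
  - by rewrite -fn -fm h.
by rewrite (@first_occ_inj (first_index n) (first_index m))// fn fm.
Qed.

End order_of_appearance.

Section block_rank.
Context (N : nat) (pi : {set {set 'I_N}}).
Hypothesis pi_part : finset.partition pi [set: 'I_N]%SET.

Let bs : seq {set 'I_N} := sort (relpre (fun B : {set 'I_N} => #|B|) geq) (enum pi).

(** Numbering blocks by decreasing size turns a partition into a function: its fibers give the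
    partition back, and their sizes are the ranked block sizes of Kingman's correspondence. *)
Definition block_rank (x : 'I_N) : nat := find (fun B : {set 'I_N} => x \in B) bs.

Let mem_bs B : (B \in bs) = (B \in pi).
Proof. by rewrite mem_sort mem_enum. Qed.

Let has_bs x : has (fun B : {set 'I_N} => x \in B) bs.
Proof.
have : x \in finset.cover pi by have /and3P[/eqP -> _ _] := pi_part; rewrite inE.
by move=> /bigcupP[B Bpi xB]; apply/hasP; exists B => //; rewrite mem_bs.
Qed.

Let block_rank_lt x : (block_rank x < size bs)%N.
Proof. by rewrite -has_find has_bs. Qed.

Let mem_block_rank x : x \in nth finset.set0 bs (block_rank x).
Proof. exact: (nth_find finset.set0 (has_bs x)). Qed.

Let block_rank_eq x j : (j < size bs)%N -> x \in nth finset.set0 bs j -> block_rank x = j.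
Proof.
move=> jlt xj; apply/eqP.
rewrite -(nth_uniq finset.set0 (block_rank_lt x) jlt) ?sort_uniq ?enum_uniq//.
have /and3P[_ triv _] := pi_part; apply/eqP.
have B1 : nth finset.set0 bs (block_rank x) \in pi by rewrite -mem_bs mem_nth.
have B2 : nth finset.set0 bs j \in pi by rewrite -mem_bs mem_nth.
by rewrite -(def_pblock triv B1 (mem_block_rank x)) (def_pblock triv B2 xj).
Qed.

Lemma fibers_block_rank : fibers block_rank = pi.
Proof.
apply/setP => B; apply/fibersP/idP.
  move=> [i ->].
  rewrite (_ : [set j | _]%SET = nth finset.set0 bs (block_rank i)) -?mem_bs ?mem_nth//.
  apply/setP => j; rewrite inE; apply/eqP/idP => [<-|ji]; first exact: mem_block_rank.
  exact: block_rank_eq.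
move=> Bpi; have /and3P[_ _ /negP pi0] := pi_part.
have [B0|[i iB]] := set_0Vmem B; first by case: pi0; rewrite -B0.
exists i; apply/setP => j; rewrite inE.
have Bbs : B \in bs by rewrite mem_bs.
have Blt : (index B bs < size bs)%N by rewrite index_mem.
have BE : B = nth finset.set0 bs (index B bs) by rewrite nth_index.
have -> : block_rank i = index B bs by apply: block_rank_eq => //; rewrite -BE.
apply/idP/eqP => [jB|jE]; first by apply: block_rank_eq => //; rewrite -BE.
by rewrite BE -jE mem_block_rank.
Qed.

Lemma ranked_block_sizeE j : ranked_block_size pi j = #|[set x | block_rank x == j]%SET|.
Proof.
rewrite /ranked_block_size sort_map -/bs.
have [jlt|jge] := ltnP j (size bs).
  rewrite (nth_map finset.set0)//; apply: eq_card => x; rewrite inE.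
  by apply/idP/eqP => [|<-]; [exact: block_rank_eq|exact: mem_block_rank].
rewrite nth_default ?size_map//; apply/esym/eqP; rewrite cards_eq0; apply/eqP/setP => x.
by rewrite !inE; apply/negbTE; rewrite neq_ltn (leq_trans (block_rank_lt x) jge).
Qed.

End block_rank.

Section paint.
Context (R : realType) (n : nat).

(* truncation to the indices below M of the probability that sampling n times
   with replacement from the weights v yields the partition pi *)
Definition paint (M : nat) (pi : {set {set 'I_n}}) (v : nat -> R) : R :=
  \sum_(k : {ffun 'I_n -> 'I_M} | fibers (fun i => k i : nat) == pi) \prod_i v (k i).

Lemma paint_ge0 M pi v : (forall j, 0 <= v j) -> 0 <= paint M pi v.
Proof. by move=> v0; apply: sumr_ge0 => k _; exact: prodr_ge0. Qed.

Lemma paint_le M pi v : (forall j, 0 <= v j <= 1) ->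
  paint M pi v <= #|{ffun 'I_n -> 'I_M}|%:R.
Proof.
move=> v01; rewrite /paint -sum1_card natr_sum big_mkcond/=; apply: ler_sum => k _.
case: ifP => _ //; apply: prodr_ile1 => i _; exact: v01.
Qed.

(** Each colouring has exactly one fiber partition, so the sum over [pi] removes the constraint.
    This total is the mass that has to tend to 1. *)
Lemma sum_paint M v : \sum_pi paint M pi v = (\sum_(j < M) v j) ^+ n.
Proof.
rewrite -[in RHS](card_ord n) -prodr_const bigA_distr_bigA /=.
by rewrite [RHS](partition_big (fun k : {ffun 'I_n -> 'I_M} => fibers (fun i => k i : nat)) xpredT).
Qed.

(** The term of k counts the functions g with [r \o g] equal to k. Regrouped by g, each function is
    counted at most once, for its own k, and not at all if some value of [r \o g] reaches M. *)
Lemma paint_count M N (r : 'I_N -> nat) pi :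
  (\sum_(k : {ffun 'I_n -> 'I_M} | fibers (fun i => k i : nat) == pi)
      \prod_i #|[set x | r x == k i]%SET| <=
   \sum_(g : {ffun 'I_n -> 'I_N}) (fibers (r \o g) == pi))%N.
Proof.
have cardE (k : {ffun 'I_n -> 'I_M}) : (\prod_i #|[set x | r x == k i]%SET| =
   \sum_(g : {ffun 'I_n -> 'I_N}) \prod_i (r (g i) == k i))%N.
  rewrite -(bigA_distr_bigA (fun i x => (r x == k i) : nat)).
  apply: eq_bigr => i _; rewrite -sum1_card big_mkcond/=.
  by apply: eq_bigr => x _; rewrite inE; case: eqP.
under eq_bigr do rewrite cardE.
rewrite exchange_big/=; apply: leq_sum => g _.
have prodE (k : {ffun 'I_n -> 'I_M}) :
    (\prod_i (r (g i) == k i) = [forall i, r (g i) == k i])%N.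
  case: forallP => [h|/forallP]; first by rewrite big1// => i _; rewrite h.
  by rewrite negb_forall => /existsP[i /negbTE ri]; rewrite (bigD1 i)//= ri.
under eq_bigr do rewrite prodE.
have [/forallP rM|] := boolP [forall i, r (g i) < M]%N; last first.
  rewrite negb_forall => /existsP[i]; rewrite -leqNgt => rM.
  rewrite big1// => k _; case: forallP => // /(_ i) /eqP rk.
  by have := ltn_ord (k i); rewrite -rk ltnNge rM.
pose k0 : {ffun 'I_n -> 'I_M} := [ffun i => Ordinal (rM i)].
rewrite (eq_bigr (fun k : {ffun 'I_n -> 'I_M} => (k == k0) : nat)); last first.
  move=> k _; congr nat_of_bool; apply/forallP/eqP => [h|-> i]; last by rewrite ffunE.
  by apply/ffunP => i; apply: val_inj; rewrite ffunE /= -(eqP (h i)).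
rewrite big_mkcond (bigD1 k0)//= eqxx big1 ?addn0; last first.
  by move=> k /negbTE ->; case: ifP.
rewrite (_ : fibers _ = fibers (r \o g)); first by case: ifP.
by apply: eq_fibers => i j; rewrite !ffunE.
Qed.

End paint.

Section finite_valued.
Context (R : realType) (d : measure_display) (Om : measurableType d).
Context (F : finType) (P : probability Om R) (X : Om -> F).
Hypothesis mX : forall x, measurable (X @^-1` [set x]).

Lemma measurable_preimage_fin (S : set F) : measurable (X @^-1` S).
Proof.
pose G x := if `[< S x >] then X @^-1` [set x] else set0.
rewrite (_ : _ @^-1` _ = \bigcup_x G x).
  by apply: countable_bigcupT_measurable => // x; rewrite /G; case: ifP.
apply/seteqP; split=> w /= => [Sw|[x _]].
  by exists (X w) => //; rewrite /G (asboolT Sw).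
by rewrite /G; case: asboolP => // Sx /= ->.
Qed.

Lemma measurable_fin_comp (d' : measure_display) (T : measurableType d') (h : F -> T) :
  measurable_fun setT (fun w => h (X w)).
Proof. by move=> _ B mB; rewrite setTI; exact: (measurable_preimage_fin (h @^-1` B)). Qed.

Lemma prob_fin (A : set Om) : measurable A ->
  P A = (\sum_(x : F) P (A `&` X @^-1` [set x]))%E.
Proof.
move=> mA; rewrite fsbig_seq ?index_enum_uniq// -measure_fin_bigcup//.
- rewrite -setI_bigcupr; congr (P _); apply/esym/setIidPl => w _.
  by exists (X w) => //=; rewrite mem_index_enum.
- exact: trivIset_preimage1_in.
- by move=> x _; exact: measurableI.
Qed.

Lemma prob_fin_preimage (S : pred F) :
  P (X @^-1` [set x | S x]) = (\sum_(x | S x) P (X @^-1` [set x]))%E.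
Proof.
rewrite (prob_fin (measurable_preimage_fin _)) [RHS]big_mkcond/=.
apply: eq_bigr => x _; case: ifPn => Sx.
  congr (P _); apply/seteqP; split=> w; first by case.
  by move=> /= wx; split=> //; rewrite /= wx.
rewrite (_ : _ `&` _ = set0) ?measure0//.
by apply/seteqP; split=> w //= -[Sw wx]; move: Sx; rewrite -wx Sw.
Qed.

End finite_valued.

(** * Truncated paintbox probabilities as lower bounds *)

Section kingman_lower_bound.
Context (R : realType) (d : measure_display) (Om : measurableType d).
Variables (P : probability Om R) (Pi : forall n : nat, Om -> {set {set 'I_n}}).
Hypothesis Pi_rp : random_partition Pi.
Hypothesis Pi_ex : exchangeable_partition P Pi.

Let mPi n pi : measurable (Pi n @^-1` [set pi]). Proof. by case: Pi_rp. Qed.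
Let Pi_part n w : finset.partition (Pi n w) [set: 'I_n]%SET. Proof. by case: Pi_rp. Qed.

(** Sampling without replacement: the injection extends to a permutation of [N], exchangeability
    removes the permutation, and what remains is the restriction to the first n points. *)
Lemma exchangeable_pullback (n N : nat) (g : 'I_n -> 'I_N) pi : injective g ->
  P [set w | fibers (block_rank (Pi N w) \o g) = pi] = P [set w | Pi n w = pi].
Proof.
move=> gi.
have le_nN : (n <= N)%N by have := leq_card g gi; rewrite !card_ord.
have [rho rhoE] := perm_of_inj le_nN gi.
have E w : fibers (block_rank (Pi N w) \o g) =
    restrict_partition le_nN (permute_partition (rho^-1)%g (Pi N w)).
  rewrite -[in RHS](fibers_block_rank (Pi_part N w)) fibers_permute fibers_restrict.
  by apply: eq_fibers => i j /=; rewrite !rhoE.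
rewrite (_ : [set w | _] = (fun w => permute_partition (rho^-1)%g (Pi N w)) @^-1`
   [set x | restrict_partition le_nN x == pi]); last first.
  by apply/seteqP; split=> w /=; rewrite E => /eqP.
rewrite prob_fin_preimage; last first.
  by move=> x; rewrite (_ : _ @^-1` _ = Pi N @^-1` [set y | permute_partition (rho^-1)%g y = x])//;
    exact: (measurable_preimage_fin (@mPi N)).
under eq_bigr do rewrite [P _]Pi_ex.
rewrite -(prob_fin_preimage P (@mPi N)); congr (P _).
have [_ _ Pi_restr] := Pi_rp.
by apply/seteqP; split=> w /=; rewrite Pi_restr => /eqP.
Qed.

(** At the empirical frequencies, [paint] is at most the probability that n draws with replacement
    from [N.+1] see the partition [pi]. Draws without repetition have the law of [Pi n]; the error
    term is the probability of a repetition. *)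
Lemma paint_freq_bound (n N M : nat) pi :
  (\int[P]_w (paint M pi (fun j => (ranked_block_size (Pi N.+1 w) j)%:R / N.+1%:R : R))%:E <=
   P [set w | Pi n w = pi] + (1 - (N.+1 ^_ n)%:R / (N.+1 ^ n)%:R)%:E)%E.
Proof.
pose A (g : {ffun 'I_n -> 'I_N.+1}) := [set w | fibers (block_rank (Pi N.+1 w) \o g) = pi].
have mA g : measurable (A g).
  rewrite (_ : A g = Pi N.+1 @^-1` [set x | fibers (block_rank x \o g) = pi])//.
  exact: (measurable_preimage_fin (@mPi N.+1)).
(* The probability of each single outcome g of n uniform draws with replacement. *)
pose c : R := (N.+1 ^ n)%:R^-1; have c0 : 0 <= c by rewrite invr_ge0.
have cE : c = \prod_(i < n) N.+1%:R^-1 by rewrite prodr_const card_ord /c natrX exprVn.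
have le1 : (\int[P]_w (paint M pi (fun j => (ranked_block_size (Pi N.+1 w) j)%:R / N.+1%:R : R))%:E <=
    \int[P]_w (\sum_(g : {ffun 'I_n -> 'I_N.+1}) c%:E * (\1_(A g) w)%:E))%E.
  apply: ge0_le_integral => //.
  - by move=> w _; rewrite lee_fin; apply: paint_ge0 => j; rewrite divr_ge0.
  - apply/measurable_EFinP.
    exact: (measurable_fin_comp (@mPi N.+1) (fun x => paint M pi
      (fun j => (ranked_block_size x j)%:R / N.+1%:R : R))).
  - apply: emeasurable_sum => g; apply: emeasurable_funM => //.
    exact/measurable_EFinP.
  - move=> w _; under eq_bigr do rewrite -EFinM; rewrite sumEFin lee_fin -mulr_sumr.
    have := @paint_count n M N.+1 (block_rank (Pi N.+1 w)) pi.
    rewrite -(ler_nat R) natr_sum => h.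
    rewrite (_ : paint _ _ _ = c * \sum_(k : {ffun 'I_n -> 'I_M} | fibers (fun i => k i : nat) == pi)
       (\prod_i #|[set x | block_rank (Pi N.+1 w) x == k i]%SET|)%:R); last first.
      rewrite /paint mulr_sumr; apply: eq_bigr => k _.
      rewrite natr_prod cE -big_split/=.
      by apply: eq_bigr => i _; rewrite ranked_block_sizeE// mulrC.
    rewrite ler_wpM2l//; apply: le_trans h _; rewrite natr_sum; apply: ler_sum => g _.
    by rewrite indicE; case: eqP => [gp|]//; rewrite mem_set.
apply: (le_trans le1); rewrite ge0_integral_sum//; last 2 first.
- by move=> g; apply: emeasurable_funM => //; exact/measurable_EFinP.
- by move=> g w _; rewrite mule_ge0// lee_fin.
pose a := P [set w | Pi n w = pi].
have ma : measurable [set w | Pi n w = pi] by exact: mPi.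
(* Exchangeability gives the value a for every injective draw; a draw with a repetition is simply
   bounded by 1. *)
apply: (@le_trans _ _ (\sum_(g : {ffun 'I_n -> 'I_N.+1}) c%:E * (if injectiveb g then a else 1))%E).
  apply: lee_sum => g _; rewrite ge0_integralZl_EFin//; last exact/measurable_EFinP.
  rewrite integral_indic// setIT lee_wpmul2l ?lee_fin//; case: ifPn => gi.
    have h : P (A g) = a by apply: exchangeable_pullback; exact/injectiveP.
    by move: (lexx a); rewrite -{1}h.
  exact: probability_le1.
have [a' aE] : exists a' : R, a = a'%:E by exists (fine a); rewrite fineK// fin_num_prob.
have a'0 : 0 <= a' by rewrite -lee_fin -aE; exact: measure_ge0.
rewrite -/a aE (eq_bigr (fun g : {ffun 'I_n -> 'I_N.+1} => (c * (if injectiveb g then a' else 1))%:E)); last first.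
  by move=> g _; case: ifP; rewrite EFinM.
rewrite sumEFin -EFinD lee_fin -mulr_sumr (bigID (fun g : {ffun 'I_n -> 'I_N.+1} => injectiveb g))/=.
rewrite (eq_bigr (fun=> a')) => [|g ->//].
rewrite [X in _ + X](eq_bigr (fun=> 1)) => [|g /negbTE ->//].
rewrite !sumr_const -cardsE card_inj_ffuns !card_ord.
have -> : #|[pred g : {ffun 'I_n -> 'I_N.+1} | ~~ injectiveb g]| = (N.+1 ^ n - N.+1 ^_ n)%N.
  have := cardC [pred g : {ffun 'I_n -> 'I_N.+1} | injectiveb g].
  rewrite card_ffun !card_ord => <-.
  have := card_inj_ffuns 'I_n 'I_N.+1; rewrite !card_ord cardsE => <-.
  by rewrite addKn.
have le_ff : (N.+1 ^_ n <= N.+1 ^ n)%N.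
  have := max_card (mem [set g : {ffun 'I_n -> 'I_N.+1} | injectiveb g]%SET).
  by rewrite card_inj_ffuns card_ffun !card_ord.
have c1 : c * (N.+1 ^ n)%:R = 1 by rewrite mulVf// pnatr_eq0 expn_eq0.
have -> : (N.+1 ^_ n)%:R / (N.+1 ^ n)%:R = c * (N.+1 ^_ n)%:R by rewrite mulrC.
rewrite mulrDr; apply: lerD; last by rewrite natrB// mulrBr c1.
rewrite -mulr_natr mulrCA -[leRHS]mulr1 ler_wpM2l//.
by rewrite /c mulrC ler_pdivrMr ?ltr0n ?expn_gt0// mul1r ler_nat.
Qed.

Lemma cvg_ffact_ratio (n : nat) :
  (fun N => (N.+1 ^_ n)%:R / (N.+1 ^ n)%:R : R) @ \oo --> (1 : R).
Proof.
elim: n => [|n IH].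
  by under eq_fun do rewrite ffactn0 expn0 divr1; exact: cvg_cst.
rewrite -[X in _ --> X]mulr1.
have h : (fun N => 1 - n%:R * N.+1%:R^-1 : R) @ \oo --> (1 : R).
  rewrite -[X in _ --> X]subr0; apply: cvgB; first exact: cvg_cst.
  by rewrite -[X in _ --> X](mulr0 n%:R); apply: cvgMr; exact: cvg_harmonic.
apply: (cvg_trans _ (cvgM IH h)); apply: near_eq_cvg; near=> N.
have nN : (n <= N.+1)%N by near: N; exists n => // k /= nk; exact: leqW.
rewrite /= ffactnSr expnSr !natrM invfM natrB//.
rewrite mulrACA; congr (_ * _); rewrite mulrBl divff//.
Unshelve. all: by end_near. Qed.

Lemma ranked_freq_bounds (N : nat) w j :
  0 <= ((ranked_block_size (Pi N.+1 w) j)%:R / N.+1%:R : R) <= 1.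
Proof.
rewrite divr_ge0//= ler_pdivrMr// mul1r ler_nat ranked_block_sizeE//.
by rewrite (leq_trans (max_card _))// card_ord.
Qed.

Lemma cvg_prod_fin (I : Type) (s : seq I) (u : I -> nat -> R) (l : I -> R) :
  (forall i, u i @ \oo --> l i) ->
  (fun N => \prod_(i <- s) u i N) @ \oo --> \prod_(i <- s) l i.
Proof.
move=> ul; elim: s => [|i s IH].
  by rewrite big_nil; under eq_fun do rewrite big_nil; exact: cvg_cst.
by rewrite big_cons; under eq_fun do rewrite big_cons; exact: cvgM.
Qed.

Lemma cvg_sum_fin (I : Type) (s : seq I) (A : pred I) (u : I -> nat -> R) (l : I -> R) :
  (forall i, u i @ \oo --> l i) ->
  (fun N => \sum_(i <- s | A i) u i N) @ \oo --> \sum_(i <- s | A i) l i.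
Proof.
move=> ul; elim: s => [|i s IH].
  by rewrite big_nil; under eq_fun do rewrite big_nil; exact: cvg_cst.
rewrite big_cons; under eq_fun do rewrite big_cons.
by case: ifP => // _; exact: cvgD.
Qed.

Lemma measurable_paint n M (pi : {set {set 'I_n}}) (v : nat -> Om -> R) :
  (forall j, measurable_fun setT (v j)) ->
  measurable_fun setT (fun w => paint M pi (v ^~ w)).
Proof.
move=> mv.
have -> : (fun w => paint M pi (v ^~ w)) = (fun w => \sum_(k : {ffun 'I_n -> 'I_M})
    if fibers (fun i => k i : nat) == pi then \prod_i v (k i) w else 0).
  by apply/funext => w; rewrite /paint big_mkcond.
apply: measurable_sum => k.
case: (fibers (fun i => k i : nat) == pi); last exact: measurable_cst.
by apply: measurable_prod => i _.
Qed.

(** Let N tend to infinity: frequencies converge to the weights, repetitions become negligible, and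
    the truncated [paint] is bounded by the number of colourings. *)
Lemma kingman_paint_le (v : nat -> {RV P >-> R}) (n M : nat) pi :
  kingman_weights Pi v ->
  (\int[P]_w (paint M pi (fun j => v j w))%:E <= P [set w | Pi n w = pi])%E.
Proof.
move=> Pv.
pose fr N w j : R := (ranked_block_size (Pi N.+1 w) j)%:R / N.+1%:R.
have := @dominated_convergence _ _ _ P setT measurableT
  (fun N w => (paint M pi (fr N w))%:E) (fun w => (paint M pi (fun j => v j w))%:E)
  (cst #|{ffun 'I_n -> 'I_M}|%:R%:E).
case.
- move=> N; apply/measurable_EFinP.
  exact: (measurable_fin_comp (fun pi => let: And3 h _ _ := Pi_rp in h N.+1 pi) (fun x => paint M pi
      (fun j => (ranked_block_size x j)%:R / N.+1%:R : R))).
- by apply/measurable_EFinP; exact: measurable_paint.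
- apply: filterS Pv => w vw _; apply: cvg_EFin; first by near=> N.
  apply: cvg_sum_fin => k; apply: cvg_prod_fin => i.
  have := vw (k i); rewrite -cvg_shiftS; exact.
- exact: finite_measure_integrable_cst.
- apply: aeW => w N _; rewrite gee0_abs ?lee_fin; last first.
    by apply: paint_ge0 => j; have /andP[] := ranked_freq_bounds N w j.
  by apply: paint_le => j; exact: ranked_freq_bounds.
move=> _ _ cv.
have mPn : measurable [set w | Pi n w = pi] by have [h _ _] := Pi_rp; exact: h.
have [a aE] : exists a : R, P [set w | Pi n w = pi] = a%:E.
  by exists (fine (P [set w | Pi n w = pi])); rewrite fineK// fin_num_prob.
rewrite aE.
apply: (lee_cvg_to cv (g := fun N => (a + (1 - (N.+1 ^_ n)%:R / (N.+1 ^ n)%:R))%:E)).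
  apply: cvg_EFin; first by near=> N.
  rewrite -[X in _ --> X]addr0; apply: cvgD; first exact: cvg_cst.
  by rewrite -(subrr 1); apply: cvgB; [exact: cvg_cst|exact: cvg_ffact_ratio].
by apply: nearW => N; rewrite EFinD -aE; exact: paint_freq_bound.
Unshelve. all: by end_near. Qed.

End kingman_lower_bound.

Section paint_comparison.
Context (R : realType) (n : nat).

(** Colourings that use a colour of zero weight contribute nothing; the others are recoloured
    through f, which keeps the weights and, by injectivity, the fibers. *)
Lemma paint_le_inj (M M' : nat) pi (v u : nat -> R) (f : nat -> nat) :
  (forall j, 0 <= v j) -> (forall j, 0 <= u j) ->
  (forall j, (j < M)%N -> 0 < v j -> (f j < M'.+1)%N /\ u (f j) = v j) ->
  (forall i j, 0 < v i -> 0 < v j -> f i = f j -> i = j) ->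
  paint M pi v <= paint (n := n) M'.+1 pi u.
Proof.
move=> v0 u0 fM fi.
pose A := [set k : {ffun 'I_n -> 'I_M} | (fibers (fun i => k i : nat) == pi) &&
  [forall i, 0 < v (k i)]]%SET.
pose h (k : {ffun 'I_n -> 'I_M}) : {ffun 'I_n -> 'I_M'.+1} := [ffun i => inord (f (k i))].
have hE k i : k \in A -> h k i = f (k i) :> nat.
  rewrite inE => /andP[_ /forallP vk]; rewrite ffunE inordK//.
  by have [] := fM (k i) (ltn_ord _) (vk i).
have hi : {in A &, injective h}.
  move=> k l kA lA kl; apply/ffunP => i; apply: val_inj.
  move: (kA) (lA); rewrite !inE => /andP[_ /forallP vk] /andP[_ /forallP vl].
  by apply: (fi _ _ (vk i) (vl i)); rewrite -!hE// kl.
have -> : paint M pi v = \sum_(k in A) \prod_i u (h k i).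
  rewrite /paint (bigID (fun k : {ffun 'I_n -> 'I_M} => [forall i, 0 < v (k i)]))/=.
  rewrite [X in _ + X]big1 ?addr0; last first.
    move=> k /andP[_]; rewrite negb_forall => /existsP[i vi].
    by rewrite (bigD1 i)//= (_ : v (k i) = 0) ?mul0r//; apply/eqP; rewrite eq_le v0 andbT leNgt.
  apply: eq_big => k; first by rewrite inE.
  move=> kA; have kA' : k \in A by rewrite inE.
  apply: eq_bigr => i _; rewrite hE//; move: kA => /andP[_ /forallP vk].
  by have [] := fM (k i) (ltn_ord _) (vk i).
rewrite -(big_imset (fun k : {ffun 'I_n -> 'I_M'.+1} => \prod_i u (k i)) hi)/=.
rewrite /paint big_mkcond [leRHS]big_mkcond/=; apply: ler_sum => l _.
case: imsetP => [[k kA ->]|_]; last by case: ifP => // _; exact: prodr_ge0.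
have -> // : fibers (fun i => h k i : nat) == pi.
move: (kA); rewrite inE => /andP[/eqP <- /forallP vk]; apply/eqP.
apply: eq_fibers => i j; rewrite !hE//.
by apply/eqP/eqP => [|-> //]; exact: fi.
Qed.

Lemma paint_nondecreasing pi (v : nat -> R) : (forall j, 0 <= v j) ->
  {homo (fun M => paint (n := n) M.+1 pi v) : M M' / (M <= M')%N >-> M <= M'}.
Proof.
move=> v0 M M' MM'; apply: (@paint_le_inj M.+1 M' pi v v id) => // j jM _; split=> //.
exact: leq_trans jM _.
Qed.

End paint_comparison.

(** Only the positive terms count, and the rearrangement matches these bijectively; the numbers of
    zero terms may differ. *)
Lemma decreasing_rearrangement_sum (R : realType) (p s : nat -> R) :
  (forall j, 0 <= p j) -> decreasing_rearrangement p s ->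
  (\sum_(0 <= j <oo) (s j)%:E = \sum_(0 <= j <oo) (p j)%:E)%E.
Proof.
move=> p0 [_ s0 [f fb fE]].
have supp (a : nat -> R) : (forall j, 0 <= a j) ->
    (\sum_(0 <= j <oo) (a j)%:E = \esum_(j in [set j | (0 < a j)%R]) (a j)%:E)%E.
  move=> a0; rewrite nneseries_esumT; last by move=> j; rewrite lee_fin.
  rewrite [RHS]esum_mkcond; apply: eq_esum => j _.
  case: ifPn => //; rewrite notin_setE /= => /negP; rewrite -leNgt => aj.
  by congr EFin; apply/eqP; rewrite eq_le aj a0.
rewrite !supp// (reindex_esum _ _ _ _ fb); apply: eq_esum => j /= sj.
by rewrite fE.
Qed.

(** Two probability vectors above a common vector of mass nearly 1 are both close to it. *)
Lemma squeeze_finite_sum (R : realType) (T : finType) (x y : T -> R) (a : nat -> T -> R) :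
  \sum_t x t = 1 -> \sum_t y t = 1 ->
  (forall M t, a M t <= x t) -> (forall M t, a M t <= y t) ->
  (fun M => \sum_t a M t) @ \oo --> (1 : R) -> forall t, x t = y t.
Proof.
wlog suff : x y / \sum_t x t = 1 ->
    (forall M t, a M t <= x t) -> (forall M t, a M t <= y t) ->
    (fun M => \sum_t a M t) @ \oo --> (1 : R) -> forall t, x t <= y t.
  by move=> h x1 y1 ax ay a1 t; apply/eqP; rewrite eq_le !h.
move=> x1 ax ay a1 t.
(* As x sums to 1 and dominates [a M] off t, x t is at most 1 - \sum a M plus a M t, and a M t is at
   most y t; the defect 1 - \sum a M vanishes in the limit. *)
apply: (@ler_cvg_to _ \oo _ _ (fun=> x t) (fun M => (1 - \sum_t a M t) + y t)).
- exact: cvg_cst.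
- rewrite -[X in _ --> X]add0r; apply: cvgD; last exact: cvg_cst.
  by rewrite -[X in _ --> X](subrr 1); apply: cvgB => //; exact: cvg_cst.
- apply: nearW => M; have := ay M t; have : \sum_(i | i != t) a M i <= \sum_(i | i != t) x i.
    exact: ler_sum.
  have aE : \sum_i a M i = a M t + \sum_(i | i != t) a M i by rewrite (bigD1 t).
  by move: x1; rewrite aE (bigD1 t)//=; lra.
Qed.

(** The absolute values make the integrand nonnegative on all of [seqspace R], so that its integral
    is a function of the law of the weights. *)
Lemma measurable_paint_seq (R : realType) n M (pi : {set {set 'I_n}}) :
  measurable_fun setT (fun v : seqspace R => (paint M pi (fun j => `|(v : nat -> R) j|))%:E).
Proof.
apply/measurable_EFinP; apply: measurable_paint => j.
by apply: measurableT_comp => //; exact: measurable_coord.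
Qed.

Section paintbox.
Context (R : realType) (d : measure_display) (Om : measurableType d).
Variables (P : probability Om R) (F : set (set Om)).
Variables (p : nat -> {RV P >-> R}) (I : nat -> Om -> nat) (q : seq nat -> R).
Hypothesis p01 : random_weights p.
Hypothesis mI : forall i k, measurable (I i @^-1` [set k]).
Hypothesis FT : F setT.
Hypothesis sI : sampling P F (fun k => p k : Om -> R) I.
Hypothesis pq : weights_eppf p q.

Let p0 j w : 0 <= p j w. Proof. by have [h _] := p01; have /andP[] := h j w. Qed.

Lemma sampling_tuple n (k : 'I_n -> nat) :
  P [set w | forall i : 'I_n, I i w = k i] = (\int[P]_w (\prod_i (p (k i) w))%:E)%E.
Proof.
pose k' i := if insub i is Some j then k j else 0%N.
have := sI FT k' (iota_uniq 0 n); rewrite setTI.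
under eq_integral do rewrite -(val_enum_ord n) big_map big_enum.
rewrite (_ : [set w | _] = [set w | forall i : 'I_n, I i w = k i]); last first.
  apply/seteqP; split=> w /= h i.
    have := h (val i); rewrite mem_iota ltn_ord /k' valK; exact.
  rewrite mem_iota add0n => /= ilt; have := h (Ordinal ilt) => /= ->.
  by rewrite /k' -[X in insub X]/(val (Ordinal ilt)) valK.
move=> ->; apply: eq_integral => w _; rewrite -prodEFin.
by apply: eq_bigr => i _; rewrite /k' valK.
Qed.

Lemma measurable_tuple n (k : 'I_n -> nat) : measurable [set w | forall i : 'I_n, I i w = k i].
Proof.
rewrite (_ : [set w | _] = \bigcap_(i in [set: 'I_n]) I i @^-1` [set k i]); last first.
  by apply/seteqP; split=> w /= h i; [move=> _; exact: h|exact: h].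
by apply: fin_bigcap_measurable => // i _; exact: mI.
Qed.

Lemma measurable_fibers n pi : measurable [set w | fibers (fun i : 'I_n => I i w) = pi].
Proof.
pose G (k : seq nat) := if fibers (fun i : 'I_n => nth 0%N k i) == pi then
   [set w | forall i : 'I_n, I i w = nth 0%N k i] else set0.
rewrite (_ : [set w | _] = \bigcup_k G k).
  apply: countable_bigcupT_measurable => // k; rewrite /G; case: ifP => // _.
  exact: measurable_tuple.
apply/seteqP; split=> w /=.
  move=> wpi; exists (mkseq (I ^~ w) n) => //.
  have E (i : 'I_n) : nth 0%N (mkseq (I ^~ w) n) i = I i w by rewrite nth_mkseq.
  have fE : fibers (fun i : 'I_n => nth 0%N (mkseq (I ^~ w) n) i) = pi.
    by rewrite -wpi; apply: eq_fibers => i j; rewrite !E.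
  by rewrite /G fE eqxx => i; rewrite E.
move=> [k _]; rewrite /G; case: eqP => // kpi h.
by rewrite -kpi; apply: eq_fibers => i j; rewrite !h.
Qed.

(** Distinct colourings prescribe disjoint index events, all contained in the event that the fibers
    are [pi]. *)
Lemma integral_paint_le n M (pi : {set {set 'I_n}}) :
  (\int[P]_w (paint M pi (p ^~ w))%:E <= P [set w | fibers (fun i : 'I_n => I i w) = pi])%E.
Proof.
pose A (k : {ffun 'I_n -> 'I_M}) : set Om := if fibers (fun i => k i : nat) == pi then
  [set w | forall i : 'I_n, I i w = k i] else set0.
have mA k : measurable (A k) by rewrite /A; case: ifP => // _; exact: measurable_tuple.
have -> : (\int[P]_w (paint M pi (p ^~ w))%:E = \sum_(k : {ffun 'I_n -> 'I_M}) P (A k))%E.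
  under eq_integral do rewrite /paint -sumEFin big_mkcond/=.
  rewrite ge0_integral_sum//; last 2 first.
  - move=> k; case: (_ == pi) => //; apply/measurable_EFinP.
    by apply: measurable_prod => i _.
  - by move=> k w _; case: ifP => // _; rewrite lee_fin prodr_ge0.
  apply: eq_bigr => k _; rewrite /A; case: ifP => _; last by rewrite integral0 measure0.
  by rewrite sampling_tuple.
rewrite fsbig_seq ?index_enum_uniq// -measure_fin_bigcup//.
- apply: le_measure; rewrite ?inE.
  + by apply: fin_bigcup_measurable => // k _; exact: mA.
  + exact: measurable_fibers.
  + move=> w [k _]; rewrite /A; case: eqP => // kpi h /=.
    by rewrite -kpi; apply: eq_fibers => i j; rewrite !h.
- move=> k l _ _ [w []]; rewrite /A; case: ifP => // _ kw; case: ifP => // _ lw.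
  by apply/ffunP => i; apply: val_inj; rewrite /= -kw -lw.
Qed.

(** The sampled partition and the abstract partition [Pi1] behind [q] have probabilities above the
    same numbers [Ps M pi], and the sum of these over [pi] is the expectation of the n-th power of
    the truncated total weight, which tends to 1. *)
Lemma paintbox_law n (pi : {set {set 'I_n}}) : finset.partition pi [set: 'I_n]%SET -> (0 < n)%N ->
  P [set w | fibers (fun i : 'I_n => I i w) = pi] =
  (q [seq #|(B : {set 'I_n})| | B <- blocks pi])%:E.
Proof.
move=> pip n0; case: pq => s [ps [d1 [Om1 [P1 [Pi1 [v [[Pi1rp Pi1ex Pi1q] Pv vs]]]]]]].
have [_ p1] := p01.
rewrite -(Pi1q.2 n pi n0 pip).
pose Ps M (pi : {set {set 'I_n}}) := (\int[P]_w (paint M.+1 pi (fun j => `|s j w|))%:E)%E.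
have s_ae : {ae P, forall w, (forall j, 0 <= s j w) /\ (\sum_(0 <= j <oo) (s j w)%:E = 1)%E}.
  apply: filterS2 ps p1 => w psw p1w; split; first by case: psw.
  by rewrite -p1w; apply: decreasing_rearrangement_sum psw => j.
have PsE M pi' : Ps M pi' = (\int[P1]_w (paint M.+1 pi' (fun j => `|v j w|))%:E)%E.
  have sl : same_law P P1 (fun w => (fun j => s j w) : seqspace R) (fun w => (fun j => v j w) : seqspace R).
    by move=> B mB; have := vs B mB; rewrite /seq_law => <-.
  have := same_law_integral _ _ sl measurableT (@measurable_paint_seq R n M.+1 pi').
  rewrite !preimage_setT; apply.
  - exact: (@measurable_seq _ R _ _ (fun j w => s j w)).
  - exact: (@measurable_seq _ R _ _ (fun j w => v j w)).
  - by move=> x; rewrite lee_fin paint_ge0.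
have mps M (pi' : {set {set 'I_n}}) : measurable_fun setT (fun w => (paint M pi' (fun j => `|s j w|))%:E).
  apply/measurable_EFinP; apply: measurable_paint => j.
  exact: measurableT_comp.
have le1 M pi' : (Ps M pi' <= P1 [set w | Pi1 n w = pi'])%E.
  rewrite PsE; apply: le_trans (kingman_paint_le Pi1rp Pi1ex M.+1 pi' Pv).
  rewrite le_eqVlt; apply/orP; left; apply/eqP.
  apply: ae_eq_integral => //.
  - apply/measurable_EFinP; apply: measurable_paint => j; exact: measurableT_comp.
  - by apply/measurable_EFinP; exact: measurable_paint.
  apply: filterS Pv => w vw _; congr EFin; rewrite /paint; apply: eq_bigr => k _.
  apply: eq_bigr => i _; rewrite ger0_norm//.
  apply: (ler_cvg_to (cvg_cst 0) (vw (k i))); apply: nearW => N.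
  by rewrite divr_ge0.
(* The first indices of s are matched by f with indices of p, but how far these reach depends on the
   outcome. The bound is therefore taken with all truncations of p at once, by monotone
   convergence. *)
have le2 M pi' : (Ps M pi' <= P [set w | fibers (fun i : 'I_n => I i w) = pi'])%E.
  have nd w : {homo (fun M => (paint M.+1 pi' (p ^~ w))%:E) : M M' / (M <= M')%N >-> (M <= M')%E}.
    by move=> M1 M2 M12; rewrite lee_fin; exact: paint_nondecreasing.
  have mp M' : measurable_fun setT (fun w => (paint M'.+1 pi' (p ^~ w))%:E).
    by apply/measurable_EFinP; exact: measurable_paint.
  have cv := @cvg_monotone_convergence _ _ _ P setT measurableT
    (fun M' w => (paint M'.+1 pi' (p ^~ w))%:E) mp
    (fun _ _ _ => ltac:(by rewrite lee_fin paint_ge0)) (fun w _ => nd w).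
  apply: (@le_trans _ _ (\int[P]_w limn (fun M' => (paint M'.+1 pi' (p ^~ w))%:E))%E); last first.
    apply: (cvge_le _ cv); apply: nearW => M'; exact: integral_paint_le.
  apply: ae_ge0_le_integral => //.
  - by move=> w _; rewrite lee_fin paint_ge0.
  - move=> w _; apply: lime_ge; first exact: ereal_nondecreasing_is_cvgn.
    by apply: nearW => M'; rewrite lee_fin paint_ge0.
  - apply: (emeasurable_fun_cvg (fun M' w => (paint M'.+1 pi' (p ^~ w))%:E)) => // w _.
    exact: ereal_nondecreasing_is_cvgn.
  apply: filterS ps => w [_ s0 [f [_ fi _] fE]] _.
  pose M' := (\max_(j < M.+1) f j)%N.
  apply: (@le_trans _ _ (paint M'.+1 pi' (p ^~ w))%:E).
    rewrite lee_fin; apply: (@paint_le_inj _ _ _ _ _ _ _ f) => //.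
    - move=> j jM; rewrite ger0_norm// => sj; split; last exact: fE.
      by rewrite ltnS /M' -[j]/(val (Ordinal jM)); exact: leq_bigmax.
    - by move=> i j; rewrite !ger0_norm// => si sj; apply: fi; rewrite inE.
  apply: lime_ge; first exact: ereal_nondecreasing_is_cvgn.
  by near=> k; apply: nd; near: k; exact: nbhs_infty_ge.
have mPi1 := fun pi => let: And3 h _ _ := Pi1rp in h n pi.
have x1 : \sum_t fine (P [set w | fibers (fun i : 'I_n => I i w) = t]) = 1.
  apply: EFin_inj; rewrite -sumEFin -(probability_setT P).
  rewrite [RHS](@prob_fin _ _ _ _ P (fun w => fibers (fun i : 'I_n => I i w)) (@measurable_fibers n))//.
  apply: eq_bigr => t _; rewrite setTI fineK// fin_num_prob//.
  exact: measurable_fibers.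
have y1 : \sum_t fine (P1 [set w | Pi1 n w = t]) = 1.
  apply: EFin_inj; rewrite -sumEFin -(probability_setT P1).
  rewrite [RHS](prob_fin P1 mPi1)//.
  by apply: eq_bigr => t _; rewrite setTI fineK// fin_num_prob//; exact: mPi1.
have Ps_fin M t : Ps M t \is a fin_num.
  rewrite ge0_fin_numE; last by apply: integral_ge0 => w _; rewrite lee_fin paint_ge0.
  apply: (le_lt_trans (le1 M t)); rewrite ltey_eq fin_num_prob//; exact: mPi1.
have sumPs M : (\sum_t Ps M t = \int[P]_w ((\sum_(j < M.+1) `|s j w|) ^+ n)%:E)%E.
  rewrite -ge0_integral_sum//; last by move=> t w _; rewrite lee_fin paint_ge0.
  by apply: eq_integral => w _; rewrite sumEFin sum_paint.
have S1 : (fun M => \sum_t fine (Ps M t)) @ \oo --> (1 : R).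
  have s_le w M : (forall j, 0 <= s j w) -> (\sum_(0 <= j <oo) (s j w)%:E = 1)%E ->
      \sum_(j < M) `|s j w| <= 1.
    move=> s0 s1; rewrite -lee_fin -s1 -sumEFin.
    under eq_bigr do rewrite ger0_norm//.
    rewrite -(big_mkord xpredT (fun j => (s j w)%:E)).
    by apply: nneseries_lim_ge => j _ _; rewrite lee_fin.
  have mS M : measurable_fun setT (fun w => ((\sum_(j < M.+1) `|s j w|) ^+ n)%:E).
    apply/measurable_EFinP; apply: measurable_funX; apply: measurable_sum => j.
    exact: measurableT_comp.
  have [|||_ _] := @dominated_convergence _ _ _ P setT measurableT
    (fun M w => ((\sum_(j < M.+1) `|s j w|) ^+ n)%:E) (cst 1%E) (cst 1%E) mS (measurable_cst _).
  - apply: filterS s_ae => w [s0 s1] _; apply: cvg_EFin; first by near=> M.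
    have c1 : (fun M => \sum_(j < M.+1) `|s j w|) @ \oo --> (1 : R).
      have := @is_cvg_nneseries R (fun j => (s j w)%:E) xpredT 0 (fun j _ _ => s0 j).
      rewrite /cvg_to; move=> cv.
      have : (fun M => \sum_(0 <= j < M) (s j w)%:E)%E @ \oo --> (1 : R)%:E by rewrite -s1.
      move=> /fine_cvg; rewrite -cvg_shiftS; apply: cvg_trans; apply: near_eq_cvg.
      apply: nearW => M /=; rewrite big_mkord sumEFin /=.
      by apply: eq_bigr => j _; rewrite ger0_norm.
    have := @cvg_prod_fin R _ (index_enum 'I_n) (fun _ M => \sum_(j < M.+1) `|s j w|) (fun=> 1) (fun=> c1).
    rewrite big1_eq; apply: cvg_trans; apply: near_eq_cvg; apply: nearW => M /=.
    by rewrite prodr_const card_ord.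
  - exact: finite_measure_integrable_cst.
  - apply: filterS s_ae => w [s0 s1] M _; rewrite /= lee_fin ger0_norm ?exprn_ge0 ?sumr_ge0//.
    by apply: exprn_ile1; [exact: sumr_ge0|exact: s_le].
  have -> : (\int[P]_x cst 1 x = 1)%E.
    by rewrite integral_cst// mul1e; exact: probability_setT.
  move=> /fine_cvg; apply: cvg_trans.
  apply: near_eq_cvg; apply: nearW => M /=; rewrite -sumPs.
  by rewrite (eq_bigr (fun t => (fine (Ps M t))%:E)) ?sumEFin// => t _; rewrite fineK.
have := @squeeze_finite_sum R _ _ _ (fun M t => fine (Ps M t)) x1 y1 _ _ S1 pi.
have mA1 t : measurable [set w | Pi1 n w = t] by exact: mPi1.
have mA2 t := @measurable_fibers n t.
move=> h; rewrite -[LHS]fineK ?fin_num_prob// -[RHS]fineK ?fin_num_prob//; congr EFin.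
by apply: h => M t; apply: fine_le => //; rewrite fin_num_prob.
Unshelve. all: by end_near. Qed.

End paintbox.

(** * From weights to exchangeable partitions *)

Section product_space.
Context (R : realType) (d1 d2 : measure_display).
Context (Om1 : measurableType d1) (Om2 : measurableType d2).
Variables (P1 : probability Om1 R) (P2 : probability Om2 R).

Lemma prod_setX (A : set Om1) (B : set Om2) : measurable A -> measurable B ->
  (P1 \x P2)%E (fst @^-1` A `&` snd @^-1` B) = (P1 A * P2 B)%E.
Proof. by move=> mA mB; rewrite -product_measure1E. Qed.

Lemma prod_fst (A : set Om1) : measurable A -> (P1 \x P2)%E (fst @^-1` A) = P1 A.
Proof.
move=> mA; have := prod_setX mA (measurableT : measurable [set: Om2]).
by rewrite preimage_setT setIT probability_setT mule1.
Qed.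

Lemma prod_snd (B : set Om2) : measurable B -> (P1 \x P2)%E (snd @^-1` B) = P2 B.
Proof.
move=> mB; have := prod_setX (measurableT : measurable [set: Om1]) mB.
by rewrite preimage_setT setTI probability_setT mul1e.
Qed.

End product_space.

Lemma big_double_mule (R : realType) n (a : nat -> \bar R) :
  (\prod_(i < n.*2) a i = (\prod_(i < n) a i.*2) * \prod_(i < n) a i.*2.+1)%E.
Proof.
elim: n => [|n IH]; first by rewrite !big_ord0 mule1.
rewrite doubleS !big_ord_recr/= IH -!muleA; congr (_ * _)%E.
by rewrite muleCA.
Qed.

Section interleave.
Context (R : realType) (d1 d2 d : measure_display).
Context (Om1 : measurableType d1) (Om2 : measurableType d2) (T : measurableType d).
Variables (P1 : probability Om1 R) (P2 : probability Om2 R) (H : probability T R).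
Variables (Z1 : nat -> {RV P1 >-> T}) (Z2 : nat -> {RV P2 >-> T}).
Variable G : set (set Om1).
Hypotheses (Z1_iid : iid Z1 H) (Z2_iid : iid Z2 H).
Hypotheses (Gm : G `<=` measurable) (GZ : indep_systems P1 G (seq_sigma Z1)) (GT : G setT).

Local Notation P := (P1 \x P2)%E.

(** Even positions hold the given types, odd positions a reserve. A relabelling can then be one
    injection into a single i.i.d. sequence, and parity decides which supply it uses. *)
Definition interleave_fun (n : nat) (w : Om1 * Om2) : T :=
  if odd n then Z2 n./2 w.2 else Z1 n./2 w.1.

Lemma measurable_interleave n : measurable_fun setT (interleave_fun n).
Proof.
rewrite /interleave_fun; case: (odd n).
  exact: (measurableT_comp (measurable_funP (Z2 n./2)) measurable_snd).
exact: (measurableT_comp (measurable_funP (Z1 n./2)) measurable_fst).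
Qed.

Definition interleave n : {RV P >-> T} := mkRV P (measurable_interleave n).

Lemma interleave_rect (g : set Om1) n (B : nat -> set T) : G g ->
  (forall i, measurable (B i)) ->
  P ([set w | forall i, (i < n)%N -> B i (interleave i w)] `&` fst @^-1` g) =
  ((\prod_(i < n) H (B i)) * P1 g)%E.
Proof.
move=> Gg mB; have mg := Gm Gg.
(* Padding with full sides up to length n.*2 splits the constraint into n conditions on each
   sequence. *)
pose B' i := if (i < n)%N then B i else setT.
have mB' i : measurable (B' i) by rewrite /B'; case: ifP.
have -> : (\prod_(i < n) H (B i) = \prod_(i < n.*2) H (B' i))%E.
  rewrite -(big_mkord xpredT (fun i => H (B i))) -(big_mkord xpredT (fun i => H (B' i))).
  rewrite [RHS](@big_cat_nat _ _ _ n)//= -?addnn ?leq_addr//.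
  rewrite [X in (_ * X)%E]big_nat_cond [X in (_ * X)%E]big1 ?mule1; last first.
    by move=> i /andP[/andP[ni _] _]; rewrite /B' ltnNge ni probability_setT.
  by rewrite big_nat_cond [RHS]big_nat_cond; apply: eq_bigr => i /andP[/andP[_ ilt] _]; rewrite /B' ilt.
rewrite (big_double_mule n (fun i => H (B' i))) -(iid_rect n Z1_iid (fun i => mB' i.*2)).
rewrite -(iid_rect n Z2_iid (fun i => mB' i.*2.+1)).
pose A1 := [set w | forall i, (i < n)%N -> B' i.*2 (Z1 i w)].
pose A2 := [set w | forall i, (i < n)%N -> B' i.*2.+1 (Z2 i w)].
rewrite -/A1 -/A2.
have A1s : seq_sigma Z1 A1.
  rewrite seq_sigmaE; exists (rect n (fun i => B' i.*2)); last by rewrite setTI.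
  exact: measurable_rect.
have A2s : seq_sigma Z2 A2.
  rewrite seq_sigmaE; exists (rect n (fun i => B' i.*2.+1)); last by rewrite setTI.
  exact: measurable_rect.
have mA1 := seq_sigma_measurable A1s; have mA2 := seq_sigma_measurable A2s.
rewrite muleAC [X in (X * _)%E]muleC -(GZ Gg A1s).
rewrite -prod_setX//; last exact: measurableI.
congr (P _); apply/seteqP; split=> -[w1 w2] /=.
  move=> [h gw]; split.
    split=> // i ilt; rewrite /B'; case: ifPn => // i2.
    by have := h i.*2 i2; rewrite /interleave_fun odd_double doubleK.
  move=> i ilt; rewrite /B'; case: ifPn => // i2.
  by have := h i.*2.+1 i2; rewrite /interleave_fun /= odd_double uphalf_double.
move=> [[gw h1] h2]; split=> // i ilt; rewrite /interleave_fun.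
have i2 : (i./2 < n)%N by apply: leq_ltn_trans ilt; rewrite leq_half_double -addnn -addnS leq_addr.
case: ifPn => io /=.
  have iE : i./2.*2.+1 = i by rewrite -[RHS]odd_double_half io.
  by have := h2 _ i2; rewrite /B' iE ilt.
have iE : i./2.*2 = i by rewrite -[RHS]odd_double_half (negbTE io).
by have := h1 _ i2; rewrite /B' iE ilt.
Qed.

Lemma interleave_iid : iid interleave H.
Proof.
apply: iidP => n B mB; have := interleave_rect n GT mB.
by rewrite preimage_setT setIT probability_setT mule1.
Qed.

Lemma interleave_indep :
  indep_systems P (preimage_set_system setT fst G) (seq_sigma interleave).
Proof.
move=> _ E [g Gg <-]; rewrite setTI seq_sigmaE => -[B mB <-]; rewrite setTI setIC muleC.
have mg := Gm Gg.
apply: (@indep_rect _ _ _ P _ _ (fun j w => interleave j w)) => //.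
  by rewrite -[X in measurable X]setTI; exact: measurable_fst.
move=> n C mC; apply: etrans (interleave_rect n Gg mC) _; congr (_ * _)%E.
  exact/esym/(iid_rect n interleave_iid mC).
exact/esym/prod_fst.
Qed.

End interleave.

Section sampling_independence.
Context (R : realType) (d d' : measure_display) (Om : measurableType d).
Context (T : measurableType d') (P : probability Om R).
Variables (p : nat -> {RV P >-> R}) (Z : nat -> {RV P >-> T}) (I : nat -> {RV P >-> nat}).
Hypothesis p0 : forall k w, 0 <= p k w.

Definition joint_sigma : set (set Om) := <<s seq_sigma p `|` seq_sigma Z >>.

Lemma joint_sigma_measurable : joint_sigma `<=` measurable.
Proof.
apply: smallest_sub; first exact: sigma_algebra_measurable.
by move=> A [|] /seq_sigma_measurable.
Qed.

Lemma joint_sigmaT : joint_sigma setT.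
Proof. by rewrite -setC0; apply: sigma_algebraC; exact: sigma_algebra0. Qed.

Lemma sigma_algebra_setI (X : Type) (F : set (set X)) : sigma_algebra setT F -> setI_closed F.
Proof.
move=> [F0 FC FU] A B FA FB; have FC' C : F C -> F (~` C) by move=> /FC; rewrite setTD.
rewrite -[_ `&` _]setCK setCI; apply: (FC' _).
have -> : ~` A `|` ~` B = \bigcup_n (if n is 0%N then ~` A else ~` B).
  apply/seteqP; split=> x /=; first by move=> [|] h; [exists 0%N|exists 1%N].
  by move=> [[|n] _ h]; [left|right].
by apply: FU => -[|n]; exact: (FC' _).
Qed.

Lemma joint_sigmaI : setI_closed joint_sigma.
Proof. by apply: sigma_algebra_setI; exact: smallest_sigma_algebra. Qed.

Hypothesis sI : sampling P joint_sigma (fun k => p k : Om -> R) (fun i => I i : Om -> nat).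
Hypothesis pZ : indep_systems P (seq_sigma p) (seq_sigma Z).

Let mI i k : measurable (I i @^-1` [set k]).
Proof. by rewrite -[X in measurable X]setTI; exact: measurable_funP. Qed.

(** Given weights and types, the probability of an index event is a function of the weights alone,
    and the weights are independent of the types. *)
Lemma sampling_indep_rect (D E : set Om) n (B : nat -> set nat) :
  seq_sigma p D -> seq_sigma Z E ->
  P ((D `&` E) `&` [set w | forall i, (i < n)%N -> B i (I i w)]) =
  (P (D `&` [set w | forall i, (i < n)%N -> B i (I i w)]) * P E)%E.
Proof.
move=> pD ZE; have mE := seq_sigma_measurable ZE.
have FD : joint_sigma D by apply: sub_sigma_algebra; left.
have FE : joint_sigma E by apply: sub_sigma_algebra; right.
pose A i k : set Om := if `[< B i k >] then setT else set0.
have FA i k : joint_sigma (A i k).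
  by rewrite /A; case: ifP => _; [exact: joint_sigmaT|exact: sigma_algebra0].
have AE : [set w | forall i, (i < n)%N -> B i (I i w)] =
  [set w | (forall i, i \in [::] -> I i w = 0%N) /\
           (forall i, i \in iota 0 n -> A i (I i w) w)].
  apply/seteqP; split=> w /=.
    by move=> h; split=> // i; rewrite mem_iota add0n /A => /= /h ?; rewrite asboolT.
  move=> [_ h] i ilt; have := h i; rewrite mem_iota add0n => /(_ ilt).
  by rewrite /A; case: asboolP.
have mix_joint C : joint_sigma C -> P (C `&` [set w | forall i, (i < n)%N -> B i (I i w)]) =
    (\int[P]_(w in C) \prod_(i <- iota 0 n) mix (fun k => p k : Om -> R) (A i) w)%E.
  move=> FC; rewrite AE.
  rewrite (sampling_mix p0 _ mI joint_sigma_measurable joint_sigmaI (fun=> 0%N) sI)// ?cats0 ?iota_uniq//.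
  by apply: eq_integral => w _; rewrite big_nil mul1e.
have mD := joint_sigma_measurable FD.
rewrite !mix_joint//; last exact: joint_sigmaI.
(* The conditional probability of the index event as a function of the weights; absolute values
   extend it nonnegatively and measurably to all sequences. *)
pose h (v : nat -> R) : \bar R := (\prod_(i <- iota 0 n)
  (\sum_(0 <= k <oo) (`|v k|%:E * (if `[< B i k >] then 1 else 0))))%E.
have hE w : (\prod_(i <- iota 0 n) mix (fun k => p k : Om -> R) (A i) w)%E = h (p ^~ w).
  apply: eq_bigr => i _; apply: eq_eseriesr => k _.
  by rewrite /A ger0_norm//; case: ifP => _; rewrite ?indicT ?indic0.
have mh : measurable_fun [set: seqspace R] h.
  apply: emeasurable_prod => i; apply: ge0_emeasurable_sum => k.
    by move=> v _ _; rewrite mule_ge0// ?lee_fin//; case: ifP.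
  move=> _; apply: emeasurable_funM => //; apply/measurable_EFinP.
  by apply: measurableT_comp => //; exact: measurable_coord.
have h0 v : (0 <= h v)%E.
  apply: prode_ge0 => i _; apply: nneseries_ge0 => k _ _.
  by rewrite mule_ge0// ?lee_fin//; case: ifP.
have mps : measurable_fun setT (fun w => (fun k => p k w) : seqspace R).
  exact: (@measurable_seq _ R _ _ (fun k w => p k w)).
under eq_integral do rewrite hE.
under [in RHS]eq_integral do rewrite hE.
move: (pD); rewrite seq_sigmaE => -[D' mD' DE]; rewrite setTI in DE.
rewrite -DE setIC [LHS]integral_mkcondr [X in (X * _)%E]integral_mkcond.
pose h' (v : seqspace R) := (h v * (\1_D' v)%:E)%E.
have h'E w : (((fun w => h (p ^~ w)) \_ ((fun w => (fun k => p k w) : seqspace R) @^-1` D')) w =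
    h' (fun k => p k w))%E.
  rewrite patchE /h' indicE; case: ifPn => wD.
    by rewrite mem_set ?mule1//; rewrite inE in wD.
  by rewrite memNset ?mule0//; rewrite notin_setE in wD.
under eq_integral do rewrite h'E.
under [in RHS]eq_integral do rewrite h'E.
apply: (@integral_indep _ _ _ P _ (seqspace R) _ E h' mps mE) => //.
- move=> B' mB'; apply: pZ => //; rewrite seq_sigmaE.
  by exists B' => //; rewrite setTI.
- by apply: emeasurable_funM => //; apply/measurable_EFinP; exact: measurable_indic.
- by move=> v; rewrite mule_ge0// lee_fin.
Qed.

Lemma sampling_indep_setI (D g E : set Om) :
  seq_sigma p D -> seq_sigma I g -> seq_sigma Z E -> P ((D `&` g) `&` E) = (P (D `&` g) * P E)%E.
Proof.
move=> pD Ig ZE.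
have mE := seq_sigma_measurable ZE; have mD := seq_sigma_measurable pD.
have mDE : measurable (D `&` E) by exact: measurableI.
have PE0 : 0 <= fine (P E) by rewrite fine_ge0.
move: Ig; rewrite seq_sigmaE => -[B mB <-]; rewrite setTI.
have mI' : measurable_fun setT (fun w => (fun k => I k w) : seqspace nat).
  exact: (@measurable_seq _ nat _ _ (fun k w => I k w)).
rewrite [D `&` _]setIC -setIA [RHS]muleC -(fineK (fin_num_prob P mE)).
have := @finite_measure_unique R _ (seqspace nat) (@rects _ nat)
  (pushforward (mrestr P mDE) (mfun_Sub (mem_set mI')))
  (mscale (NngNum PE0) (pushforward (mrestr P mD) (mfun_Sub (mem_set mI')))).
move=> /(_ mI' mI') /(_ _ _ _ _ _ B); rewrite /= /mscale /= /pushforward /mrestr.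
apply.
- by rewrite measurable_rects; exact: sub_sigma_algebra.
- exact: rectsT.
- exact: rectsI.
- by rewrite preimage_setT setTI ltey_eq fin_num_prob.
- move=> _ [n [C [mC ->]]]; rewrite setIC fineK ?fin_num_prob// muleC [in RHS]setIC.
  exact: sampling_indep_rect.
- by rewrite -measurable_rects.
Qed.

(** Weights are kept along with indices because the reconstruction of a species model later needs
    relabelled types that are independent of both at once. *)
Definition weight_index_sigma : set (set Om) := <<s seq_sigma p `|` seq_sigma I >>.

(** Intersections of a weight event and an index event form a pi-system generating the joint
    sigma-algebra. This independence is what permits relabelling the types by a function of the
    indices. *)
Lemma sampling_indep : indep_systems P weight_index_sigma (seq_sigma Z).
Proof.
move=> g E Gg ZE; have mE := seq_sigma_measurable ZE.
have PE0 : 0 <= fine (P E) by rewrite fine_ge0.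
pose PS : set (set Om) := [set A | exists D g, [/\ seq_sigma p D, seq_sigma I g & A = D `&` g]].
have sT d0 (U : measurableType d0) (X : nat -> {RV P >-> U}) : seq_sigma X setT.
  by rewrite -setC0; apply: sigma_algebraC; exact: sigma_algebra0.
have := @finite_measure_unique R _ Om PS (mrestr P mE) (mscale (NngNum PE0) P).
move=> /(_ _ _ _ _ _ g); rewrite /= /mscale /= /mrestr fineK ?fin_num_prob// muleC; apply.
- by move=> _ [D [h [/seq_sigma_measurable mD /seq_sigma_measurable mh ->]]]; exact: measurableI.
- by exists setT, setT; split; rewrite ?setIT//; exact: sT.
- move=> _ _ [D [h [pD Ih ->]]] [D' [h' [pD' Ih' ->]]].
  exists (D `&` D'), (h `&` h'); split; last by rewrite setIACA.
    exact: (sigma_algebra_setI (smallest_sigma_algebra _ _)).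
  exact: (sigma_algebra_setI (smallest_sigma_algebra _ _)).
- by rewrite setTI ltey_eq fin_num_prob.
- by move=> _ [D [h [pD Ih ->]]]; rewrite [RHS]muleC; exact: sampling_indep_setI.
- move: Gg; apply: smallest_sub; first exact: smallest_sigma_algebra.
  move=> A [pA|IA]; apply: sub_sigma_algebra.
    by exists A, setT; rewrite setIT; split=> //; exact: sT.
  by exists setT, A; rewrite setTI; split=> //; exact: sT.
Qed.

End sampling_independence.

Section eppf_exchangeable.
Context (R : realType) (d : measure_display) (Om : measurableType d).
Variables (P : probability Om R) (Pi : forall n : nat, Om -> {set {set 'I_n}}).
Variable q : seq nat -> R.

Lemma permute_partitionK n (rho : 'S_n) (pi : {set {set 'I_n}}) :
  permute_partition (rho^-1)%g (permute_partition rho pi) = pi.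
Proof.
apply/setP => B; apply/imsetP/idP => [[_ /imsetP[C Cpi ->] ->]|Bpi].
  by rewrite -imset_comp (eq_imset _ (permK rho)) imset_id.
exists (rho @: B)%SET; first exact: imset_f.
by rewrite -imset_comp (eq_imset _ (permK rho)) imset_id.
Qed.

Lemma permute_partition_partition n (rho : 'S_n) (pi : {set {set 'I_n}}) :
  finset.partition pi [set: 'I_n]%SET ->
  finset.partition (permute_partition rho pi) [set: 'I_n]%SET.
Proof.
move=> pip; have fE := fibers_block_rank pip.
have := fibers_permute (rho^-1)%g (block_rank pi); rewrite invgK fE => ->.
exact: fibers_partition.
Qed.

Lemma permute_partition_sizes n (rho : 'S_n) (pi : {set {set 'I_n}}) :
  perm_eq [seq #|(B : {set 'I_n})| | B <- blocks (permute_partition rho pi)]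
          [seq #|(B : {set 'I_n})| | B <- blocks pi].
Proof.
have inj_rho : injective (fun B : {set 'I_n} => (rho @: B)%SET) by apply: imset_inj; exact: perm_inj.
apply: (perm_trans (y := [seq #|(B : {set 'I_n})| | B <- enum (permute_partition rho pi)])).
  by apply: perm_map; rewrite /blocks perm_sort.
apply: (perm_trans (y := [seq #|(B : {set 'I_n})| | B <- enum pi])); last first.
  by apply: perm_map; rewrite /blocks perm_sym perm_sort.
apply: (perm_trans (y := [seq #|(B : {set 'I_n})| | B <- [seq (rho @: (B : {set 'I_n}))%SET | B <- enum pi]])).
  apply: perm_map; apply: uniq_perm; rewrite ?enum_uniq ?map_inj_uniq ?enum_uniq//.
  move=> B; rewrite mem_enum; apply/imsetP/mapP => -[C Cpi ->]; exists C => //.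
    by rewrite mem_enum.
  by rewrite mem_enum in Cpi.
rewrite -map_comp (eq_map (g := fun B : {set 'I_n} => #|B|))// => B /=.
by rewrite card_imset//; exact: perm_inj.
Qed.

(** Permuting points preserves the multiset of block sizes, the only thing a symmetric [q] sees. *)
Lemma has_eppf_exchangeable : random_partition Pi -> has_eppf P Pi q ->
  exchangeable_partition P Pi.
Proof.
move=> [_ Pip _] [qsym Pq] [|n] rho pi.
  (* [has_eppf] is silent for n = 0, but a partition of the empty set has no block to permute. *)
  have -> : [set w | permute_partition rho (Pi 0 w) = pi] = [set w | Pi 0 w = pi] => //.
  have E w : permute_partition rho (Pi 0 w) = Pi 0 w.
    have P0 x : x \in Pi 0 w = false.
      have /and3P[_ _] := Pip 0%N w; apply: contraNF => xP.
      by have -> // : finset.set0 = x by apply/setP => -[].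
    by apply/setP => B; rewrite P0; apply/imsetP => -[C]; rewrite P0.
  by apply/seteqP; split=> w /=; rewrite E.
have [pip|npip] := boolP (finset.partition pi [set: 'I_n.+1]%SET); last first.
  have -> : [set w | permute_partition rho (Pi n.+1 w) = pi] = set0.
    apply/seteqP; split=> w //= h; move: npip; rewrite -h.
    by rewrite permute_partition_partition.
  have -> // : [set w | Pi n.+1 w = pi] = set0.
  by apply/seteqP; split=> w //= h; move: npip; rewrite -h Pip.
have -> : [set w | permute_partition rho (Pi n.+1 w) = pi] =
    [set w | Pi n.+1 w = permute_partition (rho^-1)%g pi].
  apply/seteqP; split=> w /= h; first by rewrite -h permute_partitionK.
  by rewrite h; have := permute_partitionK (rho^-1)%g pi; rewrite invgK.
rewrite !Pq//; last exact: permute_partition_partition.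
congr EFin; apply: qsym; last exact: permute_partition_sizes.
apply/allP => x /mapP[B]; rewrite mem_sort mem_enum => Bpi ->.
have /and3P[_ _ h] := permute_partition_partition (rho^-1)%g pip.
by rewrite card_gt0; apply: contraNneq h => <-.
Qed.

End eppf_exchangeable.

Section class_value.

Definition class_of (f : nat -> nat) (n : nat) : nat :=
  find (fun B : {set 'I_n.+1} => ord_max \in B) (blocks (fibers (fun i : 'I_n.+1 => f i))).

Lemma class_of_eq f n m : (class_of f n = class_of f m) <-> f n = f m.
Proof. by rewrite /class_of !find_blocks rank_occ_first_index. Qed.

Definition class_hit (f : nat -> nat) (j : nat) : set nat := [set n | class_of f n = j].

(** A class that occurs takes the type of its own index, at an even position of the interleaved
    sequence; a class that never occurs takes the reserve type at the odd position j.*2.+1. *)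
Definition class_select (f : nat -> nat) (j : nat) : nat :=
  if pselect (class_hit f j !=set0) is left _ then (f (xget 0%N (class_hit f j))).*2
  else j.*2.+1.

Lemma class_select_hit f n : class_select f (class_of f n) = (f n).*2.
Proof.
rewrite /class_select; case: pselect => [h|[]]; last by exists n.
case: xgetP => [m _ mn|/(_ n) []//].
by congr _.*2; apply/class_of_eq.
Qed.

Lemma class_select_miss f j : ~ (class_hit f j !=set0) -> class_select f j = j.*2.+1.
Proof. by rewrite /class_select; case: pselect. Qed.

(** Parity separates classes that occur from those that do not; among the former, distinct classes
    have distinct indices. *)
Lemma class_select_inj f : injective (class_select f).
Proof.
move=> i j; have [[n ni]|ni] := pselect (class_hit f i !=set0);
  have [[m mj]|mj] := pselect (class_hit f j !=set0).
- rewrite -ni -mj !class_select_hit => /double_inj.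
  exact: (class_of_eq f n m).2.
- by rewrite -ni class_select_hit class_select_miss// => /(congr1 odd); rewrite /= !odd_double.
- by rewrite -mj class_select_hit class_select_miss// => /(congr1 odd); rewrite /= !odd_double.
- by rewrite !class_select_miss// => -[] /double_inj.
Qed.

(** Prefixes of length n are countably many, so such a set is a countable union of rectangles. *)
Lemma measurable_finite_dep (n : nat) (S : set (nat -> nat)) :
  (forall f g, (forall i, (i < n)%N -> f i = g i) -> S f -> S g) ->
  measurable (S : set (seqspace nat)).
Proof.
move=> Sdep.
pose C (t : seq nat) : set (seqspace nat) :=
  if `[< S (nth 0%N t) >] then rect n (fun i => [set nth 0%N t i]) else set0.
rewrite (_ : S = \bigcup_t C t); last first.
  apply/seteqP; split=> f.
    move=> Sf; exists (mkseq f n) => //; rewrite /C asboolT.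
      by move=> i ilt /=; rewrite nth_mkseq.
    by apply: Sdep Sf => i ilt; rewrite nth_mkseq.
  move=> [t _]; rewrite /C; case: asboolP => // St ft.
  by apply: Sdep St => i ilt; rewrite ft.
apply: countable_bigcupT_measurable => // t; rewrite /C; case: ifP => // _.
exact: measurable_rect.
Qed.

Lemma class_of_dep f g n : (forall i, (i < n.+1)%N -> f i = g i) -> class_of f n = class_of g n.
Proof.
move=> fg; rewrite /class_of (_ : (fun i : 'I_n.+1 => f i) = (fun i => g i))//.
by apply/funext => i; exact: fg.
Qed.

Lemma measurable_class_select j k :
  measurable ([set f | class_select f j = k] : set (seqspace nat)).
Proof.
pose A n : set (seqspace nat) := [set f | class_of f n = j /\ (f n).*2 = k].
pose B n : set (seqspace nat) := [set f | class_of f n = j].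
have mA n : measurable (A n).
  apply: (@measurable_finite_dep n.+1) => f g fg; rewrite /A /= => -[<- <-]; split; last by rewrite fg.
  by apply: class_of_dep => i ilt; rewrite fg.
have mB n : measurable (B n).
  apply: (@measurable_finite_dep n.+1) => f g fg; rewrite /B /= => <-.
  by apply: class_of_dep => i ilt; rewrite fg.
rewrite (_ : [set f | _] = (\bigcup_n A n) `|` (~` (\bigcup_n B n) `&`
    (if j.*2.+1 == k then setT else set0))).
  apply: measurableU; first exact: bigcupT_measurable.
  by apply: measurableI; [exact/measurableC/bigcupT_measurable|case: ifP].
apply/seteqP; split=> f /=.
  have [[n nj]|nj] := pselect (class_hit f j !=set0).
    by move: (nj) => <-; rewrite class_select_hit => fk; left; exists n.
  rewrite class_select_miss// => /eqP ->; right; split=> //.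
  by move=> [n _ Bn]; apply: nj; exists n.
move=> [[n _ [<- <-]]|[nB]]; first exact: class_select_hit.
case: eqP => // <- _; apply: class_select_miss => -[n nj].
by apply: nB; exists n.
Qed.

End class_value.

Section relabeling.
Context (R : realType) (d d' : measure_display) (Om : measurableType d) (T : measurableType d').
Variables (P : probability Om R) (H : probability T R).
Variables (p : nat -> {RV P >-> R}) (Z : nat -> {RV P >-> T}) (I : nat -> {RV P >-> nat}).

Local Notation P2 := (P \x P)%E.
Local Notation G1 := (weight_index_sigma p I).
Local Notation G := (preimage_set_system setT (fst : Om * Om -> Om) G1).

Lemma sigma_algebra_weight_index : sigma_algebra setT G1.
Proof. exact: smallest_sigma_algebra. Qed.

Lemma weight_index_sigma_measurable : G1 `<=` measurable.
Proof.
apply: smallest_sub; first exact: sigma_algebra_measurable.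
by move=> A [|] /seq_sigma_measurable.
Qed.

Lemma weight_index_sigma_index (D : set (seqspace nat)) : measurable D ->
  G1 [set w | D (fun n => I n w)].
Proof.
move=> mD; apply: sub_sigma_algebra; right; rewrite seq_sigmaE.
by exists D => //; rewrite setTI.
Qed.

Lemma weight_index_sigma_weight (D : set (seqspace R)) : measurable D ->
  G1 [set w | D (fun n => p n w)].
Proof.
move=> mD; apply: sub_sigma_algebra; left; rewrite seq_sigmaE.
by exists D => //; rewrite setTI.
Qed.

Hypothesis Z_iid : iid Z H.
Hypothesis p0 : forall k w, 0 <= p k w.
Hypothesis pZ : indep_systems P (seq_sigma p) (seq_sigma Z).
Hypothesis sI : sampling P (joint_sigma p Z) (fun k => p k : Om -> R) (fun i => I i : Om -> nat).
Variable sel : seqspace nat -> nat -> nat.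
Hypothesis msel : forall j k, measurable [set f | sel f j = k].
Hypothesis sel_inj : forall f, injective (sel f).

Let G1Z : indep_systems P G1 (seq_sigma Z). Proof. exact: sampling_indep. Qed.

Let G1T : G1 setT.
Proof. by have [G0 GC _] := sigma_algebra_weight_index; rewrite -(setD0 setT); exact: GC. Qed.

Let GT : G setT. Proof. by exists setT => //; rewrite preimage_setT setIT. Qed.

Let Gm : G `<=` measurable.
Proof.
move=> _ [g /weight_index_sigma_measurable mg <-]; apply: measurableI => //.
by rewrite -[X in measurable X]setTI; exact: measurable_fst.
Qed.

Let GI : setI_closed G.
Proof.
by apply: sigma_algebra_setI; apply: sigma_algebra_preimage; exact: sigma_algebra_weight_index.
Qed.

Let ZZ : nat -> {RV P2 >-> T} := interleave Z Z.

Let ZZ_iid : iid ZZ H.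
Proof. exact: interleave_iid Z_iid Z_iid weight_index_sigma_measurable G1Z G1T. Qed.

Let GZZ : indep_systems P2 G (seq_sigma ZZ).
Proof. exact: interleave_indep Z_iid Z_iid weight_index_sigma_measurable G1Z G1T. Qed.

Let sg j (w : Om * Om) : nat := sel (fun i => I i w.1) j.

Let Gsg j k : G (sg j @^-1` [set k]).
Proof.
exists [set w | sel (fun i => I i w) j = k]; last by rewrite setTI.
exact: (weight_index_sigma_index (msel j k)).
Qed.

Let sg_inj w : injective (sg ^~ w). Proof. exact: sel_inj. Qed.

(* the types interleaved with an independent copy of them, relabelled by an
   injection that depends on the indices only *)
Definition relabeled : nat -> {RV P2 >-> T} := selected ZZ Gm Gsg.

Lemma relabeled_rect (g : set Om) n (B : nat -> set T) : G1 g -> (forall i, measurable (B i)) ->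
  P2 ([set w | forall i, (i < n)%N -> B i (relabeled i w)] `&` fst @^-1` g) =
  (P g * \prod_(i < n) H (B i))%E.
Proof.
move=> Gg mB; have Gg2 : G (fst @^-1` g) by exists g => //; rewrite setTI.
apply: etrans (selected_rect ZZ_iid GZZ Gm GI Gsg sg_inj n Gg2 mB) _.
by congr (_ * _)%E; exact: (prod_fst P P (weight_index_sigma_measurable Gg)).
Qed.

Lemma relabeled_iid : iid relabeled H.
Proof. exact: (selected_iid ZZ_iid GZZ Gm GI Gsg sg_inj GT). Qed.

Lemma relabeled_indep : indep_systems P2 G (seq_sigma relabeled).
Proof.
by move=> A B; exact: (@selected_indep _ _ _ _ _ _ _ _ _ _ ZZ_iid GZZ Gm GI Gsg sg_inj GT).
Qed.

End relabeling.

Section weights_to_partition.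
Context (R : realType) (X : ptopologicalType) (q : seq nat -> R).
Context (H : probability (borel X) R).
Context (d : measure_display) (Om : measurableType d) (P : probability Om R).
Variables (p : nat -> {RV P >-> R}) (Z : nat -> {RV P >-> borel X}).
Variable I : nat -> {RV P >-> nat}.
Hypothesis pZ : species_data q H p Z.
Hypothesis sI : sampling P (joint_sigma p Z) (fun k => p k : Om -> R) (fun i => I i : Om -> nat).

Local Notation P2 := (P \x P)%E.

Let mI i k : measurable (I i @^-1` [set k]).
Proof. by rewrite -[X in measurable X]setTI; exact: measurable_funP. Qed.

Let p0 k w : 0 <= p k w.
Proof. by have [_ [h _] _ _] := pZ; have /andP[] := h k w. Qed.

Local Notation G1 := (weight_index_sigma p I).

Let Ziid : iid Z H. Proof. by case: pZ. Qed.

Let pi_Z : indep_systems P (seq_sigma p) (seq_sigma Z). Proof. by case: pZ. Qed.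

Let G1m : G1 `<=` measurable. Proof. exact: weight_index_sigma_measurable. Qed.

Let Z' : nat -> {RV P2 >-> borel X} := relabeled p Z I measurable_class_select.

Let Pi n (w : Om * Om) : {set {set 'I_n}} := fibers (fun i : 'I_n => I i w.1).

Let fibers_class n pi : G1 [set w | fibers (fun i : 'I_n => I i w) = pi].
Proof.
apply: (@weight_index_sigma_index _ _ _ _ _ _ [set f : nat -> nat | fibers (fun i : 'I_n => f i) = pi]).
apply: (@measurable_finite_dep n) => f g fg /= <-.
by apply: eq_fibers => i j; rewrite !fg.
Qed.

(** The second factor of [P \x P] only supplies the reserve; indices and partition live on the
    first. A class index met along the sequence always belongs to a class that occurs, so its
    relabelled type is the original one, at every point and not just almost surely. *)
Lemma weights_partition : exists (Pi : forall n : nat, Om * Om -> {set {set 'I_n}})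
    (Z' : nat -> {RV P2 >-> borel X}),
  [/\ exchangeable_with_eppf P2 Pi q, iid Z' H,
      indep_systems P2 (partition_sigma Pi) (seq_sigma Z') &
      forall n w, Z (I n w.1) w.1 = Z' (class_index Pi n w) w].
Proof.
exists Pi, Z'.
have rpPi : random_partition Pi.
  split=> [n pi|n w|m n le_mn w].
  - rewrite (_ : Pi n @^-1` [set pi] = fst @^-1` [set w | fibers (fun i : 'I_n => I i w) = pi])//.
    rewrite -[X in measurable X]setTI; apply: measurable_fst => //.
    exact: G1m.
  - exact: fibers_partition.
  - exact: fibers_restrict.
have [_ pw _ pq] := pZ.
have FT : joint_sigma p Z setT by exact: joint_sigmaT.
have qPi : has_eppf P2 Pi q.
  split; first by case: pq => s [_ [d1 [Om1 [P1 [Pi1 [v [[_ _ [qs _]] _ _]]]]]]].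
  move=> n pi n0 pip; rewrite -(paintbox_law pw mI FT sI pq pip n0).
  apply: (@prod_fst _ _ _ _ _ P P [set w | fibers (fun i : 'I_n => I i w) = pi]).
  exact: G1m.
split=> //.
- by split => //; exact: has_eppf_exchangeable rpPi qPi.
- exact: (relabeled_iid Ziid p0 pi_Z sI measurable_class_select class_select_inj).
- have selG A B : preimage_set_system setT (fst : Om * Om -> Om) G1 A -> seq_sigma Z' B ->
      P2 (A `&` B) = (P2 A * P2 B)%E.
    exact: (relabeled_indep Ziid p0 pi_Z sI class_select_inj).
  move=> A B PiA ZB; apply: (selG A B) => //.
  move: A PiA; apply: smallest_sub => [|A [n _ [S _ <-]]].
    by apply: sigma_algebra_preimage; exact: sigma_algebra_weight_index.
  exists (\bigcup_(pi in S) [set w | fibers (fun i : 'I_n => I i w) = pi]); last first.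
    rewrite !setTI; apply/seteqP; split=> w /=; first by move=> [pi0 Spi0 wpi0]; rewrite /Pi wpi0.
    by move=> Sw; exists (Pi n w).
  have [F0 _ FU] := sigma_algebra_weight_index p I.
  pose C (k : nat) := if unpickle k is Some pi then
    (if `[< S pi >] then [set w | fibers (fun i : 'I_n => I i w) = pi] else set0) else set0.
  rewrite (_ : \bigcup_(pi in S) _ = \bigcup_k C k).
    by apply: FU => k; rewrite /C; case: unpickle => // pi; case: ifP.
  apply/seteqP; split=> w /=.
    by move=> [pi Spi wpi]; exists (pickle pi) => //; rewrite /C pickleK asboolT.
  by move=> [k _]; rewrite /C; case: unpickle => // pi; case: asboolP => // Spi wpi; exists pi.
- move=> n w; rewrite /Z' /=.
  have -> : class_select (fun i => I i w.1) (class_index Pi n w) = (I n w.1).*2.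
    exact: (class_select_hit (fun i => I i w.1) n).
  by rewrite /interleave_fun odd_double doubleK.
Qed.

End weights_to_partition.

(** Reading the class of i off a partition of all of [n] makes one value of [Pi n] determine the
    classes of all its points simultaneously. *)
Definition partition_class n (pi : {set {set 'I_n}}) (i : 'I_n) : nat :=
  find (fun B : {set 'I_i.+1} => ord_max \in B) (blocks (restrict_partition (ltn_ord i) pi)).

(** * The law of a species sequence in terms of [q] and [H] *)

Section partition_species_law.
Context (R : realType) (d d' : measure_display) (T : measurableType d').
Context (Om : measurableType d) (P : probability Om R) (H : probability T R).
Variables (Pi : forall n : nat, Om -> {set {set 'I_n}}) (q : seq nat -> R).
Variable Z : nat -> {RV P >-> T}.
Hypothesis qPi : exchangeable_with_eppf P Pi q.
Hypothesis Z_iid : iid Z H.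
Hypothesis PiZ : indep_systems P (partition_sigma Pi) (seq_sigma Z).

Let rpPi : random_partition Pi. Proof. by case: qPi. Qed.

Lemma class_indexE n (i : 'I_n) w : class_index Pi i w = partition_class (Pi n w) i.
Proof. by have [_ _ r] := rpPi; rewrite /class_index /partition_class r. Qed.

Let mPi n pi : measurable (Pi n @^-1` [set pi]). Proof. by case: rpPi. Qed.

Lemma measurable_class_index i k : measurable (class_index Pi i @^-1` [set k]).
Proof.
rewrite (_ : _ @^-1` _ = Pi i.+1 @^-1` [set x |
   find (fun B : {set 'I_i.+1} => ord_max \in B) (blocks x) = k])//.
exact: (measurable_preimage_fin (@mPi i.+1)).
Qed.

Lemma measurable_class_value n : measurable_fun setT (fun w => Z (class_index Pi n w) w).
Proof.
apply: (@measurable_select _ _ _ _ (fun k => Z k : Om -> T) (class_index Pi n)) => //.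
exact: measurable_class_index.
Qed.

(** Given [Pi n], the types attached to distinct classes are independent with law [H]. Apart from
    [H] and B, the right-hand side involves only the law of [Pi n]. *)
Lemma partition_rect_law n (B : nat -> set T) : (forall i, measurable (B i)) ->
  P [set w | forall i, (i < n)%N -> B i (Z (class_index Pi i w) w)] =
  (\sum_(pi : {set {set 'I_n}}) P [set w | Pi n w = pi] *
     \prod_(j <- undup [seq partition_class pi i | i : 'I_n])
        H (\bigcap_(i in [set i : 'I_n | partition_class pi i = j]) B i))%E.
Proof.
move=> mB; rewrite (prob_fin P (@mPi n)); last first.
  rewrite (_ : [set w | _] = \bigcap_(i in `I_n) (fun w => Z (class_index Pi i w) w) @^-1` (B i)).
    apply: bigcap_measurableType => i _; rewrite -[X in measurable X]setTI.
    exact: measurable_class_value.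
  by apply/seteqP; split=> w /= h i ilt; exact: h.
apply: eq_bigr => pi _.
(* Points of one class share a type, so their constraints merge into one. *)
pose C j : set T := \bigcap_(i in [set i : 'I_n | partition_class pi i = j]) B i.
have mC j : measurable (C j) by apply: fin_bigcap_measurable.
pose t := undup [seq partition_class pi i | i : 'I_n].
rewrite -[X in (_ * X)%E]/(\prod_(j <- t) H (C j))%E.
rewrite -(iid_seq Z_iid)//; last exact: undup_uniq.
rewrite -PiZ//.
- congr (P _); apply/seteqP; split=> w /=.
    move=> [h wpi]; split=> // j; rewrite mem_undup => /mapP[i _ ->] k /= ki.
    by have := h k (ltn_ord k); rewrite class_indexE wpi ki.
  move=> [wpi h]; split=> // i ilt.
  rewrite (class_indexE (Ordinal ilt)) wpi.
  apply: (h (partition_class pi (Ordinal ilt)) _ (Ordinal ilt)) => //.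
  by rewrite mem_undup map_f// mem_enum.
- apply: sub_sigma_algebra; exists n => //; exists [set pi] => //; by rewrite setTI.
- exact: seq_sigma_seq.
Qed.

End partition_species_law.

Lemma partition_same_law (R : realType) (d1 d2 d' : measure_display) (T : measurableType d')
    (Om1 : measurableType d1) (P1 : probability Om1 R)
    (Om2 : measurableType d2) (P2 : probability Om2 R) (H : probability T R)
    (q : seq nat -> R)
    (Pi1 : forall n : nat, Om1 -> {set {set 'I_n}}) (Z1 : nat -> {RV P1 >-> T})
    (Pi2 : forall n : nat, Om2 -> {set {set 'I_n}}) (Z2 : nat -> {RV P2 >-> T}) :
  exchangeable_with_eppf P1 Pi1 q -> iid Z1 H ->
  indep_systems P1 (partition_sigma Pi1) (seq_sigma Z1) ->
  exchangeable_with_eppf P2 Pi2 q -> iid Z2 H ->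
  indep_systems P2 (partition_sigma Pi2) (seq_sigma Z2) ->
  same_law P1 P2 (fun w => (fun n => Z1 (class_index Pi1 n w) w) : seqspace T)
                 (fun w => (fun n => Z2 (class_index Pi2 n w) w) : seqspace T).
Proof.
move=> q1 Z1H PZ1 q2 Z2H PZ2; apply: seq_same_law.
- by move=> n; exact: (measurable_class_value Z1 q1).
- by move=> n; exact: (measurable_class_value Z2 q2).
(* For n = 0 there is no constraint, and no EPPF value to compare. *)
move=> n B mB; case: n => [|n].
  have TE (U : Type) (Q : nat -> U -> Prop) : [set w | forall i, (i < 0)%N -> Q i w] = setT.
    by apply/seteqP; split.
  by rewrite !TE !probability_setT.
have E1 := partition_rect_law q1 Z1H PZ1 n.+1 mB; have E2 := partition_rect_law q2 Z2H PZ2 n.+1 mB.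
apply: etrans E1 _; apply: etrans _ (esym E2).
apply: eq_bigr => pi _; congr (_ * _)%E.
(* The EPPF prescribes the probabilities of partitions only; any other family of sets is never a
   value of either process. *)
have [pip|npip] := boolP (finset.partition pi [set: 'I_n.+1]%SET).
  have [_ _ [_ h1]] := q1; have [_ _ [_ h2]] := q2.
  by rewrite h1// h2.
have empty (d : measure_display) (Om : measurableType d) (P : probability Om R)
    (Pi : forall n : nat, Om -> {set {set 'I_n}}) :
    random_partition Pi -> [set w | Pi n.+1 w = pi] = set0.
  by move=> [_ h _]; apply/seteqP; split=> w //= wpi; move: npip; rewrite -wpi h.
by rewrite (empty _ _ P1)// ?(empty _ _ P2)// ?measure0//; [case: q2|case: q1].
Qed.

(** * Conditional probabilities and laws of species sequences *)

Section conditional_probability.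
Context (R : realType) (d : measure_display) (Om : measurableType d).
Variables (P : probability Om R) (F : set (set Om)).
Hypothesis Fs : sigma_algebra setT F.
Hypothesis Fm : F `<=` measurable.

Local Notation OF := (g_sigma_algebraType F).

(** Taking [F] as the sigma-algebra of a measurable type of its own makes the calculus of measurable
    functions available for [F]-measurability. *)
Lemma sub_measurableP (d' : measure_display) (T : measurableType d') (f : Om -> T) :
  (forall B : set T, measurable B -> F (f @^-1` B)) <-> measurable_fun [set: OF] (f : OF -> T).
Proof.
split=> [h _ B mB|h B mB]; first by rewrite setTI; apply: sub_sigma_algebra; exact: h.
have := h measurableT B mB; rewrite setTI.
by rewrite measurable_g_measurableTypeE.
Qed.

Lemma sub_measurable (d' : measure_display) (T : measurableType d') (f : Om -> T) :
  measurable_fun [set: OF] (f : OF -> T) -> measurable_fun [set: Om] f.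
Proof. by move=> /sub_measurableP h _ B mB; rewrite setTI; apply: Fm; exact: h. Qed.

Lemma integrable_ae_eq (f g : Om -> \bar R) :
  {ae P, forall w, f w = g w} -> P.-integrable setT f ->
  measurable_fun setT g -> P.-integrable setT g.
Proof.
move=> fg /integrableP[mf fi] mg; apply/integrableP; split=> //.
rewrite (ae_eq_integral (fun x => `|f x|%E))//.
- exact: measurableT_comp.
- exact: measurableT_comp.
- by apply: filterS fg => w -> _.
Qed.

(** The set where f exceeds g belongs to [F], so f and g have equal integrals over it, which is
    impossible unless it is null. *)
Lemma cond_prob_ae_le A (f g : Om -> R) : measurable A ->
  cond_prob P F A f -> cond_prob P F A g -> {ae P, forall w, f w <= g w}.
Proof.
move=> mA [/sub_measurableP mf fi fA] [/sub_measurableP mg gi gA].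
pose C : set Om := [set w | (g w < f w)%R].
have FC : F C.
  have /sub_measurableP := measurable_fun_ltr mg mf.
  by move=> /(_ [set true] I); congr (F _).
have mC := Fm FC.
have fiC : P.-integrable C (EFin \o f) by exact: integrableS fi.
have giC : P.-integrable C (EFin \o g) by exact: integrableS gi.
have : (\int[P]_(w in C) `|(f w)%:E - (g w)%:E| = 0)%E.
  rewrite (eq_integral (fun w => ((f w)%:E - (g w)%:E)%E)) => [|w]; last first.
    by rewrite inE /C => gf; rewrite gee0_abs// -EFinB lee_fin subr_ge0 ltW.
  rewrite integralB_EFin// fA// gA// subee//.
  by apply: fin_num_measure; exact: measurableI.
move=> /ae_eq_integral_abs => /(_ mC) h.
have mfg : measurable_fun C (fun w => ((f w)%:E - (g w)%:E)%E).
  by apply: emeasurable_funB; [case/integrableP: fiC|case/integrableP: giC].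
apply: filterS (h mfg) => w; rewrite /C /= leNgt => Cw; apply/negP => gf.
by have := Cw gf; rewrite -EFinB => -[] /eqP; rewrite subr_eq0 => /eqP fg; move: gf; rewrite fg ltxx.
Qed.

Lemma cond_prob_unique A (f g : Om -> R) : measurable A ->
  cond_prob P F A f -> cond_prob P F A g -> {ae P, forall w, f w = g w}.
Proof.
move=> mA fA gA.
apply: filterS2 (cond_prob_ae_le mA fA gA) (cond_prob_ae_le mA gA fA) => w fg gf.
by apply/eqP; rewrite eq_le fg gf.
Qed.

(** Conditional probabilities arise here as extended-valued integrands that are finite almost
    surely; [fine] turns them into real versions. *)
Lemma cond_prob_ge0P A (g : Om -> \bar R) :
  measurable_fun [set: OF] (g : OF -> \bar R) -> measurable A -> (forall w, 0 <= g w)%E ->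
  {ae P, forall w, g w \is a fin_num} ->
  (forall C, F C -> (\int[P]_(w in C) g w = P (A `&` C))%E) ->
  cond_prob P F A (fun w => fine (g w)).
Proof.
move=> mg mA g0 gfin gA.
have mfg : measurable_fun [set: OF] ((fun w => fine (g w)) : OF -> R).
  exact: (measurableT_comp (fine_measurable measurableT) mg).
have mg' : measurable_fun [set: Om] g by exact: sub_measurable.
have mfg' : measurable_fun [set: Om] (fun w => fine (g w)) by exact: sub_measurable.
have FT : F setT by rewrite -setC0 -[~` _]setTD; case: Fs => F0 FC _; exact: FC.
split; first exact/sub_measurableP.
  apply: (@integrable_ae_eq g); first by apply: filterS gfin => w /= /fineK ->.
    apply/integrableP; split=> //.
    under eq_integral do rewrite gee0_abs//.
    rewrite gA// setIT; exact: le_lt_trans (probability_le1 _ _) (ltry _).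
  exact/measurable_EFinP.
move=> C FC; rewrite -gA//; apply: ae_eq_integral => //.
- exact: Fm.
- by apply/measurable_EFinP; exact: measurable_funTS.
- exact: measurable_funTS.
- by apply: filterS gfin => w /fineK.
Qed.

(** [cond_indep] quantifies over all versions; since versions agree almost surely, one family g of
    them is enough. *)
Lemma cond_indepP (d' : measure_display) (T : measurableType d')
    (X : nat -> {RV P >-> T}) (g : nat -> set T -> Om -> R) :
  (forall i B, measurable B -> cond_prob P F (X i @^-1` B) (g i B)) ->
  (forall (s : seq nat) (B : nat -> set T), uniq s -> (forall i, measurable (B i)) ->
    cond_prob P F (\bigcap_(i in [set` s]) (X i @^-1` B i)) (fun w => \prod_(i <- s) g i (B i) w)) ->
  cond_indep F X.
Proof.
move=> gX gXs s B f us mB fX; have [mg gi gs] := gXs s B us mB.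
have mXB i : measurable (X i @^-1` B i).
  by rewrite -[X in measurable X]setTI; exact: measurable_funP.
have mf : measurable_fun [set: OF] ((fun w => \prod_(i <- s) f i w) : OF -> R).
  by apply: measurable_prod => i _; apply/sub_measurableP; case: (fX i).
have mf' : measurable_fun [set: Om] (fun w => \prod_(i <- s) f i w) by exact: sub_measurable.
have mg' : measurable_fun [set: Om] (fun w => \prod_(i <- s) g i (B i) w).
  by apply: sub_measurable; apply/sub_measurableP.
have fg : {ae P, forall w, \prod_(i <- s) g i (B i) w = \prod_(i <- s) f i w}.
  elim: (s) => [|i t IH]; first by apply: aeW => w; rewrite !big_nil.
  apply: filterS2 IH (cond_prob_unique (mXB i) (gX i (B i) (mB i)) (fX i)) => w h1 h2.
  by rewrite !big_cons h1 h2.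
split; first exact/sub_measurableP.
  apply: integrable_ae_eq gi _; first by apply: filterS fg => w /= ->.
  exact/measurable_EFinP.
move=> C FC; rewrite -gs//; apply: ae_eq_integral => //.
- exact: Fm.
- by apply/measurable_EFinP; exact: measurable_funTS.
- by apply/measurable_EFinP; exact: measurable_funTS.
- by apply: filterS fg => w h _; congr EFin.
Qed.

End conditional_probability.

(** Infinite factors are allowed: [fine] sends both infinities to 0, and 0 times infinity is 0. *)
Lemma fine_mul (R : realType) (x y : \bar R) : fine (x * y)%E = fine x * fine y.
Proof.
case: x y => [x| |] [y| |] //=; rewrite ?mulr0 ?mul0r//.
- by rewrite mulry; case: (sgrP x) => _; rewrite ?mul1e ?mulN1e ?mul0e.
- by rewrite mulrNy; case: (sgrP x) => _; rewrite ?mul1e ?mulN1e ?mul0e.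
- by rewrite mulyr; case: (sgrP y) => _; rewrite ?mul1e ?mulN1e ?mul0e.
- by rewrite mulNyr; case: (sgrP y) => _; rewrite ?mul1e ?mulN1e ?mul0e.
Qed.

Lemma fine_prod (R : realType) (J : Type) (s : seq J) (a : J -> \bar R) :
  fine (\prod_(i <- s) a i)%E = \prod_(i <- s) fine (a i).
Proof. by elim: s => [|i s IH]; rewrite ?big_nil// !big_cons fine_mul IH. Qed.

Lemma mix_le1 (R : realType) (d : measure_display) (Om : measurableType d)
    (p : nat -> Om -> R) (E : nat -> set Om) w : (forall k, 0 <= p k w) ->
  (\sum_(0 <= k <oo) (p k w)%:E = 1)%E -> (mix p E w <= 1)%E.
Proof.
move=> p0 <-; apply: lee_nneseries => [k _ _|k _].
  by rewrite mule_ge0// lee_fin.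
by rewrite -EFinM lee_fin indicE; case: (_ \in _); rewrite ?mulr1// mulr0.
Qed.

Section sampling_conditional.
Context (R : realType) (d d' : measure_display) (Om : measurableType d).
Context (T : measurableType d') (P : probability Om R).
Variables (p : nat -> {RV P >-> R}) (Z : nat -> {RV P >-> T}) (I : nat -> {RV P >-> nat}).

Local Notation F := (joint_sigma p Z).

Let Fs : sigma_algebra setT F. Proof. exact: smallest_sigma_algebra. Qed.

Let mI i k : measurable (I i @^-1` [set k]).
Proof. by rewrite -[X in measurable X]setTI; exact: measurable_funP. Qed.

Lemma cond_sampling :
  (forall n k : nat, cond_prob P F (I n @^-1` [set k]) (p k)) -> cond_indep F I ->
  sampling P F (fun k => p k : Om -> R) (fun i => I i : Om -> nat).
Proof.
move=> pI iI C FC s k us.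
have [_ _ h] := iI s (fun i => [set k i]) (fun i => p (k i)) us (fun=> Logic.I)
  (fun i => pI i (k i)).
under eq_integral do rewrite prodEFin.
rewrite h// setIC; congr (P (_ `&` _)).
Qed.

Hypothesis p01 : random_weights p.
Hypothesis sI : sampling P F (fun k => p k : Om -> R) (fun i => I i : Om -> nat).

Let p0 k w : 0 <= p k w. Proof. by case: p01 => h _; have /andP[] := h k w. Qed.

Let mp k : measurable_fun [set: g_sigma_algebraType F] (p k : g_sigma_algebraType F -> R).
Proof.
apply/(sub_measurableP Fs) => B mB; apply: sub_sigma_algebra; left.
by apply: sub_sigma_algebra; exists k => //; exists B => //; rewrite setTI.
Qed.

Let mixI (B : set nat) (w : Om) : R :=
  fine (mix (fun k => p k : Om -> R) (fun k => if `[< B k >] then setT else set0) w).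

(** Each index is tested against events that are full or empty according to whether the value is
    allowed, so [mix] becomes the conditional probability of an index set. *)
Lemma sampling_cond_prob (s : seq nat) (B : nat -> set nat) : uniq s ->
  cond_prob P F (\bigcap_(i in [set` s]) (I i @^-1` B i)) (fun w => \prod_(i <- s) mixI (B i) w).
Proof.
move=> us.
pose E i k : set Om := if `[< B i k >] then setT else set0.
have FE i k : F (E i k).
  by rewrite /E; case: ifP => _; [exact: joint_sigmaT|exact: sigma_algebra0].
have -> : (fun w => \prod_(i <- s) mixI (B i) w) =
  (fun w => fine (\prod_(i <- s) mix (fun k => p k : Om -> R) (E i) w)%E).
  by apply/funext => w; rewrite fine_prod.
apply: cond_prob_ge0P => //.
- exact: joint_sigma_measurable.
- apply: emeasurable_prod => i; apply: measurable_mix => // k.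
  by apply: sub_sigma_algebra; exact: FE.
- by apply: bigcap_measurableType => i _; exact: measurable_preimage_nat.
- by move=> w; apply: prode_ge0 => i _; exact: mix_ge0.
- have [_ p1] := p01; apply: filterS p1 => w p1.
  rewrite ge0_fin_numE; last by apply: prode_ge0 => i _; exact: mix_ge0.
  apply: (@le_lt_trans _ _ 1%E); last exact: ltry.
  elim: (s) => [|i t IH]; first by rewrite big_nil.
  rewrite big_cons -[leRHS]mule1; apply: lee_pmul => //.
  - exact: mix_ge0.
  - by apply: prode_ge0 => j _; exact: mix_ge0.
  - by apply: mix_le1.
move=> C FC.
have := @sampling_mix _ _ _ P F (fun k => p k : Om -> R) (fun i => I i : Om -> nat) p0.
move=> /(_ _ mI (@joint_sigma_measurable _ _ _ _ _ _ p Z) (@joint_sigmaI _ _ _ _ _ _ p Z)).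
move=> /(_ _ s [::] C (fun=> 0%N) E sI FC); rewrite cats0 => /(_ _ us FE) h.
rewrite setIC (_ : _ `&` _ = C `&` [set w | (forall i, i \in [::] -> I i w = 0%N) /\
                 (forall i, i \in s -> E i (I i w) w)]); last first.
  congr (_ `&` _); apply/seteqP; split=> w /=.
    by move=> h'; split=> // i si; rewrite /E asboolT//; exact: h'.
  by move=> [_ h'] i /= /h'; rewrite /E; case: asboolP.
rewrite h; last by move=> k.
by under [RHS]eq_integral do rewrite big_nil mul1e.
Qed.

Lemma sampling_cond :
  (forall n k : nat, cond_prob P F (I n @^-1` [set k]) (p k)) /\ cond_indep F I.
Proof.
have Fm : F `<=` measurable by exact: joint_sigma_measurable.
have one n B : cond_prob P F (I n @^-1` B) (mixI B).
  have := @sampling_cond_prob [:: n] (fun=> B) isT.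
  rewrite set_cons1 bigcap_set1.
  by rewrite (_ : (fun w => _) = mixI B)//; apply/funext => w; rewrite big_seq1.
split=> [n k|].
  suff -> : p k = mixI [set k] :> (Om -> R) by exact: one.
  apply/funext => w; rewrite /mixI.
  have := mix_eq (p := fun k => p k : Om -> R) p0 k w => h.
  rewrite (_ : (fun j => _) = fun j => if j == k then setT else set0) ?h//.
  by apply/funext => j; congr (if _ then _ else _); apply/asboolP/eqP.
apply: (cond_indepP Fs Fm (g := fun _ B => mixI B)).
- by move=> i B _; exact: one.
- by move=> s B us _; exact: sampling_cond_prob.
Qed.

End sampling_conditional.

Lemma ae_eq_prob (R : realType) (d : measure_display) (Om : measurableType d)
    (P : probability Om R) (A B : set Om) : measurable A -> measurable B ->
  {ae P, forall w, A w <-> B w} -> P A = P B.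
Proof.
move=> mA mB AB; rewrite -(setIT A) -(setIT B) -!integral_indic//.
apply: ae_eq_integral => //; try by apply/measurable_EFinP.
apply: filterS AB => w AB _; rewrite !indicE; congr ((nat_of_bool _)%:R%:E).
by apply/idP/idP; rewrite !inE => /AB.
Qed.

Lemma measurable_index_value (R : realType) (d d' : measure_display) (Om : measurableType d)
    (T : measurableType d') (P : probability Om R) (Z : nat -> {RV P >-> T})
    (I : nat -> {RV P >-> nat}) n :
  measurable_fun setT (fun w => Z (I n w) w).
Proof.
apply: (@measurable_select _ _ _ _ (fun k => Z k : Om -> T) (I n)) => // k.
by rewrite -[X in measurable X]setTI; exact: measurable_funP.
Qed.

Section species_law.
Context (R : realType) (X : ptopologicalType) (q : seq nat -> R).
Context (H : probability (borel X) R).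

Lemma weights_partition_same_law (d1 d2 : measure_display)
    (Om1 : measurableType d1) (P1 : probability Om1 R)
    (p1 : nat -> {RV P1 >-> R}) (Z1 : nat -> {RV P1 >-> borel X}) (I1 : nat -> {RV P1 >-> nat})
    (Om2 : measurableType d2) (P2 : probability Om2 R)
    (Pi2 : forall n : nat, Om2 -> {set {set 'I_n}}) (Z2 : nat -> {RV P2 >-> borel X}) :
  species_data q H p1 Z1 ->
  sampling P1 (joint_sigma p1 Z1) (fun k => p1 k : Om1 -> R) (fun i => I1 i : Om1 -> nat) ->
  exchangeable_with_eppf P2 Pi2 q -> iid Z2 H ->
  indep_systems P2 (partition_sigma Pi2) (seq_sigma Z2) ->
  same_law P1 P2 (fun w => (fun n => Z1 (I1 n w) w) : seqspace (borel X))
                 (fun w => (fun n => Z2 (class_index Pi2 n w) w) : seqspace (borel X)).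
Proof.
move=> s1 sI1 q2 Z2H PZ2 B mB.
have [Pi [Z' [qPi Z'H PiZ' ZE]]] := weights_partition s1 sI1.
rewrite -(partition_same_law qPi Z'H PiZ' q2 Z2H PZ2 mB).
have mZI : measurable ((fun w => (fun n => Z1 (I1 n w) w) : seqspace (borel X)) @^-1` B).
  rewrite -[X in measurable X]setTI; apply: measurable_seq => // n.
  exact: (measurable_index_value Z1 I1).
rewrite -[LHS](@prod_fst _ _ _ _ _ P1 P1 _ mZI).
congr ((P1 \x P1)%E _); apply/seteqP; split=> w /=;
  by rewrite (_ : (fun n => Z1 (I1 n w.1) w.1) = (fun n => Z' (class_index Pi n w) w))//;
    apply/funext => n; exact: ZE.
Qed.

(** Both sequences have the law of the partition form of the first model, since that law depends on
    [q] and [H] only. *)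
Lemma species_same_law (d1 : measure_display)
    (Om1 : measurableType d1) (P1 : probability Om1 R)
    (p1 : nat -> {RV P1 >-> R}) (Z1 : nat -> {RV P1 >-> borel X}) (I1 : nat -> {RV P1 >-> nat}) :
  species_data q H p1 Z1 ->
  sampling P1 (joint_sigma p1 Z1) (fun k => p1 k : Om1 -> R) (fun i => I1 i : Om1 -> nat) ->
  forall (d2 : measure_display) (Om2 : measurableType d2) (P2 : probability Om2 R)
    (p2 : nat -> {RV P2 >-> R}) (Z2 : nat -> {RV P2 >-> borel X}) (I2 : nat -> {RV P2 >-> nat}),
  species_data q H p2 Z2 ->
  sampling P2 (joint_sigma p2 Z2) (fun k => p2 k : Om2 -> R) (fun i => I2 i : Om2 -> nat) ->
  same_law P1 P2 (fun w => (fun n => Z1 (I1 n w) w) : seqspace (borel X))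
                 (fun w => (fun n => Z2 (I2 n w) w) : seqspace (borel X)).
Proof.
move=> s1 sI1 d2 Om2 P2 p2 Z2 I2 s2 sI2 B mB.
have [Pi [Z' [qPi Z'H PiZ' ZE]]] := weights_partition s1 sI1.
have E1 := weights_partition_same_law s1 sI1 qPi Z'H PiZ' mB.
have E2 := weights_partition_same_law s2 sI2 qPi Z'H PiZ' mB.
by rewrite E1 -E2.
Qed.

End species_law.

Section weights_to_partition_representation.
Context (R : realType) (X : ptopologicalType) (q : seq nat -> R).
Context (H : probability (borel X) R).
Context (d : measure_display) (Om : measurableType d) (P : probability Om R).
Variable xi : nat -> {RV P >-> borel X}.

Lemma weights_partition_representation :
  weights_representation q H xi -> partition_representation q H xi.
Proof.
move=> [d' [Om' [P' [phi [p [Z [I [mphi pZ pI iI xiE]]]]]]]].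
have sI : sampling P' (joint_sigma p Z) (fun k => p k : Om' -> R) (fun i => I i : Om' -> nat).
  exact: cond_sampling.
have [Pi [Z' [qPi Z'H PiZ' ZE]]] := weights_partition pZ sI.
exists _, (Om' * Om')%type, (P' \x P')%E.
have mphi1 : measurable_fun setT (phi \o fst : Om' * Om' -> Om).
  by apply: measurableT_comp measurable_fst; exact: measurable_funP.
exists (mfun_Sub (mem_set mphi1)), Pi, Z'; split=> //.
- move=> A mA; rewrite -(mphi _ mA); apply: (@prod_fst _ _ _ _ _ P' P' (phi @^-1` A)).
  by rewrite -[X in measurable X]setTI; exact: measurable_funP.
- move=> n; have [N [mN N0 xiN]] := xiE n; exists (fst @^-1` N); split.
  + by rewrite -[X in measurable X]setTI; exact: measurable_fst.
  + by apply: etrans N0; exact: prod_fst.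
  + by move=> w /= h; apply: xiN => /=; contradict h; rewrite h ZE.
Qed.

Lemma partition_representation_law (d2 : measure_display) (Om2 : measurableType d2)
    (P2 : probability Om2 R) (p : nat -> {RV P2 >-> R}) (Z : nat -> {RV P2 >-> borel X})
    (I : nat -> {RV P2 >-> nat}) :
  species_data q H p Z ->
  sampling P2 (joint_sigma p Z) (fun k => p k : Om2 -> R) (fun i => I i : Om2 -> nat) ->
  partition_representation q H xi ->
  same_law P P2 (fun w => (fun n => xi n w) : seqspace (borel X))
                (fun w => (fun n => Z (I n w) w) : seqspace (borel X)).
Proof.
move=> pZ sI [d' [Om' [P' [phi [Pi [Z' [mphi qPi Z'H PiZ' xiE]]]]]]] B mB.
rewrite (weights_partition_same_law pZ sI qPi Z'H PiZ' mB).
have mxi : measurable ((fun w => (fun n => xi n w) : seqspace (borel X)) @^-1` B).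
  by rewrite -[X in measurable X]setTI; apply: measurable_seq.
rewrite -(mphi _ mxi).
have xiE' : {ae P', forall w, forall n, xi n (phi w) = Z' (class_index Pi n w) w}.
  exact/ae_foralln.
have mphixi : measurable (phi @^-1` ((fun w => (fun n => xi n w) : seqspace (borel X)) @^-1` B)).
  by rewrite -[X in measurable X]setTI; exact: measurable_funP.
have mZ : measurable ((fun w => (fun n => Z' (class_index Pi n w) w) : seqspace (borel X)) @^-1` B).
  rewrite -[X in measurable X]setTI; apply: measurable_seq => // n.
  exact: measurable_class_value qPi _.
have -> : P' ((fun w => (fun n => Z' (class_index Pi n w) w) : seqspace (borel X)) @^-1` B) =
  P' (phi @^-1` ((fun w => (fun n => xi n w) : seqspace (borel X)) @^-1` B)).
  by apply: ae_eq_prob => //; apply: filterS xiE' => w h /=;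
    rewrite (_ : (fun n => xi n (phi w)) = (fun n => Z' (class_index Pi n w) w))//; apply/funext.
by [].
Qed.

End weights_to_partition_representation.

(** Unlike [weights_eppf], this involves a single sequence of variables and depends only on its
    law. *)
Definition sorted_weights_eppf (R : realType) (d : measure_display) (Om : measurableType d)
    (P : probability Om R) (p : nat -> {RV P >-> R}) (q : seq nat -> R) : Prop :=
  {ae P, forall w, forall i j, (i <= j)%N -> p j w <= p i w} /\ kingman q (seq_law p).

Lemma sorted_weights_eppfW (R : realType) (d : measure_display) (Om : measurableType d)
    (P : probability Om R) (p : nat -> {RV P >-> R}) (q : seq nat -> R) :
  (forall k w, 0 <= p k w) -> sorted_weights_eppf p q -> weights_eppf p q.
Proof.
move=> p0 [ps pq]; exists p; split=> //; apply: filterS ps => w ps; split=> //.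
by exists id => //; split=> [j //|i j _ _ //|j pj]; exists j.
Qed.

(** * An explicit model *)

Section pullback.
Context (R : realType) (d d' : measure_display).
Context (Om : measurableType d) (Om' : measurableType d').
Variables (P : probability Om R) (P' : probability Om' R) (phi : {mfun Om' >-> Om}).
Hypothesis mphi : measure_preserving P P' phi.

Lemma ae_pullback (Q : Om -> Prop) : {ae P, forall w, Q w} -> {ae P', forall w, Q (phi w)}.
Proof.
move=> [N [mN N0 QN]]; exists (phi @^-1` N); split.
- by rewrite -[X in measurable X]setTI; exact: measurable_funP.
- by apply: etrans N0; exact: mphi.
- by move=> w /= h; exact: QN.
Qed.

Lemma measurable_pullback (d1 : measure_display) (T : measurableType d1) (f : {RV P >-> T}) :
  measurable_fun setT (f \o phi).
Proof. exact: measurableT_comp. Qed.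

Definition pullback (d1 : measure_display) (T : measurableType d1) (f : {RV P >-> T}) :
  {RV P' >-> T} := mkRV P' (measurable_pullback f).

Lemma seq_sigma_pullback (d1 : measure_display) (T : measurableType d1) (X : nat -> {RV P >-> T}) :
  seq_sigma (fun n => pullback (X n)) `<=` preimage_set_system setT phi (seq_sigma X).
Proof.
rewrite !seq_sigmaE => _ [B mB <-].
exists ((fun w => (fun n => X n w) : seqspace T) @^-1` B); last by rewrite !setTI.
by exists B => //; rewrite setTI.
Qed.

Lemma joint_sigma_pullback (d1 : measure_display) (T1 : measurableType d1)
    (p : nat -> {RV P >-> R}) (Z : nat -> {RV P >-> T1}) :
  joint_sigma (fun n => pullback (p n)) (fun n => pullback (Z n)) `<=`
  preimage_set_system setT phi (joint_sigma p Z).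
Proof.
apply: smallest_sub.
  by apply: sigma_algebra_preimage; exact: smallest_sigma_algebra.
move=> A [|] /seq_sigma_pullback [B BX <-]; exists B => //; apply: sub_sigma_algebra.
  by left.
by right.
Qed.

Lemma iid_pullback (d1 : measure_display) (T : measurableType d1) (H : probability T R)
  (Z : nat -> {RV P >-> T}) : iid Z H -> iid (fun n => pullback (Z n)) H.
Proof.
move=> ZH; apply: iidP => n B mB; rewrite -(iid_rect n ZH mB) -mphi//.
have : seq_sigma Z [set w | forall i, (i < n)%N -> B i (Z i w)].
  rewrite seq_sigmaE; exists (rect n B); last by rewrite setTI.
  exact: measurable_rect.
exact: seq_sigma_measurable.
Qed.

Lemma random_weights_pullback (p : nat -> {RV P >-> R}) :
  random_weights p -> random_weights (fun n => pullback (p n)).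
Proof. by move=> [p01 p1]; split=> [j w|]; [exact: p01|exact: (ae_pullback p1)]. Qed.

Lemma kingman_pullback (p : nat -> {RV P >-> R}) (q : seq nat -> R) :
  kingman q (seq_law p) -> kingman q (seq_law (fun n => pullback (p n))).
Proof.
move=> [d1 [Om1 [P1 [Pi [v [qPi vPi sv]]]]]].
exists d1, Om1, P1, Pi, v; split=> // B mB; rewrite sv// /seq_law -mphi//.
have : seq_sigma p [set w | B (fun n => p n w)].
  by rewrite seq_sigmaE; exists B => //; rewrite setTI.
exact: seq_sigma_measurable.
Qed.

Lemma weights_eppf_pullback (p : nat -> {RV P >-> R}) (q : seq nat -> R) :
  weights_eppf p q -> weights_eppf (fun n => pullback (p n)) q.
Proof.
move=> [s [ps qs]]; exists (fun n => pullback (s n)).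
by split; [exact: (ae_pullback ps)|exact: kingman_pullback].
Qed.

Lemma sorted_weights_eppf_pullback (p : nat -> {RV P >-> R}) (q : seq nat -> R) :
  sorted_weights_eppf p q -> sorted_weights_eppf (fun n => pullback (p n)) q.
Proof. by move=> [ps pq]; split; [exact: (ae_pullback ps)|exact: kingman_pullback]. Qed.

Lemma species_data_pullback (X : ptopologicalType) (q : seq nat -> R)
    (H : probability (borel X) R) (p : nat -> {RV P >-> R}) (Z : nat -> {RV P >-> borel X}) :
  species_data q H p Z ->
  species_data q H (fun n => pullback (p n)) (fun n => pullback (Z n)).
Proof.
move=> [ZH p01 pZ pq]; split.
- exact: iid_pullback.
- exact: random_weights_pullback.
- move=> _ _ /seq_sigma_pullback [A pA <-] /seq_sigma_pullback [B ZB <-].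
  have mA := seq_sigma_measurable pA; have mB := seq_sigma_measurable ZB.
  rewrite !setTI -preimage_setI; apply: etrans (mphi _) _; first exact: measurableI.
  by rewrite pZ// !mphi.
- exact: weights_eppf_pullback.
Qed.

End pullback.

Section model.
Context (R : realType) (X : ptopologicalType) (q : seq nat -> R).
Context (H : probability (borel X) R).
Context (d : measure_display) (Om : measurableType d) (P : probability Om R).
Variables (p : nat -> {RV P >-> R}) (Z : nat -> {RV P >-> borel X}).
Hypothesis pZ : species_data q H p Z.

Local Notation U := (uniform_prob (@ltr01 R)).
Local Notation P1 := (P \x U)%E.

Let p0 k w : 0 <= p k w.
Proof. by have [_ [h _] _ _] := pZ; have /andP[] := h k w. Qed.

(** The sampler needs total mass 1 at every point; on the null event where it fails, all mass is put
    on index 0. *)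
Definition proper_weight (k : nat) (w : Om) : R :=
  if (\sum_(0 <= j <oo) (p j w)%:E == 1)%E then p k w else (k == 0%N)%:R.

Lemma measurable_proper_weight k : measurable_fun setT (proper_weight k).
Proof.
apply: measurable_fun_ifT => //.
apply: measurable_fun_eqe => //; apply: ge0_emeasurable_sum => // j.
  by move=> w _ _; rewrite lee_fin.
by move=> _; apply/measurable_EFinP.
Qed.

Lemma proper_weight_ge0 k w : 0 <= proper_weight k w.
Proof. by rewrite /proper_weight; case: ifP. Qed.

Lemma proper_weight_sum w : (\sum_(0 <= k <oo) (proper_weight k w)%:E = 1)%E.
Proof.
rewrite /proper_weight; case: eqP => [//|_].
rewrite (nneseriesD1 (n := 0%N))//.
by rewrite eseries0 ?adde0// => k _ /negbTE ->.
Qed.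

Let m (t : seq nat) (w : Om) : R := \prod_(k <- t) proper_weight k w.

Let mm t : measurable_fun setT (m t).
Proof. by apply: measurable_prod => k _; exact: measurable_proper_weight. Qed.

Let m_ge0 t w : 0 <= m t w.
Proof. by apply: prodr_ge0 => k _; exact: proper_weight_ge0. Qed.

Let m_nil w : m [::] w = 1. Proof. by rewrite /m big_nil. Qed.

Let m_sum t w : (\sum_(0 <= k <oo) (m (rcons t k) w)%:E = (m t w)%:E)%E.
Proof.
rewrite (eq_eseriesr (g := fun k => ((m t w)%:E * (proper_weight k w)%:E)%E)) => [|k _].
  rewrite nneseriesZl; last by move=> k _; rewrite lee_fin proper_weight_ge0.
  by rewrite proper_weight_sum mule1.
by rewrite /m -cats1 big_cat big_seq1 EFinM.
Qed.

Lemma measurable_draw_fun i : measurable_fun setT (draw m i).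
Proof.
by move=> _ B _; rewrite setTI; apply: (measurable_preimage_nat B) => k; exact: measurable_draw.
Qed.

Definition model_proj : {mfun (Om * measurableTypeR R)%type >-> Om} :=
  mfun_Sub (mem_set measurable_fst).

Definition model_index i : {RV P1 >-> nat} := mkRV P1 (measurable_draw_fun i).

Lemma model_preserving : measure_preserving P P1 model_proj.
Proof. by move=> A mA; exact: prod_fst. Qed.

Definition model_weight n : {RV P1 >-> R} := pullback P1 model_proj (p n).
Definition model_type n : {RV P1 >-> borel X} := pullback P1 model_proj (Z n).

Lemma model_species : species_data q H model_weight model_type.
Proof. exact: (species_data_pullback model_preserving). Qed.

(** The measure [Q] is arbitrary, not just [P]: with a Dirac mass at w, the draws become genuinely
    i.i.d. from the weights at w, which is how the law of large numbers is applied. *)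
Lemma draw_sampling (Q : probability Om R) :
  sampling (Q \x U)%E (preimage_set_system setT (fst : Om * measurableTypeR R -> Om) measurable)
    (fun k z => proper_weight k z.1) (draw m).
Proof.
have Fs : sigma_algebra setT
    (preimage_set_system setT (fst : Om * measurableTypeR R -> Om) measurable).
  by apply: sigma_algebra_preimage; exact: sigma_algebra_measurable.
have mw k : measurable_fun setT (fun z : Om * measurableTypeR R => proper_weight k z.1).
  by apply: measurableT_comp measurable_fst; exact: measurable_proper_weight.
apply: sampling_init => //.
- by move=> k z; exact: proper_weight_ge0.
- by move=> i k; exact: measurable_draw.
- by move=> _ [D mD <-]; exact: measurable_fst.
- exact: sigma_algebra_setI.
- by case: Fs.
- by exists setT => //; rewrite preimage_setT setTI.
- by apply: aeW => z; exact: proper_weight_sum.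
move=> _ n k [D mD <-]; rewrite setTI.
have DT : (fst : Om * measurableTypeR R -> Om) @^-1` D = D `*` setT.
  by apply/seteqP; split=> w /=; [split|case].
have := draw_law mm m_ge0 m_nil m_sum Q (mkseq k n) mD.
rewrite size_mkseq -DT => h.
have mf : measurable_fun [set: Om] (fun w => \prod_(i < n) (proper_weight (k i) w)%:E)%E.
  by apply: emeasurable_prod => i; apply/measurable_EFinP; exact: measurable_proper_weight.
have fl : same_law (Q \x U)%E Q (fst : Om * measurableTypeR R -> Om) idfun.
  by move=> A mA; exact: prod_fst.
have h2 := same_law_integral measurable_fst (@measurable_id _ _ setT) fl mD mf.
apply: etrans (etrans _ h) (etrans _ (esym (h2 _))).
- by congr ((Q \x U)%E (_ `&` _)); apply/seteqP; split=> w /= wk i ilt;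
    have := wk i ilt; rewrite nth_mkseq.
- apply: eq_integral => w _.
  rewrite /m /mkseq big_map -prodEFin -[in RHS](big_mkord xpredT (fun i => (proper_weight (k i) w)%:E)).
  by rewrite /index_iota subn0.
- by move=> w; apply: prode_ge0 => i _; rewrite lee_fin proper_weight_ge0.
Qed.

Lemma model_weightE :
  {ae P1, forall z, forall k, proper_weight k z.1 = model_weight k z}.
Proof.
have [_ [_ p1] _ _] := pZ.
by apply: filterS (ae_pullback model_preserving p1) => z p1z k; rewrite /proper_weight p1z eqxx.
Qed.

Lemma model_sampling : sampling P1 (joint_sigma model_weight model_type)
  (fun k => model_weight k : _ -> R) (fun i => model_index i : _ -> nat).
Proof.
move=> C kC s k us.
have [D pD CD] := joint_sigma_pullback kC.
have mD := joint_sigma_measurable pD.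
have h := @draw_sampling P C _ s k us; apply: etrans (h _) _; first by exists D.
have mC := joint_sigma_measurable kC.
apply: ae_eq_integral => //.
- apply: measurable_funTS; apply: emeasurable_prod => i; apply/measurable_EFinP.
  by apply: measurableT_comp measurable_fst; exact: measurable_proper_weight.
- by apply: measurable_funTS; apply: emeasurable_prod => i; exact/measurable_EFinP.
- by apply: filterS model_weightE => z zE _; apply: eq_bigr => i _; rewrite zE.
Qed.

End model.

Section base_model.
Context (R : realType) (X : ptopologicalType) (q : seq nat -> R).
Context (H : probability (borel X) R).

Lemma ranked_block_size_nonincreasing n (pi : {set {set 'I_n}}) i j :
  (i <= j)%N -> (ranked_block_size pi j <= ranked_block_size pi i)%N.
Proof.
move=> ij; rewrite /ranked_block_size; set s := sort _ _.
have ss : sorted geq s by apply: sort_sorted => x y; exact: leq_total.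
have [js|js] := ltnP j (size s); last by rewrite nth_default.
apply: (sorted_leq_nth _ _ 0%N ss) => //.
- by move=> x y z /= h1 h2; exact: leq_trans h2 h1.
- exact: leqnn.
- exact: leq_ltn_trans ij js.
Qed.

(** [random_weights] asks for values in [0, 1] at every point, whereas limiting frequencies are
    known to satisfy this only almost surely. *)
Definition clamp (x : R) : R := Num.max 0 (Num.min 1 x).

Lemma measurable_clamp : measurable_fun setT clamp.
Proof. by apply: measurable_maxr => //; exact: measurable_minr. Qed.

Lemma clamp01 x : 0 <= clamp x <= 1.
Proof. by rewrite /clamp le_max lexx ge_max ler01 ge_min lexx. Qed.

Lemma clamp_id x : 0 <= x <= 1 -> clamp x = x.
Proof. by move=> /andP[x0 x1]; rewrite /clamp min_r// max_r. Qed.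

Lemma proper_weights_exist : proper_eppf q ->
  exists (d : measure_display) (Om : measurableType d) (P : probability Om R)
    (p : nat -> {RV P >-> R}), random_weights p /\ sorted_weights_eppf p q.
Proof.
move=> [L [d [Om [P [Pi [w [qPi wPi wL]]]]]] L1].
have mp j : measurable_fun setT (fun x => clamp (w j x)).
  by apply: measurableT_comp => //; exact: measurable_clamp.
pose p j : {RV P >-> R} := mkRV P (mp j).
(* The sum is 1 almost surely under [L], which is the law of w; the null set is pulled back. *)
have w1 : {ae P, forall x, (\sum_(0 <= j <oo) (w j x)%:E = 1)%E}.
  have [N [mN N0 NL]] := L1.
  exists ((fun x => (fun j => w j x) : seqspace R) @^-1` N); split.
  - by rewrite -[X in measurable X]setTI; apply: measurable_seq.
  - by rewrite -[LHS]/(seq_law w N) wL.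
  - by move=> x /= h; apply: NL.
have w0 : {ae P, forall x, (forall j, 0 <= w j x) /\ forall i j, (i <= j)%N -> w j x <= w i x}.
  apply: filterS wPi => x h; split=> [j|i j ij].
    apply: (@ler_cvg_to _ \oo _ _ (fun=> 0 : R) _ _ _ (cvg_cst _) (h j)).
    by apply: nearW => n; exact: divr_ge0.
  apply: (@ler_cvg_to _ \oo _ _ _ _ _ _ (h j) (h i)).
  apply: nearW => n; rewrite ler_wpM2r ?invr_ge0// ler_nat.
  exact: ranked_block_size_nonincreasing.
have pw : {ae P, forall x, forall j, p j x = w j x}.
  apply: filterS2 w0 w1 => x [w0 _] w1 j; apply: clamp_id; rewrite w0/=.
  rewrite -lee_fin -w1; apply: le_trans (nneseries_lim_ge j.+1 _) => //.
    by rewrite big_nat_recr//= leeDr// sume_ge0// => i _; rewrite lee_fin.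
  by move=> i _ _; rewrite lee_fin.
exists d, Om, P, p; split.
  split=> [j x|]; first exact: clamp01.
  by apply: filterS2 w1 pw => x w1 pw; rewrite -w1; apply: eq_eseriesr => j _; rewrite pw.
split.
  by apply: filterS2 w0 pw => x [_ w0] pw i j ij; rewrite !pw w0.
exists d, Om, P, Pi, w; split=> // B mB; apply: ae_eq_prob.
- by rewrite -[X in measurable X]setTI; apply: (@measurable_seq _ R _ _ (fun j x => w j x)).
- by rewrite -[X in measurable X]setTI; apply: (@measurable_seq _ R _ _ (fun j x => p j x)).
- by apply: filterS pw => x pw /=; rewrite (_ : (fun j => w j x) = (fun j => p j x))//; apply/funext.
Qed.

(** The weights come from properness of [q]. The i.i.d. types are borrowed from a given
    representation, and a product space makes the two independent. *)
Lemma species_exist (d : measure_display) (Om : measurableType d) (P : probability Om R)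
    (Z : nat -> {RV P >-> borel X}) : proper_eppf q -> iid Z H ->
  exists (d' : measure_display) (Om' : measurableType d') (P' : probability Om' R)
    (p' : nat -> {RV P' >-> R}) (Z' : nat -> {RV P' >-> borel X}),
    species_data q H p' Z' /\ sorted_weights_eppf p' q.
Proof.
move=> /proper_weights_exist[d1 [Om1 [P1 [p [p01 pq]]]]] ZH.
pose f1 : {mfun (Om1 * Om)%type >-> Om1} := mfun_Sub (mem_set measurable_fst).
pose f2 : {mfun (Om1 * Om)%type >-> Om} := mfun_Sub (mem_set measurable_snd).
have mf1 : measure_preserving P1 (P1 \x P)%E f1 by move=> A mA; exact: prod_fst.
have mf2 : measure_preserving P (P1 \x P)%E f2 by move=> A mA; exact: prod_snd.
exists _, (Om1 * Om)%type, (P1 \x P)%E, (fun n => pullback (P1 \x P)%E f1 (p n)),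
  (fun n => pullback (P1 \x P)%E f2 (Z n)).
have pq' := sorted_weights_eppf_pullback mf1 pq.
have [p01' _] := p01.
split=> //; split.
- exact: (iid_pullback mf2 ZH).
- exact: (random_weights_pullback mf1 p01).
- move=> _ _ /seq_sigma_pullback [A pA <-] /seq_sigma_pullback [B ZB <-].
  have mA := seq_sigma_measurable pA; have mB := seq_sigma_measurable ZB.
  rewrite !setTI; apply: etrans (prod_setX P1 P mA mB) _.
  by congr (_ * _)%E; apply/esym; [exact: mf1|exact: mf2].
- apply: sorted_weights_eppfW => // k w; have /andP[] := p01' k w.1; exact.
Qed.

End base_model.

Lemma measurable_eval (R : realType) (d : measure_display) (T : measurableType d) (B : set T) :
  measurable B ->
  measurable_fun [set: pprobability T R] (fun mu => (mu : probability T R) B).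
Proof.
move=> mB.
exact: (measurable_kernel (kprobability (@measurable_id _ (pprobability T R) setT)) B mB).
Qed.

Section sampled_values.
Context (R : realType) (d d' : measure_display) (Om : measurableType d).
Context (T : measurableType d') (P : probability Om R).
Variables (p : nat -> {RV P >-> R}) (Z : nat -> {RV P >-> T}) (I : nat -> {RV P >-> nat}).
Hypothesis p0 : forall k w, 0 <= p k w.
Hypothesis sI : sampling P (joint_sigma p Z) (fun k => p k : Om -> R) (fun i => I i : Om -> nat).

(** Given weights and types, the sampled values are i.i.d. from the discrete measure carried by
    them. *)
Lemma sampling_values (C : set Om) (s : seq nat) (B : nat -> set T) :
  joint_sigma p Z C -> uniq s -> (forall i, measurable (B i)) ->
  P (C `&` [set w | forall i, i \in s -> B i (Z (I i w) w)]) =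
  (\int[P]_(w in C) \prod_(i <- s) mix (fun k => p k : Om -> R) (fun k => Z k @^-1` B i) w)%E.
Proof.
move=> FC us mB.
have mI i k : measurable (I i @^-1` [set k]).
  by rewrite -[X in measurable X]setTI; exact: measurable_funP.
pose E i k : set Om := Z k @^-1` B i.
have FE i k : joint_sigma p Z (E i k).
  apply: sub_sigma_algebra; right; apply: sub_sigma_algebra.
  by exists k => //; exists (B i) => //; rewrite setTI.
have := @sampling_mix _ _ _ P _ (fun k => p k : Om -> R) (fun i => I i : Om -> nat) p0.
move=> /(_ (joint_sigma p Z) _ mI (@joint_sigma_measurable _ _ _ _ _ _ p Z) (@joint_sigmaI _ _ _ _ _ _ p Z)).
move=> /(_ _ s [::] C (fun=> 0%N) E sI FC); rewrite cats0 => /(_ _ us FE) h.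
rewrite (_ : _ `&` _ = C `&` [set w | (forall i, i \in [::] -> I i w = 0%N) /\
                 (forall i, i \in s -> E i (I i w) w)]); last first.
  congr (_ `&` _); apply/seteqP; split=> w /=; first by move=> h'; split.
  by move=> [_ h'] i si; exact: h'.
rewrite h; last by move=> k.
by under eq_integral do rewrite big_nil mul1e.
Qed.

End sampled_values.

Section gSSS_law.
Context (R : realType) (X : ptopologicalType) (q : seq nat -> R).
Context (H : probability (borel X) R).
Context (d : measure_display) (Om : measurableType d) (P : probability Om R).
Variable xi : nat -> {RV P >-> borel X}.

Lemma directing_law (mu : {RV P >-> pprobability (borel X) R}) :
  let F := preimage_set_system setT mu measurable in
  (forall (n : nat) (A : set (borel X)), measurable A ->
     cond_prob P F (xi n @^-1` A) (fun w => fine ((mu w : probability (borel X) R) A))) ->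
  cond_indep F xi ->
  forall n (B : nat -> set (borel X)), (forall i, measurable (B i)) ->
  P [set w | forall i, (i < n)%N -> B i (xi i w)] =
  (\int[P]_w \prod_(i < n) (mu w : probability (borel X) R) (B i))%E.
Proof.
move=> F muxi Fxi n B mB.
have [_ _] := Fxi (iota 0 n) B _ (iota_uniq _ _) mB (fun i => muxi i (B i) (mB i)).
have FT : F setT by exists setT => //; rewrite preimage_setT setIT.
move=> /(_ _ FT); rewrite setIT => h.
rewrite (_ : [set w | _] = \bigcap_(i in [set` iota 0 n]) (xi i @^-1` B i)); last first.
  apply/seteqP; split => w /= hw i.
    by rewrite /= mem_iota add0n => /hw.
  by move=> ilt; apply: hw => /=; rewrite mem_iota.
rewrite -h; apply: eq_integral => w _.
rewrite -prodEFin -(val_enum_ord n) big_map big_enum.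
by apply: eq_bigr => i _; rewrite fineK// fin_num_measure.
Qed.

(** The finite-dimensional laws of either sequence are expectations of products of masses under its
    directing measure, hence determined by the law of that measure. *)
Lemma directing_same_law (mu : {RV P >-> pprobability (borel X) R})
    (d2 : measure_display) (Om2 : measurableType d2) (P2 : probability Om2 R)
    (p : nat -> {RV P2 >-> R}) (Z : nat -> {RV P2 >-> borel X}) (I : nat -> {RV P2 >-> nat})
    (mu2 : {RV P2 >-> pprobability (borel X) R}) :
  let F := preimage_set_system setT mu measurable in
  (forall (n : nat) (A : set (borel X)), measurable A ->
     cond_prob P F (xi n @^-1` A) (fun w => fine ((mu w : probability (borel X) R) A))) ->
  cond_indep F xi ->
  (forall k w, 0 <= p k w) ->
  sampling P2 (joint_sigma p Z) (fun k => p k : Om2 -> R) (fun i => I i : Om2 -> nat) ->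
  {ae P2, forall w, forall A, measurable A ->
    (mu2 w : probability (borel X) R) A = mix (fun k => p k : _ -> R) (fun k => Z k @^-1` A) w} ->
  same_law P P2 mu mu2 ->
  same_law P P2 (fun w => (fun n => xi n w) : seqspace (borel X))
                (fun w => (fun n => Z (I n w) w) : seqspace (borel X)).
Proof.
move=> F muxi Fxi pge0 sI mu2E mm; apply: seq_same_law => //.
  by move=> n; exact: (measurable_index_value Z I).
move=> n B mB; rewrite (directing_law muxi Fxi n mB).
have FT : joint_sigma p Z setT by exact: joint_sigmaT.
have := sampling_values pge0 sI FT (iota_uniq 0 n) mB.
rewrite setTI => h.
rewrite [RHS](_ : _ = P2 [set w | forall i, i \in iota 0 n -> B i (Z (I i w) w)]); last first.
  congr (P2 _); apply/seteqP; split => w /= hw i.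
    by rewrite mem_iota add0n => /hw.
  by move=> ilt; apply: hw => /=; rewrite mem_iota.
apply: etrans (esym h).
pose f (m : pprobability (borel X) R) := (\prod_(i < n) (m : probability (borel X) R) (B i))%E.
have mf : measurable_fun [set: pprobability (borel X) R] f.
  apply: (@emeasurable_prod _ _ _ _ _ _ (fun (i : 'I_n) (m : pprobability (borel X) R) => (m : probability (borel X) R) (B i))) => i.
  exact: measurable_eval.
have f0 m : (0 <= f m)%E by apply: prode_ge0.
have h2 := same_law_integral (measurable_funP mu) (measurable_funP mu2) mm measurableT mf f0.
rewrite !preimage_setT in h2; apply: etrans h2 _.
apply: ae_eq_integral => //.
- exact: (measurableT_comp mf).
- apply: emeasurable_prod => i; apply: measurable_mix => // k.
  by rewrite -[X in measurable X]setTI; exact: measurable_funP.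
- apply: filterS mu2E => w h3 _.
  rewrite -(val_enum_ord n) big_map big_enum; apply: eq_bigr => i _.
  exact: h3.
Qed.

(** [is_SSrp] provides weights and types but no indices; the uniform factor of the explicit model
    supplies them. *)
Lemma gSSS_law : gSSS q H xi ->
  exists (d2 : measure_display) (Om2 : measurableType d2) (P2 : probability Om2 R)
    (p : nat -> {RV P2 >-> R}) (Z : nat -> {RV P2 >-> borel X}) (I : nat -> {RV P2 >-> nat}),
  [/\ species_data q H p Z,
      sampling P2 (joint_sigma p Z) (fun k => p k : Om2 -> R) (fun i => I i : Om2 -> nat) &
      same_law P P2 (fun w => (fun n => xi n w) : seqspace (borel X))
                    (fun w => (fun n => Z (I n w) w) : seqspace (borel X))].
Proof.
move=> [mu [[d0 [Om0 [P0 [p0 [Z0 [mu0 [pZ mu0E muL]]]]]]] muxi Fxi]].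
exists _, _, _, (model_weight p0), (model_type Z0), (model_index pZ).
have mps := model_preserving P0.
split; [exact: model_species|exact: model_sampling|].
have [_ [p01 p1] _ _] := model_species pZ.
apply: (directing_same_law (p := model_weight p0)
  (mu2 := pullback _ (model_proj R Om0) mu0) muxi Fxi).
- by move=> k w; have /andP[] := p01 k w.
- exact: model_sampling.
- exact: (ae_pullback mps mu0E).
move=> A mA; rewrite -[LHS]/(distribution P mu A) muL//.
by apply/esym/mps; rewrite -[X in measurable X]setTI; exact: measurable_funP.
Qed.

End gSSS_law.

(** * Limiting frequencies *)

Section law_of_large_numbers.
Context (R : realType) (d : measure_display) (Om : measurableType d).
Variables (P : probability Om R) (A : nat -> set Om) (c : R).
Hypothesis mA : forall i, measurable (A i).
Hypothesis PA : forall i, P (A i) = c%:E.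
Hypothesis PAA : forall i j, i != j -> P (A i `&` A j) = (c * c)%:E.

Let hits N w : R := \sum_(i < N) \1_(A i) w.

Let mhits N : measurable_fun setT (hits N).
Proof. by apply: measurable_sum => i; exact: measurable_indic. Qed.

Let hits_ge0 N w : 0 <= hits N w.
Proof. by apply: sumr_ge0 => i _; rewrite indicE. Qed.

Let c_ge0 : 0 <= c. Proof. by rewrite -lee_fin -(PA 0). Qed.

Let c_le1 : c <= 1. Proof. by rewrite -lee_fin -(PA 0) probability_le1. Qed.

Lemma integral_hits N : (\int[P]_w (hits N w)%:E = (N%:R * c)%:E)%E.
Proof.
rewrite /hits; under eq_integral do rewrite -sumEFin.
rewrite ge0_integral_sum//; last by move=> i; apply/measurable_EFinP; exact: measurable_indic.
rewrite (eq_bigr (fun=> c%:E)) => [|i _]; last by rewrite integral_indic// setIT; exact: PA.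
by rewrite sumEFin sumr_const card_ord mulr_natl.
Qed.

Lemma integral_hits2 N :
  (\int[P]_w (hits N w * hits N w)%:E = (N%:R * (N%:R * c * c + (c - c * c)))%:E)%E.
Proof.
have E w : (hits N w * hits N w)%:E = (\sum_(i < N) \sum_(j < N) (\1_(A i `&` A j) w)%:E)%E.
  rewrite /hits mulr_suml -sumEFin; apply: eq_bigr => i _.
  rewrite mulr_sumr -sumEFin; apply: eq_bigr => j _.
  by rewrite indicI.
under eq_integral do rewrite E.
rewrite ge0_integral_sum//; last 2 first.
- move=> i; apply: emeasurable_sum => j; apply/measurable_EFinP.
  by apply: measurable_indic; exact: measurableI.
- by move=> i w _; apply: sume_ge0.
transitivity (\sum_(i < N) (N%:R * c * c + (c - c * c))%:E)%E; last first.
  by rewrite sumEFin sumr_const card_ord; congr EFin; rewrite [RHS]mulr_natl.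
apply: eq_bigr => i _.
rewrite ge0_integral_sum//; last first.
  by move=> j; apply/measurable_EFinP; apply: measurable_indic; exact: measurableI.
transitivity (\sum_(j < N) (c * c + (if j == i then c - c * c else 0))%:E)%E.
  apply: eq_bigr => j _; rewrite integral_indic//; last exact: measurableI.
  rewrite setIT; have [->|ji] := eqVneq j i; first by rewrite setIid; apply: etrans (PA i) _; congr EFin; lra.
  by rewrite addr0; apply: PAA; rewrite eq_sym.
rewrite sumEFin big_split/= sumr_const card_ord -big_mkcond/= big_pred1_eq.
by rewrite -[c * c *+ N]mulr_natl mulrA.
Qed.

Lemma hits_variance N :
  (\int[P]_w ((hits N w - N%:R * c) ^+ 2)%:E = (N%:R * (c - c * c))%:E)%E.
Proof.
set v := LHS.
have m1 : measurable_fun setT (fun w => (hits N w - N%:R * c) ^+ 2).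
  by apply: measurable_funX; exact: measurable_funB.
have m2 : measurable_fun setT (fun w => 2 * (N%:R * c) * hits N w) by exact: measurable_funM.
have m3 : measurable_fun setT (fun w => hits N w * hits N w) by exact: measurable_funM.
have n0 : 0 <= 2 * (N%:R * c) by rewrite !mulr_ge0.
(* The square is expanded with the cross term on the left, so that only integrals of nonnegative
   functions are added. *)
have : (v + \int[P]_w (2 * (N%:R * c) * hits N w)%:E =
    \int[P]_w (hits N w * hits N w)%:E + \int[P]_w ((N%:R * c) ^+ 2)%:E)%E.
  rewrite /v -!ge0_integralD//=.
  - by apply: eq_integral => w _; rewrite -!EFinD; congr EFin; lra.
  - by move=> w _; rewrite lee_fin mulr_ge0.
  - exact/measurable_EFinP.
  - by move=> w _; rewrite lee_fin sqr_ge0.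
  - by move=> w _; rewrite lee_fin sqr_ge0.
  - exact/measurable_EFinP.
  - by move=> w _; rewrite lee_fin mulr_ge0.
  - exact/measurable_EFinP.
under eq_integral do rewrite EFinM.
rewrite ge0_integralZl//; last 2 first.
- exact/measurable_EFinP.
- by move=> w _; rewrite lee_fin.
rewrite integral_hits integral_hits2 integral_cst//= [P setT]probability_setT mule1 -EFinM -EFinD; case: v => [r|//|//] [h].
by congr EFin; lra.
Qed.

(** The squared deviation of the frequency after N trials has mean (c - c * c) / N, using only
    independence in pairs. At N = 4 ^ k these means have a finite sum, so the series of squared
    deviations converges almost surely and its terms vanish. *)
Lemma lln : {ae P, forall w, (fun k => (hits (4 ^ k) w / (4 ^ k)%:R)) @ \oo --> c}.
Proof.
pose f k w : R := (hits (4 ^ k) w / (4 ^ k)%:R - c) ^+ 2.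
have mf k : measurable_fun setT (f k).
  by apply: measurable_funX; apply: measurable_funB => //; exact: measurable_funM.
have f0 k w : 0 <= f k w by exact: sqr_ge0.
have fi k : (\int[P]_w (f k w)%:E <= ((4^-1) ^+ k)%:E)%E.
  have E w : (f k w)%:E = ((((4 ^ k)%:R ^- 2)%:E * ((hits (4 ^ k) w - (4 ^ k)%:R * c) ^+ 2)%:E)%E).
    rewrite -EFinM; congr EFin; rewrite -exprVn -exprMn; congr (_ ^+ 2).
    have : (4 ^ k)%:R != 0 :> R by rewrite pnatr_eq0 expn_eq0.
    by move=> h; rewrite mulrBr mulrA mulVf// mul1r mulrC.
  under eq_integral do rewrite E.
  rewrite ge0_integralZl//; last 2 first.
  - by apply/measurable_EFinP; apply: measurable_funX; exact: measurable_funB.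
  - by move=> w _; rewrite lee_fin sqr_ge0.
  rewrite hits_variance -EFinM lee_fin exprVn -(natrX _ 4 k).
  have n0 : 0 < (4 ^ k)%:R :> R by rewrite ltr0n expn_gt0.
  rewrite expr2 invfM -mulrA mulKf ?gt_eqF// -[leRHS]mulr1 ler_wpM2l ?invr_ge0 ?(ltW n0)//.
  by have := mulr_ge0 c_ge0 c_ge0; have := c_le1; lra.
have fs : (\int[P]_w (\sum_(0 <= k <oo) (f k w)%:E) < +oo)%E.
  rewrite integral_nneseries//; last 2 first.
  - by move=> k; exact/measurable_EFinP.
  - by move=> k w _; rewrite lee_fin.
  apply: (@le_lt_trans _ _ (\sum_(0 <= k <oo) ((4^-1) ^+ k : R)%:E)%E).
    apply: lee_nneseries => [k _ _|k _]; last exact: fi.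
    by apply: integral_ge0 => w _; rewrite lee_fin.
  apply: (@le_lt_trans _ _ 2%:E); last exact: ltry.
  apply: lime_le.
    by apply: is_cvg_nneseries => k _ _; rewrite lee_fin exprn_ge0// invr_ge0.
  apply: nearW => n; rewrite big_mkord sumEFin lee_fin.
  (* The term 2 times 4^-n strengthens the bound 2 so that induction goes through. *)
  suff : \sum_(i < n) (4^-1 : R) ^+ i + 2 * (4^-1) ^+ n <= 2.
    by apply: le_trans; rewrite lerDl mulr_ge0// exprn_ge0// invr_ge0.
  elim: n => [|n IH]; first by rewrite big_ord0 expr0; lra.
  rewrite big_ord_recr/=; apply: le_trans IH; rewrite -addrA lerD2l exprS.
  have : 0 <= (4^-1 : R) ^+ n by rewrite exprn_ge0// invr_ge0.
  by move: (_ ^+ n) => x; lra.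
have fae : {ae P, forall w, (\sum_(0 <= k <oo) (f k w)%:E < +oo)%E}.
  have mF : measurable_fun setT (fun w => \sum_(0 <= k <oo) (f k w)%:E)%E.
    apply: ge0_emeasurable_sum => k; first by move=> w _ _; rewrite lee_fin.
    by move=> _; exact/measurable_EFinP.
  have F0 w : (0 <= \sum_(0 <= k <oo) (f k w)%:E)%E.
    by apply: nneseries_ge0 => k _ _; rewrite lee_fin.
  have : P.-integrable setT (fun w => \sum_(0 <= k <oo) (f k w)%:E)%E.
    by apply/integrableP; split => //; under eq_integral do rewrite gee0_abs//.
  move=> /(integrable_ae measurableT); apply: filterS => w /(_ Logic.I).
  by rewrite ge0_fin_numE.
apply: filterS fae => w fw.
have f_cvg : (fun k => (f k w)%:E) @ \oo --> (0 : \bar R).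
  have tail : (\sum_(N <= k <oo) (f k w)%:E)%E @[N --> \oo] --> (0 : \bar R).
    by apply: (nneseries_tail_cvg (P := xpredT)) => // k _; rewrite lee_fin.
  apply: (squeeze_cvge _ (cvg_cst _) tail); apply: nearW => k.
  rewrite lee_fin f0/=; apply: le_trans (nneseries_lim_ge k.+1 _).
    by rewrite big_nat1.
  by move=> i _ _; rewrite lee_fin.
have /cvgrPdist_lt fw0 : (fun k => f k w) @ \oo --> (0 : R) by exact: (fine_cvg f_cvg).
apply/cvgrPdist_lt => e e0.
have e2 : 0 < e ^+ 2 by rewrite exprn_gt0.
apply: filterS (fw0 _ e2) => k.
rewrite sub0r normrN ger0_norm// => h.
by rewrite distrC -(ltr_pXn2r (n := 2))// ?nnegrE ?(ltW e0)// real_normK ?num_real.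
Qed.

End law_of_large_numbers.

(* along the subsequence 4^k the second moments of the deviations are summable,
   which is all that almost sure convergence needs *)
Definition limsup_freq (R : realType) (h : nat -> bool) : \bar R :=
  limn_esup (fun k => ((\sum_(i < 4 ^ k) (h i)%:R) / (4 ^ k)%:R : R)%:E).

Lemma limsup_freq_cvg (R : realType) (h : nat -> bool) (c : R) :
  (fun k => ((\sum_(i < 4 ^ k) (h i)%:R) / (4 ^ k)%:R : R)) @ \oo --> c ->
  limsup_freq R h = c%:E.
Proof.
move=> hc; have hc' : (fun k => ((\sum_(i < 4 ^ k) (h i)%:R) / (4 ^ k)%:R : R)%:E) @ \oo --> c%:E.
  by apply: cvg_EFin; [exact: nearW|exact: hc].
by rewrite /limsup_freq; have [_ ->] := cvg_limn_einf_sup hc'.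
Qed.

Lemma measurable_limsup_freq (R : realType) (d : measure_display) (S : measurableType d)
    (A : nat -> set S) : (forall i, measurable (A i)) ->
  measurable_fun setT (fun w => limsup_freq R (fun i => w \in A i)).
Proof.
move=> mA; apply: measurable_fun_limn_esup => k; apply/measurable_EFinP.
apply: measurable_funM => //; apply: measurable_sum => i.
exact: (measurable_indic (mA i)).
Qed.

Section model_frequencies.
Context (R : realType) (X : ptopologicalType) (q : seq nat -> R).
Context (H : probability (borel X) R).
Context (d : measure_display) (Om : measurableType d) (P : probability Om R).
Variables (p : nat -> {RV P >-> R}) (Z : nat -> {RV P >-> borel X}).
Hypothesis pZ : species_data q H p Z.

Local Notation U := (uniform_prob (@ltr01 R)).
Local Notation P1 := (P \x U)%E.
Local Notation Om1 := (Om * measurableTypeR R)%type.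

Let F : set (set Om1) := preimage_set_system setT fst measurable.

Let Fs : sigma_algebra setT F.
Proof. by apply: sigma_algebra_preimage; exact: sigma_algebra_measurable. Qed.

Let Fm : F `<=` measurable. Proof. by move=> _ [D mD <-]; exact: measurable_fst. Qed.

Let mI i k : measurable (model_index pZ i @^-1` [set k]).
Proof. by rewrite -[X in measurable X]setTI; exact: measurable_funP. Qed.

Variable E : nat -> set Om.
Hypothesis mE : forall k, measurable (E k).

Let A i : set Om1 := [set z | E (model_index pZ i z) z.1].

Let mA i : measurable (A i).
Proof.
rewrite (_ : A i = \bigcup_k (model_index pZ i @^-1` [set k] `&` fst @^-1` E k)); last first.
  apply/seteqP; split=> z; first by move=> Az; exists (model_index pZ i z).
  by move=> [k _ [/= <-]].
apply: bigcup_measurable => k _; apply: measurableI => //.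
by rewrite -[X in measurable X]setTI; exact: measurable_fst.
Qed.

Let mx w : \bar R := mix (proper_weight p) E w.

(** Freezing weights and types at w leaves only the uniform variable random; the events [A i] are
    then independent, each of probability [mx w]. *)
Lemma dirac_index_lln w :
  {ae (\d_w \x U)%E, forall z, limsup_freq R (fun i => z \in A i) = mx w}.
Proof.
have mx1 : (mx w <= 1)%E.
  by apply: mix_le1; [move=> k; exact: (proper_weight_ge0 pZ)|exact: proper_weight_sum].
have mx0 : (0 <= mx w)%E by apply: mix_ge0 => k w'; exact: (proper_weight_ge0 pZ).
have mxfin : mx w = (fine (mx w))%:E.
  by rewrite fineK// ge0_fin_numE//; exact: le_lt_trans mx1 (ltry _).
pose Q : probability Om R := \d_w.
have mmx : measurable_fun setT mx.
  apply: measurable_mix => // k; first by move=> w'; exact: (proper_weight_ge0 pZ).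
  exact: (measurable_proper_weight pZ).
have values (s : seq nat) : uniq s ->
    (Q \x U)%E [set z | forall i, i \in s -> A i z] = (\prod_(i <- s) mx w)%E.
  move=> us.
  have := @sampling_mix _ _ _ (Q \x U)%E F (fun k z => proper_weight p k z.1)
    (fun i => model_index pZ i : _ -> nat).
  move=> /(_ _ _ mI Fm (sigma_algebra_setI Fs) s [::] setT (fun=> 0%N) (fun _ k => fst @^-1` E k)).
  have FT : F setT by exists setT => //; rewrite preimage_setT setTI.
  rewrite cats0 setTI => /(_ _ _ (@draw_sampling _ _ _ _ _ _ _ _ _ pZ Q) FT us) h.
  rewrite (_ : [set z | _] = [set z | (forall i, i \in [::] -> model_index pZ i z = 0%N) /\
    (forall i, i \in s -> (fst @^-1` E (model_index pZ i z)) z)]); last first.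
    by apply/seteqP; split=> z /=; [split|case].
  apply: etrans (h _ _ _) _.
  - by move=> k z; exact: (proper_weight_ge0 pZ).
  - by move=> k; apply: measurableT_comp measurable_fst; exact: (measurable_proper_weight pZ).
  - by move=> _ k; exists (E k) => //; rewrite setTI.
  have fl : same_law (Q \x U)%E Q (fst : Om1 -> Om) idfun.
    by move=> B mB; exact: prod_fst.
  pose g w' := (\prod_(i <- s) mx w')%E.
  have mg : measurable_fun setT g by apply: emeasurable_prod.
  have g0 w' : (0 <= g w')%E.
    by apply: prode_ge0 => i _; apply: mix_ge0 => k w''; exact: (proper_weight_ge0 pZ).
  have h2 := same_law_integral measurable_fst (@measurable_id _ _ setT) fl measurableT mg g0.
  rewrite !preimage_setT in h2; apply: etrans (etrans h2 _).
    by apply: eq_integral => z _; rewrite big_nil mul1e.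
  by rewrite /Q integral_dirac// diracT mul1e.
have := @lln _ _ _ (Q \x U)%E A (fine (mx w)) mA => h; rewrite mxfin.
apply: filterS (h _ _).
- by move=> z hz; apply: (@limsup_freq_cvg _ (fun i => z \in A i)).
- move=> i; rewrite -mxfin; have := values [:: i] isT; rewrite big_seq1 => <-.
  congr ((Q \x U)%E _); apply/seteqP; split=> z /=.
    by move=> Az j; rewrite inE => /eqP ->.
  by apply; rewrite inE.
- move=> i j ij; rewrite EFinM -mxfin; have := values [:: i; j].
  rewrite /= inE ij => /(_ isT); rewrite big_cons big_seq1 => <-.
  congr ((Q \x U)%E _); apply/seteqP; split=> z /=.
    by move=> [Ai Aj] k; rewrite !inE => /orP[/eqP->|/eqP->].
  by move=> h'; split; apply: h'; rewrite !inE eqxx ?orbT.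
Qed.

(** A set whose sections at all w are null is null. The family [E] stays general for two uses:
    counting one index j, and counting a value [Z m], which collects the weights of all indices
    carrying that value. *)
Lemma model_frequency :
  {ae P1, forall z, limsup_freq R (fun i => z \in A i) =
                    mix (fun k => model_weight p k : _ -> R) (fun k => fst @^-1` E k) z}.
Proof.
pose f z := limsup_freq R (fun i => z \in A i).
pose N : set Om1 := ~` [set z | f z = mx z.1].
have mmx : measurable_fun setT mx.
  apply: measurable_mix => // k; first by move=> w'; exact: (proper_weight_ge0 pZ).
  exact: (measurable_proper_weight pZ).
have mN : measurable N.
  apply: measurableC; rewrite -[X in measurable X]setTI; apply: measurable_eqe => //.
    exact: measurable_limsup_freq.
  exact: measurableT_comp measurable_fst.
have N0 : P1 N = 0%E.
  rewrite /product_measure1; apply: integral0_eq => w _.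
  have [N' [mN' N'0 NN']] := dirac_index_lln w.
  pose Nw : set Om1 := ~` [set z | f z = mx w].
  have mNw : measurable Nw.
    apply: measurableC; rewrite -[X in measurable X]setTI; apply: measurable_eqe => //.
    exact: measurable_limsup_freq.
  (* [N] and [Nw] have the same section at w, and against the Dirac mass at w the product measure is
     the uniform measure of that section. *)
  have : (\d_w \x U)%E Nw = 0%E.
    exact: (subset_measure0 (mu := (\d_w \x U)%E) mNw mN' NN' N'0).
  rewrite /product_measure1 integral_dirac// ?diracT ?mul1e//.
    exact: measurable_fun_xsection.
have Nae : {ae P1, forall z, f z = mx z.1}.
  by exists N; split.
apply: filterS2 Nae (model_weightE pZ) => z; rewrite /f => -> zE.
by apply: eq_eseriesr => k _; rewrite zE.
Qed.

End model_frequencies.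

(** * Directing random measures *)

Section diagonal.
Context (R : realType) (X : ptopologicalType).
Hypothesis hX : polish R X.

(** Balls of radius 1/(k+1) around the points of a countable dense set: a ball smaller than half the
    distance of two points, centred near one, excludes the other. *)
Lemma separating_opens : exists2 O : nat -> set X, (forall n, open (O n)) &
  forall x y, (forall n, O n x <-> O n y) -> x = y.
Proof.
have [[D Dc Dd] [dist [[d0 ds dt] mets _]]] := hX.
have dge0 x y : 0 <= dist x y.
  by have := dt x y x; rewrite (d0 x x).2// (ds y x); lra.
have [g gD] : exists g : nat -> X, set_surj setT D g by exact/pcard_surjP.
pose O (m : nat) : set X := if unpickle m is Some (n, k) then [set y | dist (g n) y < k.+1%:R^-1] else set0.
exists O => [m|x y xy].
  rewrite /O; case: unpickle => [[n k]|]; last exact: open0.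
  rewrite openE => y /= yn; apply/mets; exists (k.+1%:R^-1 - dist (g n) y).
    by rewrite subr_gt0.
  by move=> z /=; move: (_^-1) yn (dt (g n) y z) => a /=; lra.
apply: contrapT => nxy.
have exy : 0 < dist x y by rewrite lt_neqAle dge0 andbT eq_sym; apply/eqP => /d0.
have [k kxy] : exists k, k.+1%:R^-1 < dist x y / 2.
  have h2 : 0 < dist x y / 2 by rewrite divr_gt0.
  by have [k kxy] := ltr_add_invr h2; exists k; rewrite add0r in kxy.
have oB : open [set z | dist x z < k.+1%:R^-1].
  rewrite openE => z /= zn; apply/mets; exists (k.+1%:R^-1 - dist x z).
    by rewrite subr_gt0.
  by move=> t /=; move: (_^-1) zn (dt x z t) => a /=; lra.
have [|z [/= xz Dz]] := Dd [set z | dist x z < k.+1%:R^-1] _ oB.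
  by exists x => /=; rewrite (d0 x x).2// invr_gt0.
have [n _ nz] := gD z Dz.
have := xy (pickle (n, k)); rewrite /O pickleK /= nz => h.
have : dist z y < k.+1%:R^-1 by apply/h; rewrite ds.
by move: (_^-1) kxy xz (dt x z y) => a; lra.
Qed.

(** Equality means agreeing on countably many open tests. Values are compared with each other to
    compute frequencies, and this is where the topology of [X] enters. *)
Lemma measurable_eq_fun (d : measure_display) (S : measurableType d) (f g : S -> borel X) :
  measurable_fun setT f -> measurable_fun setT g -> measurable [set s | f s = g s].
Proof.
move=> mf mg; have [V Vo Vs] := separating_opens.
have mV n (h : S -> borel X) : measurable_fun setT h -> measurable (h @^-1` V n).
  move=> mh; rewrite -[X in measurable X]setTI; apply: mh => //.
  exact: sub_sigma_algebra.
rewrite (_ : [set s | _] = \bigcap_n ((f @^-1` V n `&` g @^-1` V n) `|`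
    (~` (f @^-1` V n) `&` ~` (g @^-1` V n)))).
  apply: bigcap_measurableType => n _; apply: measurableU; apply: measurableI;
    by [exact: mV|apply: measurableC; exact: mV].
apply/seteqP; split=> s /=.
  by move=> E n _; rewrite /= E; case: (pselect (V n (g s))) => h; [left|right].
move=> h; apply: Vs => n; case: (h n Logic.I) => -[h1 h2]; split => // h3.
Qed.

End diagonal.

(** Random measures are compared only through their masses on measurable sets; measurable sets of
    measures cannot see more. *)
Lemma pprobability_saturated (R : realType) (d : measure_display) (T : measurableType d)
    (m1 m2 : probability T R) : (forall A, measurable A -> m1 A = m2 A) ->
  forall D : set (pprobability T R), measurable D -> D m1 <-> D m2.
Proof.
move=> m12 D; move: D; apply: smallest_sub.
  split=> //.
  - by move=> D h; rewrite setTD; split=> D1 /h.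
  - by move=> D h; split=> -[n _ Dn]; exists n => //; exact/(h n).
by move=> _ [r _ [A mA <-]]; rewrite /mset /= m12.
Qed.

Lemma measurable_pprobability (R : realType) (d d' : measure_display) (T : measurableType d)
    (S : measurableType d') (G : S -> pprobability T R) :
  (forall A, measurable A -> measurable_fun [set: S] (fun s => (G s : probability T R) A)) ->
  measurable_fun setT G.
Proof.
move=> mG; apply: (measurability (@pset _ _ _ : set (set (pprobability T R)))) => //.
move=> _ -[_ [r r01] [A mA <-]] <-.
exact: emeasurable_fun_infty_o (mG _ mA) _.
Qed.

Section atomic.
Context (R : realType) (d : measure_display) (T : measurableType d).

(** Turns any real sequence into a probability vector, so that [atomic] is defined and measurable
    everywhere. *)
Definition unit_weights (c : nat -> R) (n : nat) : R :=
  if (\sum_(0 <= j <oo) `|c j|%:E == 1)%E then `|c n| else (n == 0%N)%:R.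

Lemma unit_weights_ge0 c n : 0 <= unit_weights c n.
Proof. by rewrite /unit_weights; case: ifP. Qed.

Lemma unit_weights_sum c : (\sum_(0 <= n <oo) (unit_weights c n)%:E = 1)%E.
Proof.
rewrite /unit_weights; case: eqP => [//|_].
rewrite (nneseriesD1 (n := 0%N))//.
by rewrite eseries0 ?adde0// => k _ /negbTE ->.
Qed.

Lemma measurable_unit_weights (d' : measure_display) (S : measurableType d')
    (c : nat -> S -> R) n : (forall n, measurable_fun setT (c n)) ->
  measurable_fun setT (fun s => unit_weights (c ^~ s) n).
Proof.
move=> mc; apply: measurable_fun_ifT => //; last exact: measurableT_comp.
apply: measurable_fun_eqe => //; apply: ge0_emeasurable_sum => // j _.
by apply/measurable_EFinP; exact: measurableT_comp.
Qed.

(* \sum_n c_n \d_(x_n) if c sums to 1, and the default \d_(x_0) otherwise *)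
Definition atomic (c : nat -> R) (x : nat -> T) : probability T R :=
  mnormalize (mseries (fun n => mscale (NngNum (unit_weights_ge0 c n))
    (\d_(x n) : {measure set T -> \bar R})) 0) (\d_(x 0%N) : probability T R).

Lemma atomic_unitE c x A :
  atomic c x A = (\sum_(0 <= n <oo) (unit_weights c n)%:E * \d_(x n) A)%E.
Proof.
pose m : {measure set T -> \bar R} := mseries (fun n => mscale (NngNum (unit_weights_ge0 c n))
    (\d_(x n) : {measure set T -> \bar R})) 0.
have mT : m setT = 1%E.
  rewrite -(unit_weights_sum c); apply: eq_eseriesr => n _.
  apply: etrans (mule1 _); congr (_ * _)%E; exact: diracT.
have -> : atomic c x A = mnormalize m (\d_(x 0%N) : probability T R) A by [].
by rewrite /mnormalize mT onee_eq0 /= invr1 mule1.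
Qed.

Lemma atomicE c x A : (\sum_(0 <= n <oo) `|c n|%:E = 1)%E ->
  atomic c x A = (\sum_(0 <= n <oo) `|c n|%:E * \d_(x n) A)%E.
Proof.
move=> c1; rewrite atomic_unitE; apply: eq_eseriesr => n _.
by rewrite /unit_weights c1 eqxx.
Qed.

Lemma measurable_atomic (d' : measure_display) (S : measurableType d')
    (c : nat -> S -> R) (x : nat -> S -> T) :
  (forall n, measurable_fun setT (c n)) -> (forall n, measurable_fun setT (x n)) ->
  measurable_fun setT ((fun s => atomic (c ^~ s) (x ^~ s)) : S -> pprobability T R).
Proof.
move=> mc mx; apply: measurable_pprobability => A mA.
rewrite (_ : (fun s => _) =
    fun s => (\sum_(0 <= n <oo) (unit_weights (c ^~ s) n)%:E * \d_(x n s) A)%E); last first.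
  by apply/funext => s; rewrite atomic_unitE.
apply: ge0_emeasurable_sum => n.
  by move=> s _ _; rewrite mule_ge0// lee_fin unit_weights_ge0.
move=> _; apply: emeasurable_funM.
  by apply/measurable_EFinP; exact: measurable_unit_weights.
apply/measurable_EFinP; exact: measurableT_comp (measurable_indic mA) (mx n).
Qed.

End atomic.

Section directing_measure.
Context (R : realType) (X : ptopologicalType).

Local Notation S := (seqspace (borel X)).

Definition agree (n i : nat) : set S := [set s : nat -> X | s i = s n].

Definition first_seen (n : nat) : set S := [set s : nat -> X | forall m, (m < n)%N -> s m <> s n].

(** The limiting frequency of the n-th value, counted at its first appearance only, so that a
    repeated value yields a single atom. *)
Definition atom_weight (n : nat) (s : S) : R :=
  fine (limsup_freq R (fun i => s \in agree n i)) * \1_(first_seen n) s.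

Definition directing (s : S) : pprobability (borel X) R :=
  atomic (atom_weight ^~ s) (s : nat -> borel X).

Section measurability.
Hypothesis hX : polish R X.

Lemma measurable_agree n i : measurable (agree n i).
Proof. by apply: (measurable_eq_fun hX) => //; exact: measurable_coord. Qed.

Lemma measurable_first_seen n : measurable (first_seen n).
Proof.
rewrite (_ : first_seen n = \bigcap_(m in `I_n) ~` agree n m).
  by apply: bigcap_measurableType => m _; apply: measurableC; exact: measurable_agree.
by apply/seteqP; split=> s /= h m; exact: h.
Qed.

Lemma measurable_directing : measurable_fun setT directing.
Proof.
apply: measurable_atomic => n; last exact: measurable_coord.
apply: measurable_funM; last by apply: measurable_indic; exact: measurable_first_seen.
apply: (measurableT_comp (fine_measurable measurableT)).
by apply: measurable_limsup_freq => i; exact: measurable_agree.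
Qed.

End measurability.

Lemma limsup_freq_false : limsup_freq R (fun=> false) = 0%E.
Proof.
apply: (@limsup_freq_cvg R _ 0).
rewrite (_ : (fun k => _) = fun=> 0); first exact: cvg_cst.
by apply/funext => k; rewrite big1 ?mul0r.
Qed.

(** Types may coincide when [H] has atoms, so the frequency of a value is the total weight of all
    indices carrying it. Exchanging the sums assigns each index of positive weight to the one time
    at which its value first appears. *)
Lemma directing_sampled (p : nat -> R) (z : nat -> X) (I : nat -> nat) (A : set X) :
  (forall k, 0 <= p k) -> (\sum_(0 <= k <oo) (p k)%:E = 1)%E ->
  (forall m, limsup_freq R (fun i => `[< z (I i) = z m >]) =
    (\sum_(0 <= k <oo) (p k)%:E * (\1_[set j | z j = z m] k)%:E)%E) ->
  (directing (fun i => z (I i)) : probability (borel X) R) A =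
  (\sum_(0 <= k <oo) (p k)%:E * \d_(z k : borel X) A)%E.
Proof.
move=> p0 p1 pz; set s : S := fun i => z (I i).
pose g m : \bar R := (\sum_(0 <= k <oo) (p k)%:E * (\1_[set j | z j = z m] k)%:E)%E.
have g0 m : (0 <= g m)%E by apply: nneseries_ge0 => k _ _; rewrite mule_ge0// lee_fin.
have g1 m : (g m <= 1)%E.
  rewrite -p1; apply: lee_nneseries => k _; first by move=> _; rewrite mule_ge0// lee_fin.
  by rewrite -EFinM lee_fin indicE; case: (_ \in _); rewrite ?mulr1// mulr0.
have gfin m : g m \is a fin_num by rewrite ge0_fin_numE//; exact: le_lt_trans (g1 m) (ltry _).
have cE n : (`|atom_weight n s|%:E = g (I n) * (\1_(first_seen n) s)%:E)%E.
  have E : limsup_freq R (fun i => s \in agree n i) = g (I n) by rewrite /g -pz.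
  rewrite /atom_weight E ger0_norm; last by rewrite mulr_ge0// fine_ge0.
  by rewrite EFinM fineK.
have sumE (B : set (borel X)) : (\sum_(0 <= n <oo) `|atom_weight n s|%:E * \d_(s n) B =
    \sum_(0 <= k <oo) (p k)%:E * \d_(z k : borel X) B)%E.
  pose a n k : \bar R := ((p k)%:E * (\1_[set j | z j = s n] k)%:E * (\1_(first_seen n) s)%:E *
     \d_(s n : borel X) B)%E.
  have a0 n k : (0 <= a n k)%E by rewrite !mule_ge0// lee_fin.
  transitivity (\sum_(0 <= n <oo) \sum_(0 <= k <oo) a n k)%E.
    apply: eq_eseriesr => n _; rewrite cE /g -muleA -ge0_nneseriesZr.
    - by apply: eq_eseriesr => k _; rewrite /a -!muleA.
    - by rewrite mule_ge0.
    - by move=> k; rewrite mule_ge0// lee_fin.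
  rewrite nneseries_interchange//; apply: eq_eseriesr => k _.
  have [pk0|pk] := eqVneq (p k) 0.
    by rewrite pk0 mul0e eseries0// => n _ _; rewrite /a pk0 !mul0e.
  (* A type of positive weight does occur: otherwise its value would have frequency 0, while that
     frequency is at least [p k]. *)
  have [n sn] : exists n, `[< s n = z k >].
    apply: contrapT => /forallNP nk.
    have := pz k; rewrite (_ : (fun i => _) = fun=> false); last first.
      by apply/funext => i; apply/negbTE/negP; exact: nk.
    rewrite limsup_freq_false => g_0.
    have : ((p k)%:E <= g k)%E.
      rewrite /g; apply: le_trans (nneseries_lim_ge k.+1 _); last first.
        by move=> i _ _; rewrite mule_ge0// lee_fin.
      rewrite big_nat_recr//= indicE mem_set// mule1 leeDr// sume_ge0// => i _.
      by rewrite mule_ge0// lee_fin.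
    by rewrite /g -g_0 lee_fin le_eqVlt (negbTE pk) /= ltNge p0.
  have exn : exists n, `[< s n = z k >] by exists n.
  (* Only the first time of the value of type k contributes to the sum over n. *)
  case: (ex_minnP exn) => n0 /asboolP sn0 n0min.
  have first_n0 : first_seen n0 s.
    move=> m mn0 smn0; have := n0min m; rewrite leqNgt mn0 => /(_ _)/negP; apply => //.
    by apply/asboolP; rewrite smn0.
  rewrite (nneseriesD1 (n := n0))//.
  rewrite eseries0 ?adde0; last first.
    move=> m _ /= mn0; rewrite /a [\1_(first_seen m) s]indicE.
    have [zkm|zkm] := pselect (z k = s m); last first.
      by rewrite indicE memNset// mule0 !mul0e.
    rewrite (memNset (A := first_seen m))// ?mule0 ?mul0e// => fm.
    have n0m : (n0 <= m)%N by apply: n0min; apply/asboolP.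
    have : (n0 < m)%N by rewrite ltn_neqAle n0m andbT eq_sym.
    by move=> /fm; apply; rewrite sn0.
  rewrite /a !indicE mem_set//= mule1 mem_set// mule1.
  by rewrite sn0.
rewrite /directing atomicE; first exact: sumE.
rewrite -p1; transitivity (\sum_(0 <= n <oo) `|atom_weight n s|%:E * \d_(s n : borel X) setT)%E.
  by apply: eq_eseriesr => n _; rewrite diracT mule1.
by rewrite sumE; apply: eq_eseriesr => n _; rewrite diracT mule1.
Qed.

End directing_measure.

Section law_to_gSSS.
Context (R : realType) (X : ptopologicalType) (q : seq nat -> R).
Context (H : probability (borel X) R).
Hypothesis hX : polish R X.
Context (d0 : measure_display) (Om0 : measurableType d0) (P0 : probability Om0 R).
Variables (p0 : nat -> {RV P0 >-> R}) (Z0 : nat -> {RV P0 >-> borel X}).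
Hypothesis pZ : species_data q H p0 Z0.
Context (d : measure_display) (Om : measurableType d) (P : probability Om R).
Variable xi : nat -> {RV P >-> borel X}.

Local Notation S := (seqspace (borel X)).
Local Notation U := (uniform_prob (@ltr01 R)).
Local Notation Om1 := (Om0 * measurableTypeR R)%type.

Let P1 : probability Om1 R := (P0 \x U)%E.
Let p : nat -> {RV P1 >-> R} := model_weight p0.
Let Z : nat -> {RV P1 >-> borel X} := model_type Z0.
Let I : nat -> {RV P1 >-> nat} := model_index pZ.
Let xi1 (z : Om1) : S := fun n => Z (I n z) z.
Let xi0 (w : Om) : S := fun n => xi n w.

Hypothesis xi_law : same_law P P1 xi0 xi1.

Let mxi1 : measurable_fun setT xi1.
Proof. by apply: measurable_seq => n; exact: (measurable_index_value Z I). Qed.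

Let mxi0 : measurable_fun setT xi0. Proof. exact: measurable_seq. Qed.

Let mdir : measurable_fun setT (@directing R X). Proof. exact: measurable_directing. Qed.

Let mu : {RV P >-> pprobability (borel X) R} := mkRV P (measurableT_comp mdir mxi0).
Let mu1 : {RV P1 >-> pprobability (borel X) R} := mkRV P1 (measurableT_comp mdir mxi1).

Let p_ge0 k z : 0 <= p k z.
Proof. by have [_ [h _] _ _] := model_species pZ; have /andP[] := h k z. Qed.

Let pmix (A : set (borel X)) z := mix (fun k => p k : _ -> R) (fun k => Z k @^-1` A) z.

Lemma directing_model :
  {ae P1, forall z, forall A, (mu1 z : probability (borel X) R) A = pmix A z}.
Proof.
have [_ [_ p1] _ _] := model_species pZ.
have fr : {ae P1, forall z, forall m, limsup_freq R (fun i => `[< Z (I i z) z = Z m z >]) =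
    (\sum_(0 <= k <oo) (p k z)%:E * (\1_[set j | Z j z = Z m z] k)%:E)%E}.
  apply: ae_foralln => m.
  have mE k : measurable [set w | Z0 k w = Z0 m w] by exact: (measurable_eq_fun hX).
  have h := model_frequency pZ (E := fun k => [set w | Z0 k w = Z0 m w]) mE.
  by apply: filterS h => z.
apply: filterS2 p1 fr => z p1 fr A; apply: directing_sampled => //.
Qed.

(* a version of mu1 that depends on the weights and types only *)
Let mu2 z : pprobability (borel X) R := atomic (p ^~ z) (Z ^~ z).

Let mu2E : {ae P1, forall z, forall A, (mu2 z : probability (borel X) R) A = pmix A z}.
Proof.
have [_ [_ p1] _ _] := model_species pZ.
apply: filterS p1 => z p1 A; rewrite /mu2 atomicE.
  by apply: eq_eseriesr => k _; rewrite ger0_norm.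
by rewrite -p1; apply: eq_eseriesr => k _; rewrite ger0_norm.
Qed.

Let mu2F (D : set (pprobability (borel X) R)) : measurable D -> joint_sigma p Z (mu2 @^-1` D).
Proof.
have Fs : sigma_algebra setT (joint_sigma p Z) by exact: smallest_sigma_algebra.
move: D; apply/(sub_measurableP Fs).
apply: measurable_atomic => n; apply/(sub_measurableP Fs) => B mB; apply: sub_sigma_algebra.
  by left; apply: sub_sigma_algebra; exists n => //; exists B => //; rewrite setTI.
by right; apply: sub_sigma_algebra; exists n => //; exists B => //; rewrite setTI.
Qed.

Let F := preimage_set_system setT mu measurable.

Let Fs : sigma_algebra setT F.
Proof. by apply: sigma_algebra_preimage; exact: sigma_algebra_measurable. Qed.

Let Fm : F `<=` measurable. Proof. by move=> _ [D mD <-]; exact: measurable_funP. Qed.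

(** Moved to the model by equality of laws. There [mu1] is a function of the sampled sequence, so
    its events need not belong to the sigma-algebra of weights and types; replacing it by [mu2] puts
    them there, and [sampling_values] applies. *)
Lemma directing_integral (D : set (pprobability (borel X) R)) (s : seq nat)
    (B : nat -> set (borel X)) :
  measurable D -> uniq s -> (forall i, measurable (B i)) ->
  (\int[P]_(w in mu @^-1` D) \prod_(i <- s) (mu w : probability (borel X) R) (B i) =
   P ([set w | forall i, i \in s -> B i (xi i w)] `&` mu @^-1` D))%E.
Proof.
move=> mD us mB.
have mm : same_law P P1 mu mu1.
  by move=> C mC; exact: (same_law_comp mdir xi_law mC).
pose f (m : pprobability (borel X) R) := (\prod_(i <- s) (m : probability (borel X) R) (B i))%E.
have mf : measurable_fun [set: pprobability (borel X) R] f.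
  apply: (@emeasurable_prod _ _ _ _ _ _ (fun (i : nat) (m : pprobability (borel X) R) => (m : probability (borel X) R) (B i))) => i.
  exact: measurable_eval.
have f0 m : (0 <= f m)%E by apply: prode_ge0.
have h2 := same_law_integral (measurable_funP mu) (measurable_funP mu1) mm mD mf f0.
apply: etrans h2 _.
have mpre (d' : measure_display) (T : measurableType d') (Q : probability T R)
    (m : {RV Q >-> pprobability (borel X) R}) : measurable (m @^-1` D).
  by rewrite -[X in measurable X]setTI; exact: measurable_funP.
pose W : set S := [set x : nat -> borel X | forall i, i \in s -> B i (x i)] `&` (@directing R X) @^-1` D.
have mW : measurable W.
  apply: measurableI; last by rewrite -[X in measurable X]setTI; exact: mdir.
  rewrite (_ : [set x | _] = \bigcap_(i in [set` s]) ((fun x : S => (x : nat -> borel X) i) @^-1` B i)) //.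
  apply: bigcap_measurableType => i _.
  by rewrite -[X in measurable X]setTI; exact: measurable_coord.
apply: etrans (esym (xi_law mW)).
have mD1 : measurable (mu1 @^-1` D) by exact: (mpre _ _ P1 mu1).
have mD2 : measurable (mu2 @^-1` D) by exact: (joint_sigma_measurable (mu2F mD)).
have D12 : {ae P1, forall z, (mu1 @^-1` D) z <-> (mu2 @^-1` D) z}.
  apply: filterS2 directing_model mu2E => z h1 h3.
  exact: (pprobability_saturated (fun A _ => etrans (h1 A) (esym (h3 A))) mD).
have mpmix A : measurable A -> measurable_fun setT (pmix A).
  move=> mA; apply: measurable_mix => // k.
  by rewrite -[X in measurable X]setTI; exact: measurable_funP.
have mV : measurable [set z | forall i, i \in s -> B i (Z (I i z) z)].
  rewrite (_ : [set z | _] = \bigcap_(i in [set` s]) ((fun z => Z (I i z) z) @^-1` B i)) //.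
  apply: bigcap_measurableType => i _.
  by rewrite -[X in measurable X]setTI; exact: (measurable_index_value Z I).
transitivity (\int[P1]_(z in mu2 @^-1` D) \prod_(i <- s) pmix (B i) z)%E.
  rewrite [LHS]integral_mkcond [RHS]integral_mkcond; apply: ae_eq_integral => //.
  - apply/(measurable_restrictT _ _).1 => //.
    by apply: measurable_funTS; exact: (measurableT_comp mf).
  - apply/(measurable_restrictT _ _).1 => //.
    by apply: measurable_funTS; apply: emeasurable_prod => i; exact: mpmix.
  - apply: filterS2 D12 directing_model => z D12 h1 _; rewrite !patchE.
    rewrite (_ : (z \in mu1 @^-1` D) = (z \in mu2 @^-1` D)).
      by case: ifP => // _; apply: eq_bigr => i _; rewrite -h1.
    by apply/idP/idP; rewrite !inE => /D12.
apply: etrans (esym (sampling_values p_ge0 (model_sampling pZ) (mu2F mD) us mB)) _.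
apply: ae_eq_prob.
- exact: measurableI.
- by rewrite -[X in measurable X]setTI; exact: mxi1.
- by apply: filterS D12 => z D12; split=> -[h1 h3]; split=> //; exact/D12.
Qed.

Let gmu (B : set (borel X)) (w : Om) : R := fine ((mu w : probability (borel X) R) B).

Let gmu_cond (s : seq nat) (B : nat -> set (borel X)) : uniq s -> (forall i, measurable (B i)) ->
  cond_prob P F (\bigcap_(i in [set` s]) (xi i @^-1` B i)) (fun w => \prod_(i <- s) gmu (B i) w).
Proof.
move=> us mB.
have -> : (fun w => \prod_(i <- s) gmu (B i) w) =
    (fun w => fine (\prod_(i <- s) (mu w : probability (borel X) R) (B i))%E).
  by apply/funext => w; rewrite fine_prod.
apply: cond_prob_ge0P => //.
- apply: emeasurable_prod => i; apply/(sub_measurableP Fs) => C mC.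
  exists ((fun m : pprobability (borel X) R => (m : probability (borel X) R) (B i)) @^-1` C).
    by rewrite -[X in measurable X]setTI; exact: (measurable_eval (mB i)).
  by rewrite setTI.
- apply: bigcap_measurableType => i _.
  by rewrite -[X in measurable X]setTI; exact: measurable_funP.
- by move=> w; apply: prode_ge0.
- apply: aeW => w; rewrite ge0_fin_numE; last exact: prode_ge0.
  apply: (@le_lt_trans _ _ 1%E); last exact: ltry.
  elim: (s) => [|i t IH]; first by rewrite big_nil.
  rewrite big_cons -[leRHS]mule1; apply: lee_pmul => //; first exact: prode_ge0.
  exact: probability_le1.
- move=> _ [D mD <-]; rewrite setTI; apply: etrans (directing_integral mD us mB) _.
  by congr (P (_ `&` _)).
Qed.

Lemma law_gSSS : gSSS q H xi.
Proof.
exists mu; split.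
- exists _, _, P1, p, Z, mu1; split.
  + exact: model_species.
  + by apply: filterS directing_model => z h A mA; rewrite h.
  + by move=> B mB; exact: (same_law_comp mdir xi_law mB).
- move=> n A mA; have := @gmu_cond [:: n] (fun=> A) isT (fun=> mA).
  rewrite set_cons1 bigcap_set1.
  by rewrite (_ : (fun w => _) = gmu A)//; apply/funext => w; rewrite big_seq1.
- apply: (cond_indepP Fs Fm (g := fun _ B => gmu B)).
  + move=> i B mB; have := @gmu_cond [:: i] (fun=> B) isT (fun=> mB).
    rewrite set_cons1 bigcap_set1.
    by rewrite (_ : (fun w => _) = gmu B)//; apply/funext => w; rewrite big_seq1.
  + by move=> s B us mB; exact: gmu_cond.
Qed.

End law_to_gSSS.

(** * Recovering indices and weights from the sequence *)

Section conditional_index_law.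
Context (R : realType) (d d' : measure_display) (Om : measurableType d) (S : measurableType d').
Variables (P : probability Om R) (X : {RV P >-> S}) (I : nat -> {RV P >-> nat}).

Local Notation Q := (distribution P X).

Definition prefix_event (t : seq nat) : set Om :=
  [set w | forall i, (i < size t)%N -> I i w = nth 0%N t i].

Lemma measurable_prefix_event t : measurable (prefix_event t).
Proof.
rewrite (_ : prefix_event t = \bigcap_(i in `I_(size t)) (I i @^-1` [set nth 0%N t i])) //.
apply: bigcap_measurableType => i _.
by rewrite -[X in measurable X]setTI; exact: measurable_funP.
Qed.

Let mX B : measurable B -> measurable (X @^-1` B).
Proof. by move=> mB; rewrite -[X in measurable X]setTI; exact: measurable_funP. Qed.

(** The Radon-Nikodym derivative, with respect to the law of [X], of the measure that records the
    prefix t jointly with [X]: a conditional probability of the prefix as a function on [S]. *)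
Lemma prefix_density t : exists f : S -> \bar R,
  [/\ forall x, (0 <= f x)%E, forall x, f x \is a fin_num, measurable_fun setT f &
      forall B, measurable B -> (\int[Q]_(x in B) f x = P (X @^-1` B `&` prefix_event t))%E].
Proof.
have mt := measurable_prefix_event t.
pose push : {measure set S -> \bar R} := pushforward (mrestr P mt) X.
pose nu0 := push (@measurable_funP _ _ _ _ setT X).
have nuoo : (nu0 setT < +oo)%E.
  rewrite /nu0 /= /pushforward /mrestr preimage_setT setTI.
  exact: le_lt_trans (probability_le1 P mt) (ltry _).
pose nu : {finite_measure set S -> \bar R} := mfrestr measurableT nuoo.
have nuE B : nu B = P (X @^-1` B `&` prefix_event t).
  by rewrite /nu /= /mfrestr /mrestr setIT.
have dom : nu `<< Q.
  apply/null_content_dominatesP => B mB QB0; rewrite nuE.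
  apply/eqP; rewrite eq_le measure_ge0 andbT -QB0; apply: le_measure.
  - by rewrite inE; apply: measurableI => //; exact: mX.
  - by rewrite inE; exact: mX.
  - exact: subIsetl.
have [f [f0 ffin /integrableP[mf _] fE]] := @radon_nikodym_sigma_finite _ _ _ Q nu dom.
by exists f; split=> // B mB; rewrite -fE// nuE.
Qed.

Let dens (t : seq nat) : S -> \bar R := sval (cid (prefix_density t)).

Let dens0 t x : (0 <= dens t x)%E. Proof. by rewrite /dens; case: cid => f [h _ _ _] /=. Qed.
Let densfin t x : dens t x \is a fin_num. Proof. by rewrite /dens; case: cid => f [_ h _ _] /=. Qed.
Let mdens t : measurable_fun setT (dens t). Proof. by rewrite /dens; case: cid => f [_ _ h _] /=. Qed.
Let densE t B : measurable B -> (\int[Q]_(x in B) dens t x = P (X @^-1` B `&` prefix_event t))%E.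
Proof. by move=> mB; rewrite /dens; case: cid => f [_ _ _ h] /=; exact: h. Qed.

Let dens_int t : Q.-integrable setT (dens t).
Proof.
apply/integrableP; split=> //; under eq_integral do rewrite gee0_abs//.
by rewrite densE// preimage_setT setTI;
  exact: le_lt_trans (probability_le1 P (measurable_prefix_event t)) (ltry _).
Qed.

Let dens_nil : {ae Q, forall x, dens [::] x = 1%E}.
Proof.
have : ae_eq Q setT (dens [::]) (cst 1%E).
  apply: (integral_ae_eq measurableT (dens_int _)) => // B _ mB; rewrite densE// integral_cst// mul1e.
  by congr (P _); apply/setIidPl => w _.
by apply: filterS => x; exact.
Qed.

Let dens_sum t : {ae Q, forall x, (\sum_(0 <= k <oo) dens (rcons t k) x)%E = dens t x}.
Proof.
have mS : measurable_fun setT (fun x => \sum_(0 <= k <oo) dens (rcons t k) x)%E.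
  exact: ge0_emeasurable_sum.
have : ae_eq Q setT (dens t) (fun x => \sum_(0 <= k <oo) dens (rcons t k) x)%E.
  apply: (integral_ae_eq measurableT (dens_int _)) => // B _ mB; rewrite integral_nneseries//; last first.
    by move=> k; exact: measurable_funTS.
  rewrite densE// (measure_nat_partition P (f := I (size t))).
  - apply: eq_eseriesr => k _; rewrite densE// -setIA; congr (P (_ `&` _)).
    apply/seteqP; split=> w /=.
      move=> [h Ik] i; rewrite size_rcons ltnS leq_eqVlt => /predU1P[->|ilt].
        by rewrite nth_rcons ltnn eqxx.
      by rewrite nth_rcons ilt; exact: h.
    move=> h; split=> [i ilt|].
      by have := h i; rewrite size_rcons nth_rcons ilt; apply; exact: ltnW.
    by have := h (size t); rewrite size_rcons nth_rcons ltnn eqxx; exact.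
  - by move=> k; rewrite -[X in measurable X]setTI; exact: measurable_funP.
  - by apply: measurableI; [exact: mX|exact: measurable_prefix_event].
by apply: filterS => x /(_ Logic.I).
Qed.

(** Densities of the extensions of t add up to that of t outside a null set depending on t. Optional
    prefixes let [unpickle] enumerate all t by natural numbers, giving one null set for all. *)
Let consistent (o : option (seq nat)) : set S :=
  if o is Some t then [set x | (\sum_(0 <= k <oo) dens (rcons t k) x)%E = dens t x] else setT.

Let good : set S := [set x | dens [::] x = 1%E /\ forall t, consistent (Some t) x].

Let mgood : measurable good.
Proof.
rewrite (_ : good = [set x | dens [::] x = 1%E] `&` \bigcap_n consistent (unpickle n)).
  apply: measurableI; first by rewrite -[X in measurable X]setTI; apply: measurable_eqe.
  apply: bigcapT_measurable => n.
  case: (unpickle n : option (seq nat)) => [t|]; last exact: measurableT.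
  by rewrite -[X in measurable X]setTI; apply: measurable_eqe => //; exact: ge0_emeasurable_sum.
apply/seteqP; split=> x.
  by move=> [h1 h2]; split=> // n _; case: (unpickle n : option (seq nat)) => [t|//]; exact: h2.
by move=> [h1 h2]; split=> // t; have := h2 (pickle t) Logic.I; rewrite pickleK.
Qed.

Let good_ae : {ae Q, forall x, good x}.
Proof.
have h : {ae Q, forall x, forall n : nat, consistent (unpickle n) x}.
  apply: ae_foralln => n; case: (unpickle n : option (seq nat)) => [t|]; last exact: aeW.
  exact: dens_sum.
apply: filterS2 dens_nil h => x h1 h2; split=> // t.
by have := h2 (pickle t); rewrite pickleK.
Qed.

(* conditional probabilities of the prefixes of I given X, with
   I = (0, 0, ...) on an exceptional null set *)
Definition prefix_prob (t : seq nat) (x : S) : R :=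
  if x \in good then fine (dens t x) else (all (pred1 0%N) t)%:R.

Lemma measurable_prefix_prob t : measurable_fun setT (prefix_prob t).
Proof.
apply: measurable_fun_ifT.
- apply: (measurable_fun_bool true); rewrite setTI (_ : _ @^-1` _ = good); first exact: mgood.
  by apply/seteqP; split=> x h; [exact: set_mem h|exact: mem_set].
- exact: (measurableT_comp (fine_measurable measurableT)).
- exact: measurable_cst.
Qed.

Lemma prefix_prob_ge0 t x : 0 <= prefix_prob t x.
Proof. by rewrite /prefix_prob; case: ifP => // _; rewrite fine_ge0. Qed.

Lemma prefix_prob_nil x : prefix_prob [::] x = 1.
Proof. by rewrite /prefix_prob; case: ifPn => //; rewrite inE => -[-> _]. Qed.

Lemma prefix_prob_sum t x :
  (\sum_(0 <= k <oo) (prefix_prob (rcons t k) x)%:E = (prefix_prob t x)%:E)%E.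
Proof.
rewrite /prefix_prob; case: ifPn => [|_].
  rewrite inE => -[_ /(_ t) xt]; rewrite fineK// -xt.
  by apply: eq_eseriesr => k _; rewrite fineK.
rewrite (nneseriesD1 (n := 0%N))//.
rewrite eseries0 ?adde0; first by rewrite all_rcons.
by move=> k _ /negbTE k0; rewrite all_rcons /= k0.
Qed.

Lemma integral_prefix_prob t B : measurable B ->
  (\int[Q]_(x in B) (prefix_prob t x)%:E = P (X @^-1` B `&` prefix_event t))%E.
Proof.
move=> mB; rewrite -densE//; apply: ae_eq_integral => //.
- by apply/measurable_EFinP; apply: measurable_funTS; exact: measurable_prefix_prob.
- exact: measurable_funTS.
- apply: filterS good_ae => x gx _.
  by rewrite /prefix_prob mem_set// fineK.
Qed.

End conditional_index_law.

Definition prefix_set (t : seq nat) : set (seqspace nat) :=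
  [set f : nat -> nat | forall i, (i < size t)%N -> f i = nth 0%N t i].

(** The empty set is included since incompatible prefixes have no common extension; compatible ones
    are nested, which gives stability under intersection. *)
Definition prefix_sets : set (set (seqspace nat)) :=
  [set A | A = set0 \/ exists t, A = prefix_set t].

Lemma prefix_sets_setT : prefix_sets setT.
Proof. by right; exists [::]; apply/seteqP; split. Qed.

Lemma prefix_sets_setI : setI_closed prefix_sets.
Proof.
have h s t : (size s <= size t)%N -> prefix_sets (prefix_set s `&` prefix_set t).
  move=> st; have [E|E] := eqVneq (take (size s) t) s.
    right; exists t; apply/setIidPr => f ft i ilt.
    by rewrite ft ?(leq_trans ilt)// -[in RHS]E nth_take.
  left; apply/seteqP; split=> f // -[fs ft]; move/eqP: E; apply.
  apply: (@eq_from_nth _ 0%N); first by rewrite size_take_min (minn_idPl st).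
  move=> i; rewrite size_take_min (minn_idPl st) => ilt.
  by rewrite nth_take// -fs// -ft// (leq_trans ilt).
move=> A B [->|[s ->]]; first by rewrite set0I; left.
move=> [->|[t ->]]; first by rewrite setI0; left.
have [st|/ltnW st] := leqP (size s) (size t); first exact: h.
by rewrite setIC; exact: h.
Qed.

Lemma measurable_prefix_set t : measurable (prefix_set t).
Proof.
rewrite (_ : prefix_set t = rect (size t) (fun i => [set nth 0%N t i]))//.
exact: measurable_rect.
Qed.

Lemma measurable_prefix_sets : @measurable _ (seqspace nat) = <<s prefix_sets >>.
Proof.
apply/seteqP; split; last first.
  apply: smallest_sub; first exact: sigma_algebra_measurable.
  by move=> A [->|[t ->]]; [exact: measurable0|exact: measurable_prefix_set].
apply: smallest_sub; first exact: smallest_sigma_algebra.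
move=> _ [n _ [B mB <-]].
have [s0 _ sU] := smallest_sigma_algebra [set: seqspace nat] prefix_sets.
pose C (k : nat) : set (seqspace nat) := if (unpickle k : option (seq nat)) is Some t then
  (if (size t == n.+1) && `[< B (nth 0%N t n) >] then prefix_set t else set0) else set0.
rewrite (_ : _ `&` _ = \bigcup_k C k).
  apply: sU => k; rewrite /C; case: (unpickle k : option (seq nat)) => [t|]//.
  by case: ifP => // _; apply: sub_sigma_algebra; right; exists t.
rewrite setTI; apply/seteqP; split=> f /=.
  move=> fB; exists (pickle (mkseq f n.+1)) => //.
  rewrite /C (pickleK (mkseq f n.+1)) size_mkseq eqxx nth_mkseq// asboolT//.
  by move=> i; rewrite size_mkseq => ilt; rewrite nth_mkseq.
move=> [k _]; rewrite /C; case: (unpickle k : option (seq nat)) => [t|]//.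
case: ifP => // /andP[/eqP st /asboolP Bt] ft.
by rewrite ft ?st.
Qed.

Section pair_law.
Context (R : realType) (d1 d2 d : measure_display).
Context (Om1 : measurableType d1) (Om2 : measurableType d2) (S : measurableType d).
Variables (P1 : probability Om1 R) (P2 : probability Om2 R).
Variables (X1 : {RV P1 >-> S}) (X2 : {RV P2 >-> S}).
Variables (I1 : nat -> {RV P1 >-> nat}) (I2 : nat -> {RV P2 >-> nat}).
Hypothesis prefix_law : forall B t, measurable B ->
  P1 (X1 @^-1` B `&` prefix_event I1 t) = P2 (X2 @^-1` B `&` prefix_event I2 t).

Let J1 : Om1 -> seqspace nat := fun w n => I1 n w.
Let J2 : Om2 -> seqspace nat := fun w n => I2 n w.
Let mJ1 : measurable_fun setT J1. Proof. exact: (@measurable_seq _ nat _ _ (fun n w => I1 n w)). Qed.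
Let mJ2 : measurable_fun setT J2. Proof. exact: (@measurable_seq _ nat _ _ (fun n w => I2 n w)). Qed.

Lemma pair_rect_law B D : measurable B -> measurable D ->
  P1 (X1 @^-1` B `&` J1 @^-1` D) = P2 (X2 @^-1` B `&` J2 @^-1` D).
Proof.
move=> mB mD.
have m1 : measurable (X1 @^-1` B) by rewrite -[X in measurable X]setTI; exact: measurable_funP.
have m2 : measurable (X2 @^-1` B) by rewrite -[X in measurable X]setTI; exact: measurable_funP.
have := @finite_measure_unique R _ (seqspace nat) prefix_sets
  (pushforward (mrestr P1 m1) (mfun_Sub (mem_set mJ1)))
  (pushforward (mrestr P2 m2) (mfun_Sub (mem_set mJ2))).
move=> /(_ mJ1 mJ2) /(_ _ _ _ _ _ D); rewrite /= /pushforward /mrestr.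
move=> h; rewrite [X1 @^-1` B `&` _]setIC [X2 @^-1` B `&` _]setIC; apply: h.
- by rewrite measurable_prefix_sets; exact: sub_sigma_algebra.
- exact: prefix_sets_setT.
- exact: prefix_sets_setI.
- by rewrite preimage_setT setTI ltey_eq fin_num_prob.
- move=> A [->|[t ->]]; first by rewrite !preimage_set0 !set0I !measure0.
  by rewrite [_ `&` X1 @^-1` B]setIC [_ `&` X2 @^-1` B]setIC; exact: prefix_law.
- by rewrite -measurable_prefix_sets.
Qed.

(** Two successive uses of uniqueness of measures: first from prefixes to all index events with the
    first component fixed, then from rectangles to the product. *)
Lemma pair_same_law :
  same_law P1 P2 ((fun w => (X1 w, J1 w)) : Om1 -> (S * seqspace nat)%type) (fun w => (X2 w, J2 w)).
Proof.
have m1 : measurable_fun setT (fun w => (X1 w, J1 w)) by exact: measurable_fun_pair.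
have m2 : measurable_fun setT (fun w => (X2 w, J2 w)) by exact: measurable_fun_pair.
move=> W mW.
have := @finite_measure_unique R _ (S * seqspace nat)%type
  [set A `*` B | A in measurable & B in measurable]
  (pushforward P1 (mfun_Sub (mem_set m1)))
  (pushforward P2 (mfun_Sub (mem_set m2))).
move=> /(_ m1 m2) /(_ _ _ _ _ _ W); rewrite /= /pushforward; apply.
- by move=> _ [A mA [B mB <-]]; exact: measurableX.
- by exists setT => //; exists setT => //; rewrite setXTT.
- move=> _ _ [A mA [B mB <-]] [A' mA' [B' mB' <-]].
  exists (A `&` A'); first exact: measurableI.
  by exists (B `&` B'); [exact: measurableI|rewrite setXI].
- by rewrite preimage_setT probability_setT ltry.
- by move=> _ [A mA [B mB <-]]; exact: pair_rect_law.
- by rewrite -measurable_prod_measurableType.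
Qed.

End pair_law.

Section product_law.
Context (R : realType) (d1 d2 d3 d d' : measure_display).
Context (Om1 : measurableType d1) (Om2 : measurableType d2) (Om3 : measurableType d3).
Context (S : measurableType d) (S' : measurableType d').
Variables (P1 : probability Om1 R) (P2 : probability Om2 R) (P3 : probability Om3 R).

Lemma prod_same_law (Y1 : Om1 -> S) (Y2 : Om2 -> S) (V : {RV P3 >-> S'}) :
  measurable_fun setT Y1 -> measurable_fun setT Y2 -> same_law P1 P2 Y1 Y2 ->
  same_law (P1 \x P3)%E (P2 \x P3)%E (fun z => (Y1 z.1, V z.2)) (fun z => (Y2 z.1, V z.2)).
Proof.
move=> m1 m2 Y12 W mW.
pose h (t : S) : \bar R := distribution P3 V (xsection W t).
have mh : measurable_fun setT h by exact: measurable_fun_xsection.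
have E (d0 : measure_display) (Om0 : measurableType d0) (P0 : probability Om0 R) (Y : Om0 -> S) :
    (P0 \x P3)%E ((fun z => (Y z.1, V z.2)) @^-1` W) = (\int[P0]_w h (Y w))%E.
  rewrite /product_measure1; apply: eq_integral => w _.
  rewrite /h /distribution /pushforward /=; congr (P3 _).
apply: etrans (E _ _ P1 Y1) (etrans _ (esym (E _ _ P2 Y2))).
have := same_law_integral m1 m2 Y12 measurableT mh.
by rewrite !preimage_setT; apply => t; exact: measure_ge0.
Qed.

End product_law.

Section density.
Context (R : realType) (d : measure_display) (Om : measurableType d).
Variables (P : probability Om R) (f : Om -> \bar R).
Hypotheses (mf : measurable_fun setT f) (f0 : forall w, (0 <= f w)%E).

Definition density_measure (A : set Om) : \bar R := (\int[P]_(w in A) f w)%E.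

Let density0 : density_measure set0 = 0%E. Proof. exact: integral_set0. Qed.

Let density_ge0 A : (0 <= density_measure A)%E. Proof. exact: integral_ge0. Qed.

Let density_sigma_additive : semi_sigma_additive density_measure.
Proof. exact: semi_sigma_additive_nng_induced. Qed.

HB.instance Definition _ := isMeasure.Build _ _ _ density_measure
  density0 density_ge0 density_sigma_additive.

End density.

(** * Characterizing a species model by one identity in law *)

Section joint_species.
Context (R : realType) (d d' : measure_display) (Om : measurableType d) (T : measurableType d').
Variables (P : probability Om R) (H : probability T R).
Variables (p : nat -> {RV P >-> R}) (Z : nat -> {RV P >-> T}) (I : nat -> {RV P >-> nat}).
Hypothesis p01 : forall k w, 0 <= p k w <= 1.

Definition weight_event (D : set (seqspace R)) : set Om := [set w | D (fun k => p k w)].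

Definition index_event (s : seq nat) (k : nat -> nat) : set Om :=
  [set w | forall i, i \in s -> I i w = k i].

Definition type_event n (B : nat -> set T) : set Om :=
  [set w | forall j, (j < n)%N -> B j (Z j w)].

(** Both sides depend only on the joint law of weights, indices and types, so the identity can be
    checked in one model and used in another. It contains the i.i.d. property, the independence of
    weights and types, and conditional sampling. *)
Hypothesis joint : forall D s k n B, measurable D -> uniq s -> (forall i, measurable (B i)) ->
  P ((weight_event D `&` index_event s k) `&` type_event n B) =
  ((\int[P]_(w in weight_event D) \prod_(i <- s) (p (k i) w)%:E) * \prod_(j < n) H (B j))%E.

Let measurable_weight_event D : measurable D -> measurable (weight_event D).
Proof.
move=> mD; rewrite -[X in measurable X]setTI.
exact: (@measurable_seq _ R _ _ (fun k w => p k w)).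
Qed.

Let measurable_index_event s k : measurable (index_event s k).
Proof.
rewrite (_ : index_event s k = \bigcap_(i in [set` s]) (I i @^-1` [set k i])) //.
apply: bigcap_measurableType => i _.
by rewrite -[X in measurable X]setTI; exact: measurable_funP.
Qed.

Let index_event0 k : index_event [::] k = setT.
Proof. by apply/seteqP; split. Qed.

Let weight_eventT : weight_event setT = setT. Proof. by []. Qed.

Lemma joint_iid : iid Z H.
Proof.
apply: iidP => n B mB; have := joint (fun=> 0%N) n (@measurableT _ (seqspace R))
  (isT : uniq ([::] : seq nat)) mB.
rewrite weight_eventT index_event0 setIT setTI => ->.
under eq_integral do rewrite big_nil.
by rewrite integral_cst// mul1e -[RHS]mul1e; congr (_ * _)%E; exact: probability_setT.
Qed.

Lemma joint_index_type D s k E : measurable D -> uniq s -> seq_sigma Z E ->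
  P ((weight_event D `&` index_event s k) `&` E) =
  ((\int[P]_(w in weight_event D) \prod_(i <- s) (p (k i) w)%:E) * P E)%E.
Proof.
move=> mD us; rewrite seq_sigmaE => -[B mB <-]; rewrite setTI.
have one B' n : (forall i, measurable (B' i)) ->
  P (weight_event D `&` index_event s k `&` type_event n B') =
  (P (type_event n B') * P (weight_event D `&` index_event s k))%E.
  move=> mB'; rewrite joint// muleC; congr (_ * _)%E; first exact/esym/(iid_rect n joint_iid).
  have := joint k 0 mD us (fun i => measurableT : measurable [set: T]).
  rewrite big_ord0 mule1 => <-; congr (P _).
  by apply/setIidPl => w _ j.
have mA : measurable (weight_event D `&` index_event s k).
  by apply: measurableI => //; exact: measurable_weight_event.
rewrite setIC (indep_rect (P := P) (X := fun j w => Z j w))//; last first.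
  by move=> n B' mB'; rewrite setIC; exact: one.
rewrite muleC; congr (_ * _)%E.
have := joint k 0 mD us (fun i => measurableT : measurable [set: T]).
rewrite big_ord0 mule1 => <-; congr (P _).
by apply/esym/setIidPl => w _ j.
Qed.

Lemma joint_indep : indep_systems P (seq_sigma p) (seq_sigma Z).
Proof.
move=> A E; rewrite seq_sigmaE => -[D mD <-] ZE; rewrite setTI -/(weight_event D).
have := joint_index_type (fun=> 0%N) mD (isT : uniq ([::] : seq nat)) ZE.
rewrite index_event0 setIT => ->; congr (_ * _)%E.
under eq_integral do rewrite big_nil.
by rewrite integral_cst ?mul1e//; exact: measurable_weight_event.
Qed.

Let joint_set : set (set Om) :=
  [set C | exists D E, [/\ measurable D, seq_sigma Z E & C = weight_event D `&` E]].

(** The two sides of the sampling identity are finite measures in [C]; they are compared on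
    intersections of a weight event and a type event, where the types factor out. *)
Lemma joint_sampling : sampling P (joint_sigma p Z)
  (fun k => p k : Om -> R) (fun i => I i : Om -> nat).
Proof.
move=> C FC s k us.
pose f w : \bar R := (\prod_(i <- s) (p (k i) w)%:E)%E.
have mf : measurable_fun setT f by apply: emeasurable_prod => i; exact/measurable_EFinP.
have f0 w : (0 <= f w)%E.
  by apply: prode_ge0 => i _; rewrite lee_fin; have /andP[] := p01 (k i) w.
have mA := measurable_index_event s k.
have ZT : seq_sigma Z setT.
  by rewrite -setC0; apply: sigma_algebraC; exact: sigma_algebra0.
pose nu : {measure set Om -> \bar R} := density_measure P f.
have := @finite_measure_unique R _ Om joint_set (mrestr P mA) (nu mf f0).
move=> /(_ _ _ _ _ _ C); apply.
- move=> _ [D [E [mD ZE ->]]]; apply: measurableI; first exact: measurable_weight_event.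
  exact: seq_sigma_measurable ZE.
- by exists setT, setT; split=> //; rewrite weight_eventT setIT.
- move=> _ _ [D [E [mD ZE ->]]] [D' [E' [mD' ZE' ->]]]; exists (D `&` D'), (E `&` E').
  split; [exact: measurableI| |by rewrite setIACA].
  exact: (sigma_algebra_setI (smallest_sigma_algebra _ _)).
- by rewrite /= /mrestr setTI ltey_eq fin_num_prob.
- move=> _ [D [E [mD ZE ->]]].
  have mE := seq_sigma_measurable ZE.
  rewrite /= /mrestr /density_measure -setIA [E `&` _]setIC setIA joint_index_type//.
  pose h (v : seqspace R) : \bar R :=
    ((\prod_(i <- s) (`|(v : nat -> R) (k i)|)%:E) * (\1_D v)%:E)%E.
  have mh : measurable_fun [set: seqspace R] h.
    apply: emeasurable_funM; last by apply/measurable_EFinP; exact: measurable_indic.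
    apply: emeasurable_prod => i; apply/measurable_EFinP.
    by apply: measurableT_comp => //; exact: measurable_coord.
  have h0 v : (0 <= h v)%E by rewrite mule_ge0// ?lee_fin// prode_ge0.
  have hE w : h (fun j => p j w) = (f \_ (weight_event D)) w.
    rewrite patchE /h indicE /f (_ : (w \in weight_event D) = ((fun j => p j w) \in D))//.
    case: ifP => _; rewrite ?mule0// mule1.
    by apply: eq_bigr => i _; rewrite ger0_norm//; have /andP[] := p01 (k i) w.
  rewrite [X in (X * _)%E]integral_mkcond setIC integral_mkcondr.
  under eq_integral do rewrite -hE.
  under [RHS]eq_integral do rewrite -hE.
  apply/esym/(@integral_indep _ _ _ P _ (seqspace R)) => //.
    exact: (@measurable_seq _ R _ _ (fun k w => p k w)).
  move=> D' mD'; apply: joint_indep => //; rewrite seq_sigmaE.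
  by exists D' => //; rewrite setTI.
- move: FC; apply: smallest_sub; first exact: smallest_sigma_algebra.
  move=> A [|] hA; apply: sub_sigma_algebra.
    move: hA; rewrite seq_sigmaE => -[D mD <-]; exists D, setT; split => //.
    by rewrite setTI setIT.
  by exists setT, A; split=> //; rewrite weight_eventT setTI.
Qed.

End joint_species.

Lemma ae_same_law (R : realType) (d1 d2 d : measure_display)
    (Om1 : measurableType d1) (Om2 : measurableType d2) (S : measurableType d)
    (P1 : probability Om1 R) (P2 : probability Om2 R) (Y1 : Om1 -> S) (Y2 : Om2 -> S) (W : set S) :
  measurable_fun setT Y1 -> measurable_fun setT Y2 ->
  same_law P1 P2 Y1 Y2 -> measurable W ->
  {ae P2, forall w, W (Y2 w)} -> {ae P1, forall w, W (Y1 w)}.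
Proof.
move=> m1 m2 Y12 mW [N [mN N0 NW]]; have mWC := measurableC mW.
exists (Y1 @^-1` ~` W); split => //.
  by rewrite -[X in measurable X]setTI; exact: m1.
rewrite Y12//; apply: (subset_measure0 _ mN _ N0).
  by rewrite -[X in measurable X]setTI; exact: m2.
by move=> w; exact: NW.
Qed.

Section reconstruction.
Context (R : realType) (d : measure_display) (T : measurableType d).

Local Notation S := (seqspace T).
Local Notation T3 := ((S * seqspace nat) * S)%type.

Definition index_freq (j : nat) (t : T3) : R :=
  clamp (fine (limsup_freq R (fun i => (t.1.2 : nat -> nat) i == j))).

(** One more than the first time of index j; the value 0 means that j never occurs. *)
Definition hit_time (j : nat) (f : nat -> nat) : nat :=
  if pselect (exists n, f n == j) is left e then (ex_minn e).+1 else 0%N.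

(* the value of the sequence when its index is j, and the j-th reserve value
   if j is never an index *)
Definition index_type (j : nat) (t : T3) : T :=
  if hit_time j t.1.2 is n.+1 then (t.1.1 : nat -> T) n else (t.2 : nat -> T) j.

Lemma hit_timeP j f n : hit_time j f = n.+1 -> f n = j.
Proof.
rewrite /hit_time; case: pselect => // e [].
by case: ex_minnP => m /eqP fm _ <-.
Qed.

Lemma hit_time_gt0 f n : hit_time (f n) f != 0%N.
Proof. by rewrite /hit_time; case: pselect => // -[]; exists n. Qed.

Lemma measurable_hit_time j k : measurable ([set f | hit_time j f = k] : set (seqspace nat)).
Proof.
have m0 : measurable ([set f | hit_time j f = 0%N] : set (seqspace nat)).
  rewrite (_ : [set f | _] = \bigcap_n ~` ((fun f : seqspace nat => (f : nat -> nat) n) @^-1` [set j])).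
    apply: bigcap_measurableType => n _; apply: measurableC.
    by rewrite -[X in measurable X]setTI; exact: measurable_coord.
  apply/seteqP; split=> f /=.
    by move=> h n _ fn; have := hit_time_gt0 f n; rewrite fn h.
  move=> h; rewrite /hit_time; case: pselect => // e; have [n /eqP fn] := e.
  by have := h n Logic.I; rewrite /= fn.
case: k => [//|k].
pose A : set (seqspace nat) := [set f : nat -> nat | f k = j /\ forall m, (m < k)%N -> f m <> j].
rewrite (_ : [set f | _] = A).
  apply: (@measurable_finite_dep k.+1) => f g fg [fk fm]; split; first by rewrite -fg.
  by move=> m mk; rewrite -fg; [exact: fm|exact: ltnW].
apply/seteqP; split=> f /=.
  rewrite /hit_time; case: pselect => // e [].
  case: ex_minnP => m /eqP fm mmin mk; rewrite /A /= -mk; split=> // i im fi.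
  by have := mmin i; rewrite fi eqxx leqNgt im => /(_ isT).
move=> [fk fm]; rewrite /hit_time; case: pselect => [e|[]]; last by exists k; rewrite fk.
case: ex_minnP => m /eqP fmj mmin; congr _.+1; apply/eqP; rewrite eqn_leq mmin ?fk//=.
by rewrite leqNgt; apply/negP => /fm.
Qed.

Let m12 : measurable_fun setT (fun t : T3 => t.1.2).
Proof. exact: (measurableT_comp measurable_snd measurable_fst). Qed.

Let m11 : measurable_fun setT (fun t : T3 => t.1.1).
Proof. exact: (measurableT_comp measurable_fst measurable_fst). Qed.

Lemma measurable_index_freq j : measurable_fun setT (index_freq j).
Proof.
apply: measurableT_comp; first exact: measurable_clamp.
apply: (measurableT_comp (fine_measurable measurableT)).
rewrite (_ : (fun t => _) = (fun t : T3 => limsup_freq R (fun i => t \in [set t : T3 | (t.1.2 : nat -> nat) i = j]))).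
  apply: measurable_limsup_freq => i.
  rewrite -[X in measurable X]setTI.
  have mi : measurable_fun setT (fun t : T3 => (t.1.2 : nat -> nat) i).
    exact: (measurableT_comp (@measurable_coord _ nat i) m12).
  exact: (mi measurableT [set j]).
apply/funext => t; congr limsup_freq; apply/funext => i.
by apply/eqP/idP; rewrite inE.
Qed.

Lemma measurable_index_type j : measurable_fun setT (index_type j).
Proof.
pose f (n : nat) (t : T3) : T := if n is m.+1 then (t.1.1 : nat -> T) m else (t.2 : nat -> T) j.
rewrite (_ : index_type j = fun t => f (hit_time j t.1.2) t)//.
apply: (@measurable_select _ _ _ _ f (fun t : T3 => hit_time j t.1.2)).
  case=> [|m]; first exact: (measurableT_comp (measurable_coord j) measurable_snd).
  exact: (measurableT_comp (@measurable_coord _ T m) m11).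
move=> k; rewrite -[X in measurable X]setTI.
have h := m12 measurableT (measurable_hit_time j k); exact: h.
Qed.

Lemma measurable_freq_event (D : set (seqspace R)) : measurable D ->
  measurable [set t : T3 | D (fun j => index_freq j t)].
Proof.
move=> mD; rewrite -[X in measurable X]setTI.
have mfr : measurable_fun setT (fun t : T3 => (fun j => index_freq j t) : seqspace R).
  by apply: (@measurable_seq _ R _ _ (fun j (t : T3) => index_freq j t)) => j; exact: measurable_index_freq.
exact: mfr.
Qed.

Lemma measurable_index_at n : measurable_fun setT (fun t : T3 => (t.1.2 : nat -> nat) n).
Proof. exact: (measurableT_comp (@measurable_coord _ nat n) m12). Qed.

Lemma measurable_value_at n : measurable_fun setT (fun t : T3 => (t.1.1 : nat -> T) n).
Proof. exact: (measurableT_comp (@measurable_coord _ T n) m11). Qed.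

Lemma measurable_indices (s : seq nat) (k : nat -> nat) :
  measurable [set t : T3 | forall i, i \in s -> (t.1.2 : nat -> nat) i = k i].
Proof.
rewrite (_ : [set t | _] = \bigcap_(i in [set` s]) ((fun t : T3 => (t.1.2 : nat -> nat) i) @^-1` [set k i])) //.
apply: bigcap_measurableType => i _; rewrite -[X in measurable X]setTI.
exact: measurable_index_at.
Qed.

Lemma measurable_types n (B : nat -> set T) : (forall i, measurable (B i)) ->
  measurable [set t : T3 | forall j, (j < n)%N -> B j (index_type j t)].
Proof.
move=> mB; rewrite (_ : [set t | _] = \bigcap_(j in `I_n) (@index_type j @^-1` B j)) //.
apply: bigcap_measurableType => j _; rewrite -[X in measurable X]setTI.
exact: measurable_index_type.
Qed.

End reconstruction.

Section reconstructed_law.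
Context (R : realType) (d d' : measure_display) (Om : measurableType d) (T : measurableType d').
Variables (P : probability Om R) (H : probability T R).
Variables (p : nat -> {RV P >-> R}) (Z : nat -> {RV P >-> T}) (I : nat -> {RV P >-> nat}).
Hypothesis Z_iid : iid Z H.
Hypothesis p01 : random_weights p.
Hypothesis pZ : indep_systems P (seq_sigma p) (seq_sigma Z).
Hypothesis sI : sampling P (joint_sigma p Z) (fun k => p k : Om -> R) (fun i => I i : Om -> nat).
Hypothesis pfreq : {ae P, forall w, forall j, limsup_freq R (fun i => I i w == j) = (p j w)%:E}.

Local Notation S := (seqspace T).
Local Notation T3 := ((S * seqspace nat) * S)%type.
Local Notation P2 := (P \x P)%E.

(** All that the reconstruction may look at: values, indices and a reserve of types. The same data
    will be available around [xi]. *)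
Definition recorded (w : Om * Om) : T3 :=
  (((fun n => Z (I n w.1) w.1) : S, (fun n => I n w.1) : seqspace nat), (fun n => Z n w.2) : S).

Lemma measurable_recorded : measurable_fun setT recorded.
Proof.
apply: measurable_fun_pair; last first.
  by apply: measurable_seq => n; exact: (measurableT_comp (measurable_funP (Z n)) measurable_snd).
apply: measurable_fun_pair.
  apply: measurable_seq => n.
  exact: (measurableT_comp (measurable_index_value Z I n) measurable_fst).
apply: (@measurable_seq _ nat _ _ (fun n w => I n w.1)) => n.
exact: (measurableT_comp (measurable_funP (I n)) measurable_fst).
Qed.

Let p0 k w : 0 <= p k w. Proof. by have [h _] := p01; have /andP[] := h k w. Qed.

(** Slot j.*2 keeps type j if index j occurs, slot j.*2.+1 takes it from the reserve otherwise. The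
    types read off a record are thus an instance of [relabeled]. *)
Let sel (f : seqspace nat) j : nat := if hit_time j f == 0%N then j.*2.+1 else j.*2.

Let msel j k : measurable [set f | sel f j = k].
Proof.
rewrite (_ : [set f | _] = ([set f : seqspace nat | hit_time j f = 0%N] `&`
     (if j.*2.+1 == k then setT else set0)) `|`
   (~` [set f : seqspace nat | hit_time j f = 0%N] `&` (if j.*2 == k then setT else set0))).
  apply: measurableU; apply: measurableI.
  - exact: measurable_hit_time.
  - by case: ifP.
  - by apply: measurableC; exact: measurable_hit_time.
  - by case: ifP.
apply/seteqP; split=> f; rewrite /sel /=.
  case: eqP => f0 <-; rewrite eqxx; first by left.
  by right.
by move=> [[-> ]|[/eqP/negbTE ->]]; rewrite ?eqxx; case: eqP.
Qed.

Let sel_inj f : injective (sel f).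
Proof.
move=> i j; rewrite /sel; case: ifP => _; case: ifP => _.
- by move=> [] /double_inj.
- by move=> /(congr1 odd); rewrite /= !odd_double.
- by move=> /(congr1 odd); rewrite /= !odd_double.
- by move=> /double_inj.
Qed.

Let Z' : nat -> {RV P2 >-> T} := relabeled p Z I msel.

Let relabeledE j w : index_type j (recorded w) = Z' j w.
Proof.
rewrite /index_type /recorded /Z' /relabeled /selected /= /sel.
case E: hit_time => [|n] /=; rewrite /interleave_fun /=.
  by rewrite odd_double /= uphalf_double.
by rewrite odd_double doubleK (hit_timeP E).
Qed.

Lemma recorded_value n w : index_type (I n w.1) (recorded w) = Z (I n w.1) w.1.
Proof.
rewrite /index_type /recorded /=.
have := hit_time_gt0 (fun n => I n w.1) n; case E: hit_time => [//|m] _.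
by rewrite -{1}(hit_timeP E).
Qed.

Lemma recorded_freq : {ae P2, forall w, forall j, index_freq R j (recorded w) = p j w.1}.
Proof.
pose f1 : {mfun (Om * Om)%type >-> Om} := mfun_Sub (mem_set measurable_fst).
have mf1 : measure_preserving P P2 f1 by move=> A mA; exact: prod_fst.
apply: filterS (ae_pullback mf1 pfreq) => w h j.
have [p01' _] := p01.
by rewrite /index_freq /= h /= clamp_id.
Qed.

Let weight_preimage (D : set (seqspace R)) : set T3 := [set t | D (fun j => index_freq R j t)].

(** In the model the frequencies are almost surely the weights, and the reconstructed types are
    independent of weights and indices together; the sampling identity then evaluates the remaining
    factor. *)
Lemma recorded_joint (D : set (seqspace R)) s k n (B : nat -> set T) :
  measurable D -> uniq s -> (forall i, measurable (B i)) ->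
  P2 (recorded @^-1` ((weight_preimage D `&`
        [set t : T3 | forall i, i \in s -> (t.1.2 : nat -> nat) i = k i]) `&`
        [set t | forall j, (j < n)%N -> B j (index_type j t)])) =
  ((\int[P2]_(w in recorded @^-1` weight_preimage D)
     \prod_(i <- s) (index_freq R (k i) (recorded w))%:E) * \prod_(j < n) H (B j))%E.
Proof.
move=> mD us mB.
pose D1 : set Om := [set w | D (fun j => p j w)].
pose A1 : set Om := [set w | forall i, i \in s -> I i w = k i].
pose B2 : set (Om * Om) := [set w | forall j, (j < n)%N -> B j (Z' j w)].
have mD1 : measurable D1.
  rewrite -[X in measurable X]setTI; exact: (@measurable_seq _ R _ _ (fun j w => p j w)).
have FD1 : joint_sigma p Z D1.
  by apply: sub_sigma_algebra; left; rewrite seq_sigmaE; exists D => //; rewrite setTI.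
have GA1 : weight_index_sigma p I A1.
  apply: (@weight_index_sigma_index _ _ _ _ _ _ [set f : nat -> nat | forall i, i \in s -> f i = k i]).
  rewrite (_ : [set f | _] = \bigcap_(i in [set` s]) ((fun f : seqspace nat => (f : nat -> nat) i) @^-1` [set k i])) //.
  apply: bigcap_measurableType => i _.
  by rewrite -[X in measurable X]setTI; exact: measurable_coord.
have GD1 : weight_index_sigma p I D1 by exact: weight_index_sigma_weight.
have Gg : weight_index_sigma p I (D1 `&` A1).
  exact: (sigma_algebra_setI (sigma_algebra_weight_index p I)).
have mfst A : measurable A -> measurable ((fst : Om * Om -> Om) @^-1` A).
  by move=> mA; rewrite -[X in measurable X]setTI; exact: measurable_fst.
have mrec W : measurable W -> measurable (recorded @^-1` W).
  by move=> mW; rewrite -[X in measurable X]setTI; exact: measurable_recorded.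
have mpre : measurable (weight_preimage D) by exact: measurable_freq_event.
have mind := @measurable_indices _ T s k.
have mtyp := measurable_types n mB.
have mB2 : measurable B2.
  rewrite (_ : B2 = \bigcap_(j in `I_n) (Z' j @^-1` B j)) //.
  apply: bigcap_measurableType => j _; rewrite -[X in measurable X]setTI.
  exact: measurable_funP.
have recD : {ae P2, forall w, weight_preimage D (recorded w) <-> D1 w.1}.
  apply: filterS recorded_freq => w h; rewrite /weight_preimage /D1 /=.
  by rewrite (_ : (fun j => index_freq R j (recorded w)) = (fun j => p j w.1))//; apply/funext.
have h := relabeled_rect Z_iid p0 pZ sI msel sel_inj n Gg mB.
apply: etrans (etrans _ h) _.
- apply: ae_eq_prob.
  + by apply: mrec; apply: measurableI => //; exact: measurableI.
  + by apply: measurableI => //; apply: mfst; exact: weight_index_sigma_measurable Gg.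
  + apply: filterS recD => w wD; split=> /=.
      move=> [[/wD w1 w2] w3]; split=> //= j jn.
      by have := w3 j jn; rewrite relabeledE.
    move=> [w3 [/wD w1 w2]]; split=> // j jn.
    by rewrite /= relabeledE; exact: w3.
congr (_ * _)%E.
apply: etrans (sI FD1 k us) _.
pose f w : \bar R := (\prod_(i <- s) (p (k i) w)%:E)%E.
have mf : measurable_fun [set: Om] f.
  by apply: emeasurable_prod => i; exact/measurable_EFinP.
have f0 w : (0 <= f w)%E by apply: prode_ge0 => i _; rewrite lee_fin.
have fl : same_law P2 P (fst : Om * Om -> Om) idfun by move=> C mC; exact: prod_fst.
have h2 := same_law_integral measurable_fst (@measurable_id _ _ setT) fl mD1 mf f0.
apply: etrans (esym h2) _.
rewrite [LHS]integral_mkcond [RHS]integral_mkcond; apply: ae_eq_integral => //.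
- apply/(measurable_restrictT _ _).1; first exact: mfst.
  by apply: measurable_funTS; exact: (measurableT_comp mf measurable_fst).
- apply/(measurable_restrictT _ _).1; first exact: mrec.
  apply: measurable_funTS; apply: emeasurable_prod => i; apply/measurable_EFinP.
  exact: (measurableT_comp (@measurable_index_freq R _ T (k i)) measurable_recorded).
- apply: filterS2 recD recorded_freq => w wD h3 _; rewrite !patchE.
  rewrite (_ : (w \in fst @^-1` D1) = (w \in recorded @^-1` weight_preimage D)).
    by case: ifP => // _; apply: eq_bigr => i _; rewrite h3.
  by apply/idP/idP; rewrite !inE => /wD.
Qed.

End reconstructed_law.

(** * Drawing indices for a sequence that has the right law *)

Section index_coupling.
Context (R : realType) (d d1 d' : measure_display).
Context (Om : measurableType d) (Om1 : measurableType d1) (S : measurableType d').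
Variables (P : probability Om R) (P1 : probability Om1 R).
Variables (X0 : {RV P >-> S}) (X1 : {RV P1 >-> S}) (I : nat -> {RV P1 >-> nat}).
Hypothesis X_law : same_law P P1 X0 X1.

Local Notation U := (uniform_prob (@ltr01 R)).

Let m := prefix_prob X1 I.

Let redraw n (z : Om * measurableTypeR R) : nat := draw m n (X0 z.1, z.2).

Let mpair : measurable_fun setT (fun z : Om * measurableTypeR R => (X0 z.1, z.2)).
Proof.
apply: measurable_fun_pair; last exact: measurable_snd.
exact: (measurableT_comp (measurable_funP X0) measurable_fst).
Qed.

Let mdraw n k : measurable (draw m n @^-1` [set k]).
Proof.
apply: measurable_draw.
- by move=> t; exact: measurable_prefix_prob.
- by move=> t x; exact: prefix_prob_ge0.
- by move=> t x; exact: prefix_prob_sum.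
Qed.

Let mredraw n : measurable_fun setT (redraw n).
Proof.
apply: (measurableT_comp (f := draw m n) _ mpair) => _ B _.
by rewrite setTI; exact: (measurable_preimage_nat B (mdraw n)).
Qed.

(** The sampler is run with the conditional prefix probabilities of [I] given [X1], evaluated at
    [X0]; equality of the laws of [X0] and [X1] makes the pairs agree on all prefixes. *)
Lemma index_coupling : exists I' : nat -> {RV (P \x U)%E >-> nat},
  same_law (P \x U)%E P1 (fun z => (X0 z.1, (fun n => I' n z) : seqspace nat))
                         (fun w => (X1 w, (fun n => I n w) : seqspace nat)).
Proof.
exists (fun n => mkRV (P \x U)%E (mredraw n)).
have mX0 : measurable_fun setT (fun z : Om * measurableTypeR R => X0 z.1).
  exact: (measurableT_comp (measurable_funP X0) measurable_fst).
apply: (pair_same_law (X1 := mkRV (P \x U)%E mX0)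
   (I1 := fun n => mkRV (P \x U)%E (mredraw n))) => B t mB.
apply: etrans (integral_prefix_prob X1 I t mB).
(* The law of [X1] on [S] serves as an intermediate space: there [draw_law] computes the prefixes,
   and the draws from [X0] are compared with it. *)
have Qlaw : same_law P (distribution P1 X1) X0 idfun by move=> C mC; exact: X_law.
pose V : {RV U >-> measurableTypeR R} := mkRV U (@measurable_id _ (measurableTypeR R) setT).
have h := prod_same_law V (measurable_funP X0) (@measurable_id _ S setT) Qlaw.
have dl := draw_law (measurable_prefix_prob X1 I) (prefix_prob_ge0 X1 I) (prefix_prob_nil X1 I)
  (prefix_prob_sum X1 I) (distribution P1 X1) t mB.
apply: etrans dl.
have mW : measurable ((B `*` setT) `&` [set z : S * measurableTypeR R |
    forall i, (i < size t)%N -> draw m i z = nth 0%N t i]).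
  apply: measurableI; first exact: measurableX.
  rewrite (_ : [set z | _] = \bigcap_(i in `I_(size t)) (draw m i @^-1` [set nth 0%N t i])) //.
  by apply: bigcap_measurableType => i _; exact: mdraw.
apply: etrans (etrans (h _ mW) _).
  congr ((P \x U)%E _); apply/seteqP; split=> z /=; first by move=> [? ?].
  by move=> [[? _] ?].
congr ((distribution P1 X1 \x U)%E _).
by apply/seteqP; split=> -[x u].
Qed.

End index_coupling.

Section law_to_weights.
Context (R : realType) (X : ptopologicalType) (q : seq nat -> R).
Context (H : probability (borel X) R).
Hypothesis hX : polish R X.
Context (d1 : measure_display) (Om1 : measurableType d1) (P1 : probability Om1 R).
Variables (p : nat -> {RV P1 >-> R}) (Z : nat -> {RV P1 >-> borel X}) (I : nat -> {RV P1 >-> nat}).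
Hypothesis pZ : species_data q H p Z.
Hypothesis p_sorted : sorted_weights_eppf p q.
Hypothesis sI : sampling P1 (joint_sigma p Z) (fun k => p k : Om1 -> R) (fun i => I i : Om1 -> nat).
Hypothesis pfreq : {ae P1, forall w, forall j, limsup_freq R (fun i => I i w == j) = (p j w)%:E}.
Context (d : measure_display) (Om : measurableType d) (P : probability Om R).
Variable xi : nat -> {RV P >-> borel X}.
Hypothesis xi_law : same_law P P1 (fun w => (fun n => xi n w) : seqspace (borel X))
                      (fun w => (fun n => Z (I n w) w) : seqspace (borel X)).

Local Notation S := (seqspace (borel X)).
Local Notation T3 := ((S * seqspace nat) * S)%type.
Local Notation U := (uniform_prob (@ltr01 R)).
Local Notation Om' := ((Om * measurableTypeR R) * Om1)%type.
Local Notation P' := ((P \x U) \x P1)%E.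

(** Everything asked of weights, types and indices is an event or an identity in law about records,
    so it is established for [recorded] in the model and carried over. *)
Lemma law_weights : weights_representation q H xi.
Proof.
have mxi0 : measurable_fun setT (fun w => (fun n => xi n w) : S) by exact: measurable_seq.
have mxi1 : measurable_fun setT (fun w => (fun n => Z (I n w) w) : S).
  by apply: measurable_seq => n; exact: (measurable_index_value Z I).
have [I0 I0law] := index_coupling (X0 := mkRV P mxi0) (X1 := mkRV P1 mxi1) I xi_law.
have mZ : measurable_fun setT (fun w => (fun n => Z n w) : S) by exact: measurable_seq.
(* The record around [xi]: its values, the drawn indices, and a reserve from the independent factor
   [Om1]. *)
pose Y' (z : Om') : T3 := (((fun n => xi n z.1.1), (fun n => I0 n z.1)), (fun n => Z n z.2)).
have mY0 : measurable_fun setT (fun z : Om * measurableTypeR R =>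
    ((fun n => xi n z.1, fun n => I0 n z) : (S * seqspace nat)%type)).
  apply: measurable_fun_pair; first exact: (measurableT_comp mxi0 measurable_fst).
  exact: (@measurable_seq _ nat _ _ (fun n z => I0 n z)).
have mY1 : measurable_fun setT (fun w : Om1 =>
    ((fun n => Z (I n w) w, fun n => I n w) : (S * seqspace nat)%type)).
  apply: measurable_fun_pair => //.
  exact: (@measurable_seq _ nat _ _ (fun n z => I n z)).
have mY' : measurable_fun setT Y'.
  apply: measurable_fun_pair; first exact: (measurableT_comp mY0 measurable_fst).
  exact: (measurableT_comp mZ measurable_snd).
have Ylaw : same_law P' (P1 \x P1)%E Y' (recorded Z I).
  exact: (prod_same_law (mkRV P1 mZ) mY0 mY1 I0law).
have mrec := measurable_recorded Z I.
have [ZH p01 pZi _] := pZ.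
have mp' j : measurable_fun setT (fun z => index_freq R j (Y' z)).
  exact: (measurableT_comp (@measurable_index_freq R _ (borel X) j) mY').
have mZ' j : measurable_fun setT (fun z => index_type j (Y' z)).
  exact: (measurableT_comp (@measurable_index_type _ (borel X) j) mY').
have mI' n : measurable_fun setT (fun z : Om' => I0 n z.1).
  exact: (measurableT_comp (measurable_funP (I0 n)) measurable_fst).
have mphi : measurable_fun setT (fun z : Om' => z.1.1).
  exact: (measurableT_comp measurable_fst measurable_fst).
pose p' j : {RV P' >-> R} := mkRV P' (mp' j).
pose Z' j : {RV P' >-> borel X} := mkRV P' (mZ' j).
pose I' n : {RV P' >-> nat} := mkRV P' (mI' n).
have p'01 k z : 0 <= p' k z <= 1 by exact: clamp01.
have freq_event (D : set (seqspace R)) : measurable D -> measurable [set t : T3 | D (fun j => index_freq R j t)].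
  by move=> mD; exact: measurable_freq_event.
have joint (D : set (seqspace R)) (s : seq nat) (k : nat -> nat) (n : nat) (B : nat -> set (borel X)) : measurable D -> uniq s -> (forall i, measurable (B i)) ->
  P' ((weight_event p' D `&` index_event I' s k) `&` type_event Z' n B) =
  ((\int[P']_(w in weight_event p' D) \prod_(i <- s) (p' (k i) w)%:E) * \prod_(j < n) H (B j))%E.
  move=> mD us mB.
  have rj := recorded_joint ZH p01 pZi sI pfreq k n mD us mB.
  pose f (t : T3) : \bar R := (\prod_(i <- s) (index_freq R (k i) t)%:E)%E.
  have mf : measurable_fun [set: T3] f.
    by apply: emeasurable_prod => i; apply/measurable_EFinP; exact: measurable_index_freq.
  have f0 t : (0 <= f t)%E.
    by apply: prode_ge0 => i _; rewrite lee_fin; have /andP[] := clamp01 (fine (limsup_freq R (fun j => (t.1.2 : nat -> nat) j == k i))).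
  have mW := measurableI _ _ (measurableI _ _ (freq_event D mD) (@measurable_indices _ (borel X) s k))
    (measurable_types n mB).
  have hl := Ylaw _ mW.
  apply: etrans (etrans hl _) (congr1 (fun x => (x * _)%E) (esym (same_law_integral mY' mrec Ylaw (freq_event D mD) mf f0))).
  exact: rj.
have sI' := joint_sampling p'01 joint.
have [_ p1] := p01.
pose f1 : {mfun (Om1 * Om1)%type >-> Om1} := mfun_Sub (mem_set measurable_fst).
have mf1 : measure_preserving P1 (P1 \x P1)%E f1 by move=> A mA; exact: prod_fst.
have rec_freq := recorded_freq Z p01 pfreq.
have p'rw : random_weights p'.
  split=> //; apply: (ae_same_law (S := T3)
     (W := [set t : T3 | (\sum_(0 <= j <oo) (index_freq R j t)%:E = 1)%E]) mY' mrec Ylaw).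
    rewrite -[X in measurable X]setTI; apply: measurable_eqe => //.
    apply: ge0_emeasurable_sum => j.
      by move=> t _ _; rewrite lee_fin; have /andP[] := clamp01 (fine (limsup_freq R (fun i => (t.1.2 : nat -> nat) i == j))).
    by move=> _; apply/measurable_EFinP; exact: measurable_index_freq.
  apply: filterS2 rec_freq (ae_pullback mf1 p1) => w h1 h2 /=.
  by rewrite -[RHS]h2; apply: eq_eseriesr => j _; rewrite h1.
have [cI iI] := sampling_cond p'rw sI'.
exists _, Om', P', (mfun_Sub (mem_set mphi)), p', Z', I'; split=> //.
- move=> A mA; have mA1 : measurable ((fst : Om * measurableTypeR R -> Om) @^-1` A).
    by rewrite -[X in measurable X]setTI; exact: measurable_fst.
  apply: etrans (prod_fst _ P1 mA1) _; exact: prod_fst.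
- split.
  + exact: joint_iid joint.
  + by [].
  + exact: joint_indep joint.
  (* Being decreasing is a measurable event on records, and the new weights have the law of p; this
     is where sortedness is used. *)
  + have [ps [d2 [Om2 [Q [Pi [v [qPi vPi pv]]]]]]] := p_sorted.
    apply: sorted_weights_eppfW; first by move=> k z; have /andP[] := p'01 k z.
    split.
      apply: (ae_same_law (S := T3) (W := [set t : T3 | forall i j, (i <= j)%N ->
          index_freq R j t <= index_freq R i t]) mY' mrec Ylaw).
        rewrite (_ : [set t | _] = \bigcap_i \bigcap_j (if (i <= j)%N then
            (fun t : T3 => index_freq R j t <= index_freq R i t) @^-1` [set true] else setT)).
          apply: bigcapT_measurable => i; apply: bigcapT_measurable => j.
          case: ifP => // _; rewrite -[X in measurable X]setTI.
          by apply: measurable_fun_ler => //; exact: measurable_index_freq.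
        apply/seteqP; split=> t /= h.
          by move=> i _ j _; case: ifP => // /h.
        by move=> i j ij; have := h i Logic.I j Logic.I; rewrite ij.
      apply: filterS2 rec_freq (ae_pullback mf1 ps) => w h1 h2 /= i j ij.
      by rewrite !h1; exact: h2.
    exists d2, Om2, Q, Pi, v; split=> // B mB; rewrite pv//.
    apply/esym; apply: etrans (Ylaw _ (freq_event B mB)) _.
    have mpB : measurable ((fun w => (fun n => p n w) : seqspace R) @^-1` B).
      by rewrite -[X in measurable X]setTI; exact: (@measurable_seq _ R _ _ (fun n w => p n w)).
    apply: etrans (prod_fst P1 P1 mpB); apply: ae_eq_prob.
    * by rewrite -[X in measurable X]setTI; apply: mrec => //; exact: freq_event.
    * by rewrite -[X in measurable X]setTI; exact: measurable_fst.
    * apply: filterS rec_freq => w h /=.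
      by rewrite (_ : (fun j => index_freq R j (recorded Z I w)) = (fun n => p n w.1))//; apply/funext.
(* The identity between value and indexed type is itself an event on records, measurable because the
   diagonal is, and in the model it holds everywhere. *)
- move=> n; apply: (ae_same_law (S := T3) (W := [set t : T3 | (t.1.1 : nat -> borel X) n =
       index_type ((t.1.2 : nat -> nat) n) t]) mY' mrec Ylaw).
    apply: (measurable_eq_fun hX); first exact: measurable_value_at.
    apply: (@measurable_select _ _ _ _ (@index_type _ (borel X)) (fun t : T3 => (t.1.2 : nat -> nat) n)).
      by move=> j; exact: measurable_index_type.
    move=> j; rewrite -[X in measurable X]setTI.
    exact: (@measurable_index_at _ (borel X) n measurableT [set j]).
  by apply: aeW => w; rewrite /= recorded_value.
Qed.

End law_to_weights.

(** Taking [E k] full for k = j and empty otherwise makes the counted event depend on the index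
    alone. *)
Lemma model_index_freq (R : realType) (X : ptopologicalType) (q : seq nat -> R)
    (H : probability (borel X) R) (d : measure_display) (Om : measurableType d)
    (P : probability Om R) (p : nat -> {RV P >-> R}) (Z : nat -> {RV P >-> borel X})
    (pZ : species_data q H p Z) :
  {ae (P \x uniform_prob (@ltr01 R))%E, forall z, forall j,
     limsup_freq R (fun i => model_index pZ i z == j) = (model_weight p j z)%:E}.
Proof.
have [_ [p01 _] _ _] := model_species pZ.
apply: ae_foralln => j.
have mE k : measurable ((if k == j then setT else set0) : set Om) by case: ifP.
apply: filterS (model_frequency pZ mE) => z fz.
rewrite -(mix_eq (p := fun k => model_weight p k : _ -> R) _ j z); last first.
  by move=> k w; have /andP[] := p01 k w.
transitivity (limsup_freq R (fun i => z \in
    [set z | (if model_index pZ i z == j then setT else set0 : set Om) z.1])).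
  congr limsup_freq; apply/funext => i.
  by apply/idP/idP; rewrite inE /=; case: ifP.
apply: etrans fz _; congr mix; apply/funext => k.
by case: ifP; rewrite ?preimage_setT ?preimage_set0.
Qed.

Theorem proposition1 (R : realType) (X : ptopologicalType) (hX : polish R X)
    (H : probability (borel X) R) (q : seq nat -> R) (hq : proper_eppf q)
    (d : measure_display) (Om : measurableType d) (P : probability Om R)
    (xi : nat -> {RV P >-> borel X}) :
  [<-> gSSS q H xi;
       weights_representation q H xi;
       partition_representation q H xi].
Proof.
tfae.
- move=> /gSSS_law[d2 [Om2 [P2 [p [Z [I [pZ sI xi_law]]]]]]].
  have [ZH _ _ _] := pZ.
  (* The weights obtained from (i) need not be decreasing; they are exchanged for decreasing ones
     with the same [q], which leaves the law of the sequence unchanged. *)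
  have [d3 [Om3 [P3 [p3 [Z3 [pZ3 p3s]]]]]] := species_exist hq ZH.
  apply: (law_weights hX (model_species pZ3)
    (sorted_weights_eppf_pullback (model_preserving _) p3s) (model_sampling pZ3)
    (model_index_freq pZ3)) => B mB.
  rewrite xi_law//.
  exact: (species_same_law pZ sI (model_species pZ3) (model_sampling pZ3)).
- exact: weights_partition_representation.
- move=> xiP; have [d' [Om' [P' [phi [Pi [Z' [_ _ Z'H _ _]]]]]]] := xiP.
  (* The i.i.d. types of (iii), together with weights provided by properness of [q], make the
     comparison model. *)
  have [d3 [Om3 [P3 [p3 [Z3 [pZ3 _]]]]]] := species_exist hq Z'H.
  apply: (law_gSSS hX (pZ := pZ3)).
  exact: (partition_representation_law (model_species pZ3) (model_sampling pZ3) xiP).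
Qed.
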